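(* Let $k$ be a field and let $H$ be a finite-dimensional quasibialgebra over $k$. Let ${}_H\mathcal M$ be the monoidal category of left $H$-modules, ${}_H\mathcal M_f$ the full monoidal subcategory of finite-dimensional left $H$-modules, ${}_H\mathcal M^H_H$ the category of Hopf modules (right $H$-comodules in the monoidal category ${}_H\mathcal M_H$ of $H$-$H$-bimodules), and $\mathcal R\colon{}_H\mathcal M\to{}_H\mathcal M^H_H$ the functor $V\mapsto V\otimes H$ (Hopf module structure as specified in the context). Then the following are equivalent: (1) $H$ is a quasi-Hopf algebra. (2) The monoidal category ${}_H\mathcal M_f$ is rigid. (3) The functor $\mathcal R\colon{}_H\mathcal M\to{}_H\mathcal M^H_H$ is an equivalence of categories.
   Context: Quasibialgebra. A quasibialgebra $H$ over $k$ is an associative unital $k$-algebra with algebra maps $\Delta\colon H\to H\otimes H$ and $\varepsilon\colon H\to k$ and an invertible element $\phi\in H\otimes H\otimes H$ such that for all $h\in H$: $(\varepsilon\otimes H)\Delta(h)=h=(H\otimes\varepsilon)\Delta(h)$; $(H\otimes\Delta)\Delta(h)\cdot\phi=\phi\cdot(\Delta\otimes H)\Delta(h)$; $(H\otimes H\otimes\Delta)(\phi)\cdot(\Delta\otimes H\otimes H)(\phi)=(1\otimes\phi)\cdot(H\otimes\Delta\otimes H)(\phi)\cdot(\phi\otimes1)$; $(H\otimes\varepsilon\otimes H)(\phi)=1$. (Here $H$ as a map denotes the identity.) Write $\Delta(h)=h_{(1)}\otimes h_{(2)}$, $\phi=\phi^{(1)}\otimes\phi^{(2)}\otimes\phi^{(3)}$,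 $\phi^{-1}=\phi^{(-1)}\otimes\phi^{(-2)}\otimes\phi^{(-3)}$. Quasi-Hopf algebra. A quasiantipode $(S,\alpha,\beta)$ for $H$ consists of an algebra anti-endomorphism $S$ of $H$ (not required to be bijective) and elements $\alpha,\beta\in H$ such that for all $h\in H$: $S(h_{(1)})\alpha h_{(2)}=\varepsilon(h)\alpha$, $h_{(1)}\beta S(h_{(2)})=\varepsilon(h)\beta$, $\phi^{(1)}\beta S(\phi^{(2)})\alpha\phi^{(3)}=1$, $S(\phi^{(-1)})\alpha\phi^{(-2)}\beta S(\phi^{(-3)})=1$. A quasi-Hopf algebra is a quasibialgebra that has a quasiantipode. Monoidal categories. ${}_H\mathcal M$ is monoidal with tensor product $\otimes=\otimes_k$, diagonal action via $\Delta$, unit object $k$ (action via $\varepsilon$), and associativity isomorphism $\Phi\colon(U\otimes V)\otimes W\to U\otimes(V\otimes W)$, $\Phi(u\otimes v\otimes w)=\phi\cdot(u\otimes v\otimes w)$. The category ${}_H\mathcal M_H$ of $H$-$H$-bimodules is monoidal with $\otimes_k$, diagonal actions on both sides, and $\Phi(u\otimes v\otimes w)=\phi\cdot(u\otimes v\otimes w)\cdot\phi^{-1}$. With $\Delta$ and $\varepsilon$, $H$ is a coassociative counital coalgebra in ${}_H\mathcal M_H$. Hopf modules. ${}_H\mathcal M^H_H$ is the category of right $H$-comodules in ${}_H\mathcal M_H$: bimodules $M$ with a bimodule map $\rho\colon M\to M\otimes H$ satisfying $(M\otimes\varepsilon)\rho=\mathrm{id}$ and $\Phi(\rho\otimes H)\rho=(M\otimes\Delta)\rho$,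 i.e. $\phi\cdot(\rho\otimes H)\rho(m)\cdot\phi^{-1}=(M\otimes\Delta)\rho(m)$. Morphisms are bimodule maps commuting with the coactions. For a bimodule $P$, the cofree comodule is $P\otimes H$ with diagonal bimodule structure and coaction $P\otimes H\xrightarrow{P\otimes\Delta}P\otimes(H\otimes H)\xrightarrow{\Phi^{-1}}(P\otimes H)\otimes H$. The functor $\mathcal R$. For $V\in{}_H\mathcal M$, regard $V$ as a bimodule with right action via $\varepsilon$, and let $\mathcal R(V)=V\otimes H$ be the cofree comodule over it. Explicitly, $g(v\otimes h)j=g_{(1)}v\otimes g_{(2)}hj$ and $\rho(v\otimes h)=(\phi^{(-1)}v\otimes\phi^{(-2)}h_{(1)})\otimes\phi^{(-3)}h_{(2)}$. On morphisms, $\mathcal R(f)=f\otimes H$. Rigidity. A dual object of an object $V$ in a monoidal category is a triple $(V^\vee,\mathrm{ev},\mathrm{db})$ with morphisms $\mathrm{ev}\colon V^\vee\otimes V\to I$, $\mathrm{db}\colon I\to V\otimes V^\vee$ ($I$ the unit object) such that the composites $V\xrightarrow{\mathrm{db}\otimes V}(V\otimes V^\vee)\otimes V\xrightarrow{\Phi}V\otimes(V^\vee\otimes V)\xrightarrow{V\otimes\mathrm{ev}}V$ and $V^\vee\xrightarrow{V^\vee\otimes\mathrm{db}}V^\vee\otimes(V\otimes V^\vee)\xrightarrow{\Phi^{-1}}(V^\vee\otimes V)\otimes V^\vee\xrightarrow{\mathrm{ev}\otimes V^\vee}V^\vee$ are identities. A monoidal category is rigid if every object has a dual object in this sense. *)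

(* Defs.v *)
From HB Require Import structures.
From mathcomp Require Import all_boot all_algebra.
From mathcomp Require Import boolp.

Set Implicit Arguments.
Unset Strict Implicit.
Unset Printing Implicit Defensive.

Import GRing.Theory.
Local Open Scope ring_scope.
Local Open Scope quotient_scope.

Notation bilin f := (bilinear_for *:%R *:%R f).

Section Linear.
Variable k : fieldType.
Implicit Types U V W : lmodType k.

Lemma linD U V (f : U -> V) : linear f -> {morph f : x y / x + y}.
Proof. by move=> fL x y; have := fL 1 x y; rewrite !scale1r. Qed.

Lemma lin0 U V (f : U -> V) : linear f -> f 0 = 0.
Proof. by move=> fL; apply: (addIr (f 0)); rewrite -linD // !add0r. Qed.

Lemma linZ U V (f : U -> V) : linear f -> forall a, {morph f : x / a *: x}.
Proof. by move=> fL a x; have := fL a x 0; rewrite /= (lin0 fL) !addr0. Qed.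

Lemma linI U V (f : U -> V) :
  {morph f : x y / x + y} -> (forall a, {morph f : x / a *: x}) -> linear f.
Proof. by move=> fD fZ a x y; rewrite fD fZ. Qed.

Lemma lin_sum U V (f : U -> V) (fL : linear f) I (r : seq I) (F : I -> U) :
  f (\sum_(i <- r) F i) = \sum_(i <- r) f (F i).
Proof. by apply: (big_morph f (linD fL)); apply: lin0. Qed.

Lemma lin_id V : linear (fun x : V => x). Proof. by []. Qed.

Lemma lin_comp U V W (f : V -> W) (g : U -> V) :
  linear f -> linear g -> linear (fun x => f (g x)).
Proof. by move=> fL gL a x y; rewrite gL fL. Qed.

Lemma lin_add U V (f g : U -> V) :
  linear f -> linear g -> linear (fun x => f x + g x).
Proof. by move=> fL gL a x y; rewrite fL gL scalerDr addrACA. Qed.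

Lemma lin_scale U V a (f : U -> V) : linear f -> linear (fun x => a *: f x).
Proof.
by move=> fL b x y; rewrite fL scalerDr !scalerA mulrC.
Qed.

Lemma lin_bundle U V (f : {linear U -> V}) : linear f.
Proof. exact: linearP. Qed.

Section Bilin.
Variables (U V W : lmodType k) (f : U -> V -> W).

Lemma bilinI : (forall v, linear (f^~ v)) -> (forall u, linear (f u)) -> bilin f.
Proof. by []. Qed.

Hypothesis fB : bilin f.

Lemma bilin_l v : linear (fun u => f u v). Proof. exact: fB.1. Qed.
Lemma bilin_r u : linear (f u). Proof. exact: fB.2. Qed.

End Bilin.

Lemma bilin_comp U V W U' V' (f : U -> V -> W) (p : U' -> U) (q : V' -> V) :
  bilin f -> linear p -> linear q -> bilin (fun u v => f (p u) (q v)).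
Proof.
move=> fB pL qL; apply: bilinI => x; first exact: (lin_comp (bilin_l fB _)).
exact: (lin_comp (bilin_r fB _)).
Qed.

Lemma bilin_post U V W W' (f : U -> V -> W) (p : W -> W') :
  bilin f -> linear p -> bilin (fun u v => p (f u v)).
Proof.
move=> fB pL; apply: bilinI => x; apply: lin_comp => //.
  exact: bilin_l.
exact: bilin_r.
Qed.

End Linear.

Section TensorDef.
Variables (k : fieldType) (U V : lmodType k).
Implicit Type W : lmodType k.

Definition fsum (W : lmodType k) (f : U -> V -> W) (s : seq (U * V)) : W :=
  \sum_(p <- s) f p.1 p.2.

(* A list [:: (u1, v1); ...; (un, vn)] stands for the formal sum of the       *)
(* u_i (x) v_i (scalars and signs are absorbed in the u_i); two formal sums   *)
(* are identified when every bilinear map takes the same value on them.       *)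
Definition teqv : rel (seq (U * V)) := fun s t =>
  `[< forall (W : lmodType k) (f : U -> V -> W),
        bilin f -> fsum f s = fsum f t >].

Lemma teqv_is_equiv : equiv_class_of teqv.
Proof.
split=> [s|s t|t s r].
- exact/asboolP.
- by apply/asboolP/asboolP => st W f fB; rewrite st.
- by move=> /asboolP st /asboolP tr; apply/asboolP => W f fB; rewrite st // tr.
Qed.

Canonical teqv_equiv := EquivRelPack teqv_is_equiv.

Definition tens : Type := {eq_quot teqv}.

HB.instance Definition _ := Choice.on tens.

Definition tpi (s : seq (U * V)) : tens := \pi_({eq_quot teqv}) s.
Definition trepr (t : tens) : seq (U * V) := repr (t : {eq_quot teqv}).

Definition tpure (u : U) (v : V) : tens := tpi [:: (u, v)].

(* The linear map on the tensor product induced by f; meaningful (and then    *)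
(* independent of representatives) for bilinear f only, see [tlift_pure].     *)
Definition tlift (W : lmodType k) (f : U -> V -> W) (t : tens) : W :=
  fsum f (trepr t).

Lemma treprK t : tpi (trepr t) = t.
Proof. exact: reprK. Qed.

Lemma tpiP s t :
  reflect (forall (W : lmodType k) (f : U -> V -> W),
             bilin f -> fsum f s = fsum f t) (tpi s == tpi t).
Proof. by rewrite /tpi eqmodE; exact: asboolP. Qed.

Lemma tlift_pi W (f : U -> V -> W) s : bilin f -> tlift f (tpi s) = fsum f s.
Proof.
move=> fB; rewrite /tlift.
by have /eqP/tpiP -> := treprK (tpi s).
Qed.

Definition tadd s t := tpi (trepr s ++ trepr t).
Definition tscale (a : k) t := tpi [seq (a *: p.1, p.2) | p <- trepr t].

Lemma fsum_cat W (f : U -> V -> W) s t : fsum f (s ++ t) = fsum f s + fsum f t.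
Proof. by rewrite /fsum big_cat. Qed.

Lemma fsum_scale W (f : U -> V -> W) a s : bilin f ->
  fsum f [seq (a *: p.1, p.2) | p <- s] = a *: fsum f s.
Proof.
move=> fB; rewrite /fsum big_map scaler_sumr; apply: eq_bigr => p _ /=.
exact: (linZ (bilin_l fB _)).
Qed.

Lemma tens_eq s t :
  (forall W (f : U -> V -> W), bilin f -> tlift f s = tlift f t) -> s = t.
Proof.
move=> st; rewrite -(treprK s) -(treprK t); apply/eqP/tpiP => W f fB.
exact: st.
Qed.

Lemma tlift_add W (f : U -> V -> W) s t :
  bilin f -> tlift f (tadd s t) = tlift f s + tlift f t.
Proof. by move=> fB; rewrite tlift_pi // fsum_cat. Qed.

Lemma tlift_scale W (f : U -> V -> W) a t :
  bilin f -> tlift f (tscale a t) = a *: tlift f t.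
Proof. by move=> fB; rewrite tlift_pi // fsum_scale. Qed.

Lemma tlift_zero W (f : U -> V -> W) : bilin f -> tlift f (tpi [::]) = 0.
Proof. by move=> fB; rewrite tlift_pi // /fsum big_nil. Qed.

Fact taddA : associative tadd.
Proof. by move=> r s t; apply: tens_eq => W f fB; rewrite !tlift_add ?addrA. Qed.

Fact taddC : commutative tadd.
Proof. by move=> s t; apply: tens_eq => W f fB; rewrite !tlift_add // addrC. Qed.

Fact tadd0 : left_id (tpi [::]) tadd.
Proof.
by move=> t; apply: tens_eq => W f fB; rewrite tlift_add // tlift_zero ?add0r.
Qed.

Fact taddN : left_inverse (tpi [::]) (tscale (-1)) tadd.
Proof.
move=> t; apply: tens_eq => W f fB.
by rewrite tlift_add // tlift_zero // tlift_scale // scaleN1r addNr.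
Qed.

HB.instance Definition _ := GRing.isZmodule.Build tens taddA taddC tadd0 taddN.

Fact tscaleA a b t : tscale a (tscale b t) = tscale (a * b) t.
Proof. by apply: tens_eq => W f fB; rewrite !tlift_scale // scalerA. Qed.

Fact tscale1 : left_id 1 tscale.
Proof. by move=> t; apply: tens_eq => W f fB; rewrite tlift_scale // scale1r. Qed.

Fact tscaleDr : right_distributive tscale +%R.
Proof.
move=> a s t; apply: tens_eq => W f fB.
by rewrite tlift_scale // !tlift_add // !tlift_scale // scalerDr.
Qed.

Fact tscaleDl t : {morph tscale^~ t : a b / a + b}.
Proof.
move=> a b; apply: tens_eq => W f fB.
by rewrite tlift_add // !tlift_scale // scalerDl.
Qed.

HB.instance Definition _ :=
  GRing.Zmodule_isLmodule.Build k tens tscaleA tscale1 tscaleDr tscaleDl.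

End TensorDef.

Notation "u \ox v" := (tpure u v) (at level 40, left associativity).

Lemma bilDl (k : fieldType) (U V W : lmodType k) (f : U -> V -> W) :
  bilin f -> forall v, {morph f^~ v : x y / x + y}.
Proof. by move=> fB v; exact: (linD (bilin_l fB v)). Qed.

Lemma bilDr (k : fieldType) (U V W : lmodType k) (f : U -> V -> W) :
  bilin f -> forall u, {morph f u : x y / x + y}.
Proof. by move=> fB u; exact: (linD (bilin_r fB u)). Qed.

Section TensorTheory.
Variables (k : fieldType) (U V : lmodType k).
Implicit Type W : lmodType k.

Lemma tlift_pure W (f : U -> V -> W) u v : bilin f -> tlift f (u \ox v) = f u v.
Proof. by move=> fB; rewrite tlift_pi // /fsum big_seq1. Qed.

Lemma tlift_lin W (f : U -> V -> W) : bilin f -> linear (tlift f).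
Proof.
by move=> fB; apply: linI => [s t|a t]; [exact: tlift_add|exact: tlift_scale].
Qed.

Lemma tpure_bilin : bilin (@tpure k U V).
Proof.
apply: bilinI => x a y z; apply: tens_eq => W f fB;
  rewrite (tlift_lin fB) !tlift_pure //.
  exact: (bilin_l fB).
exact: (bilin_r fB).
Qed.

Lemma tens_sum (t : tens U V) : t = \sum_(p <- trepr t) p.1 \ox p.2.
Proof.
apply: tens_eq => W f fB; rewrite (lin_sum (tlift_lin fB)) /=.
by rewrite /tlift /fsum; apply: eq_bigr => p _; rewrite -[RHS]/(tlift f _) tlift_pure.
Qed.

Lemma tens_ind (P : tens U V -> Prop) :
  (forall u v, P (u \ox v)) -> (forall s t, P s -> P t -> P (s + t)) ->
  forall t, P t.
Proof.
move=> Pp PD t; rewrite [t]tens_sum; elim: (trepr t) => [|p s IHs].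
  by rewrite big_nil -(lin0 (bilin_l tpure_bilin 0)).
by rewrite big_cons; apply: PD.
Qed.

Lemma tens_ext W (f g : tens U V -> W) : linear f -> linear g ->
  (forall u v, f (u \ox v) = g (u \ox v)) -> f =1 g.
Proof.
move=> fL gL fg; elim/tens_ind => [//|s t IHs IHt].
by rewrite (linD fL) (linD gL) IHs IHt.
Qed.

Theorem tens_universal W (f : U -> V -> W) : bilin f ->
  exists! g : tens U V -> W, linear g /\ forall u v, g (u \ox v) = f u v.
Proof.
move=> fB; exists (tlift f); split=> [|h [hL hP]].
  by split=> [|u v]; [exact: tlift_lin|exact: tlift_pure].
apply/funext; apply: tens_ext => // [|u v]; first exact: tlift_lin.
by rewrite hP tlift_pure.
Qed.

Lemma tlift_linfun (X W : lmodType k) (F : X -> U -> V -> W) t :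
  (forall u v, linear (fun x => F x u v)) -> linear (fun x => tlift (F x) t).
Proof.
move=> FL a x y; rewrite /tlift /fsum scaler_sumr -big_split /=.
by apply: eq_bigr => p _; exact: FL.
Qed.

Lemma eq_tlift W (f g : U -> V -> W) : (forall u v, f u v = g u v) ->
  tlift f =1 tlift g.
Proof. by move=> fg t; apply: eq_bigr. Qed.

End TensorTheory.

Section Tmap.
Variable k : fieldType.
Implicit Types A B C D U V W X : lmodType k.

Definition tmap U V U' V' (f : U -> U') (g : V -> V') : tens U V -> tens U' V' :=
  tlift (fun u v => f u \ox g v).

(* For f : A x U -> U' and g : B x V -> V', the induced bilinear map          *)
(* (A (x) B) x (U (x) V) -> U' (x) V'.                                        *)
Definition tmap2 A B U V U' V' (f : A -> U -> U') (g : B -> V -> V')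
    (s : tens A B) (t : tens U V) : tens U' V' :=
  tlift (fun a b => tmap (f a) (g b) t) s.

Definition tassoc U V W : tens (tens U V) W -> tens U (tens V W) :=
  tlift (fun t w => tlift (fun u v => u \ox (v \ox w)) t).

Definition tassocV U V W : tens U (tens V W) -> tens (tens U V) W :=
  tlift (fun u t => tlift (fun v w => (u \ox v) \ox w) t).

Definition tscalel V : tens k^o V -> V := tlift (fun (c : k^o) (v : V) => (c : k) *: v).
Definition tscaler V : tens V k^o -> V := tlift (fun (v : V) (c : k^o) => (c : k) *: v).

Lemma scale_bilin V : bilin (fun (c : k^o) (v : V) => (c : k) *: v).
Proof.
apply: bilinI => [v a x y|c a x y]; first by rewrite scalerDl -scalerA.
by rewrite scalerDr !scalerA mulrC.
Qed.

Lemma bilin_flip U V W (f : U -> V -> W) : bilin f -> bilin (fun v u => f u v).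
Proof. by move=> fB; apply: bilinI => x; [exact: bilin_r|exact: bilin_l]. Qed.

Section TmapTh.
Variables (U V U' V' : lmodType k) (f : U -> U') (g : V -> V').
Hypotheses (fL : linear f) (gL : linear g).

Lemma tmap_bilin : bilin (fun u v => f u \ox g v).
Proof. exact: (bilin_comp (@tpure_bilin _ _ _)). Qed.

Lemma tmap_pure u v : tmap f g (u \ox v) = f u \ox g v.
Proof. exact: (tlift_pure _ _ tmap_bilin). Qed.

Lemma tmap_lin : linear (tmap f g).
Proof. exact: tlift_lin tmap_bilin. Qed.

End TmapTh.

Lemma eq_tmap U V U' V' (f f' : U -> U') (g g' : V -> V') :
  f =1 f' -> g =1 g' -> tmap f g =1 tmap f' g'.
Proof. by move=> ff gg; apply: eq_tlift => u v; rewrite ff gg. Qed.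

Lemma tmap_id U V : @tmap U V U V id id =1 id.
Proof.
by apply: tens_ext => // [|u v]; [exact: tmap_lin|rewrite tmap_pure].
Qed.

Lemma tmap_comp U V U' V' U'' V'' (f : U -> U') (g : V -> V')
    (f' : U' -> U'') (g' : V' -> V'') :
  linear f -> linear g -> linear f' -> linear g' ->
  forall t, tmap f' g' (tmap f g t) = tmap (f' \o f) (g' \o g) t.
Proof.
move=> fL gL fL' gL'.
have fL2 : linear (f' \o f) by exact: lin_comp.
have gL2 : linear (g' \o g) by exact: lin_comp.
apply: tens_ext => [||u v].
- by apply: lin_comp; exact: tmap_lin.
- exact: tmap_lin.
- by rewrite !tmap_pure.
Qed.

Section Tmap2Th.
Variables (A B U V U' V' : lmodType k) (f : A -> U -> U') (g : B -> V -> V').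
Hypotheses (fB : bilin f) (gB : bilin g).

Lemma tmap2_bilin_aux t : bilin (fun a b => tmap (f a) (g b) t).
Proof.
apply: bilinI => x.
- apply: tlift_linfun => u v.
  exact: (lin_comp (bilin_l (@tpure_bilin _ _ _) _) (bilin_l fB _)).
- apply: tlift_linfun => u v.
  exact: (lin_comp (bilin_r (@tpure_bilin _ _ _) _) (bilin_l gB _)).
Qed.

Lemma tmap2_purel a b t : tmap2 f g (a \ox b) t = tmap (f a) (g b) t.
Proof. exact: (tlift_pure _ _ (tmap2_bilin_aux t)). Qed.

Lemma tmap2_pure a b u v : tmap2 f g (a \ox b) (u \ox v) = f a u \ox g b v.
Proof. by rewrite tmap2_purel tmap_pure //; exact: bilin_r. Qed.

Lemma tmap2_bilin : bilin (tmap2 f g).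
Proof.
apply: bilinI => [t|s]; first exact: tlift_lin (tmap2_bilin_aux t).
apply: tlift_linfun => a b; apply: tmap_lin; exact: bilin_r.
Qed.

End Tmap2Th.

Section Assoc.
Variables U V W : lmodType k.

Lemma tassoc_aux w : bilin (fun (u : U) (v : V) => u \ox (v \ox w : tens V W)).
Proof.
apply: (bilin_comp (@tpure_bilin _ _ _)) => //.
exact: (bilin_l (@tpure_bilin _ _ _)).
Qed.

Lemma tassoc_bilin :
  bilin (fun (t : tens U V) (w : W) => tlift (fun u v => u \ox (v \ox w)) t).
Proof.
apply: bilinI => x; first exact: tlift_lin (tassoc_aux x).
apply: tlift_linfun => u v.
apply: (lin_comp (bilin_r (@tpure_bilin _ _ _) _)).
exact: (bilin_r (@tpure_bilin _ _ _)).
Qed.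

Lemma tassoc_lin : linear (@tassoc U V W).
Proof. exact: tlift_lin tassoc_bilin. Qed.

Lemma tassoc_pure u v w : @tassoc U V W (u \ox v \ox w) = u \ox (v \ox w).
Proof.
by rewrite /tassoc (tlift_pure _ _ tassoc_bilin) (tlift_pure _ _ (tassoc_aux _)).
Qed.

Lemma tassocV_aux u : bilin (fun (v : V) (w : W) => (u : U) \ox v \ox w).
Proof.
apply: (bilin_comp (@tpure_bilin _ _ _)) => //.
exact: (bilin_r (@tpure_bilin _ _ _)).
Qed.

Lemma tassocV_bilin :
  bilin (fun (u : U) (t : tens V W) => tlift (fun v w => u \ox v \ox w) t).
Proof.
apply: bilinI => x; last exact: tlift_lin (tassocV_aux x).
apply: tlift_linfun => v w.
apply: (lin_comp (bilin_l (@tpure_bilin _ _ _) _)).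
exact: (bilin_l (@tpure_bilin _ _ _)).
Qed.

Lemma tassocV_lin : linear (@tassocV U V W).
Proof. exact: tlift_lin tassocV_bilin. Qed.

Lemma tassocV_pure u v w : @tassocV U V W (u \ox (v \ox w)) = u \ox v \ox w.
Proof.
by rewrite /tassocV (tlift_pure _ _ tassocV_bilin) (tlift_pure _ _ (tassocV_aux _)).
Qed.

Lemma tassocK : cancel (@tassoc U V W) (@tassocV U V W).
Proof.
elim/tens_ind => [t w|s t IHs IHt]; last first.
  by rewrite (linD tassoc_lin) (linD tassocV_lin) IHs IHt.
elim/tens_ind: t => [u v|s t IHs IHt]; first by rewrite tassoc_pure tassocV_pure.
by rewrite (bilDl (@tpure_bilin _ _ _)) (linD tassoc_lin) (linD tassocV_lin) IHs IHt.
Qed.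

Lemma tassocVK : cancel (@tassocV U V W) (@tassoc U V W).
Proof.
elim/tens_ind => [u t|s t IHs IHt]; last first.
  by rewrite (linD tassocV_lin) (linD tassoc_lin) IHs IHt.
elim/tens_ind: t => [v w|s t IHs IHt]; first by rewrite tassocV_pure tassoc_pure.
by rewrite (bilDr (@tpure_bilin _ _ _)) (linD tassocV_lin) (linD tassoc_lin) IHs IHt.
Qed.

End Assoc.

Lemma tscalel_pure V c v : @tscalel V (c \ox v) = c *: v.
Proof. exact: (tlift_pure _ _ (@scale_bilin _)). Qed.

Lemma tscalel_lin V : linear (@tscalel V).
Proof. exact: tlift_lin (@scale_bilin _). Qed.

Lemma tscaler_pure V c v : @tscaler V (v \ox c) = c *: v.
Proof. exact: (tlift_pure _ _ (bilin_flip (@scale_bilin _))). Qed.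

Lemma tscaler_lin V : linear (@tscaler V).
Proof. exact: tlift_lin (bilin_flip (@scale_bilin _)). Qed.

Lemma tscalelK V : cancel (@tscalel V) (fun v => (1 : k^o) \ox v).
Proof.
have pB := @tpure_bilin k k^o V.
elim/tens_ind => [c v|s t IHs IHt].
  rewrite tscalel_pure (linZ (bilin_r pB _)) -(linZ (bilin_l pB _)) /=.
  by rewrite -[c *: 1]/(c * 1) mulr1.
by rewrite (linD (@tscalel_lin V)) (bilDr pB) IHs IHt.
Qed.

Lemma tscalerK V : cancel (@tscaler V) (fun v => v \ox (1 : k^o)).
Proof.
have pB := @tpure_bilin k V k^o.
elim/tens_ind => [v c|s t IHs IHt].
  rewrite tscaler_pure (linZ (bilin_l pB _)) -(linZ (bilin_r pB _)) /=.
  by rewrite -[c *: 1]/(c * 1) mulr1.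
by rewrite (linD (@tscaler_lin V)) (bilDl pB) IHs IHt.
Qed.

Lemma tassoc_tmap U V W U' V' W' (f : U -> U') (g : V -> V') (h : W -> W') :
  linear f -> linear g -> linear h -> forall t,
  tassoc (tmap (tmap f g) h t) = tmap f (tmap g h) (tassoc t).
Proof.
move=> fL gL hL.
have fgL := tmap_lin fL gL; have ghL := tmap_lin gL hL.
have l1 := tmap_lin fgL hL; have l2 := tmap_lin fL ghL.
elim/tens_ind => [t w|s t IHs IHt]; last first.
  by rewrite (linD l1) !(linD (@tassoc_lin _ _ _)) (linD l2) IHs IHt.
elim/tens_ind: t => [u v|s t IHs IHt]; last first.
  by rewrite (bilDl (@tpure_bilin _ _ _)) (linD l1) !(linD (@tassoc_lin _ _ _)) (linD l2) IHs IHt.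
by rewrite tmap_pure // tmap_pure // !tassoc_pure !tmap_pure.
Qed.

Lemma tassoc_tmap2 A B C U V W U' V' W'
    (f : A -> U -> U') (g : B -> V -> V') (h : C -> W -> W') :
  bilin f -> bilin g -> bilin h -> forall s t,
  tassoc (tmap2 (tmap2 f g) h s t) = tmap2 f (tmap2 g h) (tassoc s) (tassoc t).
Proof.
move=> fB gB hB.
have fgB := tmap2_bilin fB gB; have ghB := tmap2_bilin gB hB.
have b1 := tmap2_bilin fgB hB; have b2 := tmap2_bilin fB ghB.
elim/tens_ind => [s c|s s' IHs IHs'] t; last first.
  by rewrite (bilDl b1) !(linD (@tassoc_lin _ _ _)) (bilDl b2) IHs IHs'.
elim/tens_ind: s => [a b|s s' IHs IHs']; last first.
  by rewrite (bilDl (@tpure_bilin _ _ _)) (bilDl b1) !(linD (@tassoc_lin _ _ _)) (bilDl b2) IHs IHs'.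
rewrite tmap2_purel // tassoc_pure tmap2_purel //.
have -> : tmap (tmap2 f g (a \ox b)) (h c) t = tmap (tmap (f a) (g b)) (h c) t.
  by apply: eq_tmap => // x; rewrite tmap2_purel.
rewrite tassoc_tmap; try exact: bilin_r.
by apply: eq_tmap => // x; rewrite tmap2_purel.
Qed.

Lemma tmap_tmap2 A B U V W X A' B' U' V' W' X'
    (f : A -> U -> W) (g : B -> V -> X) (f' : A' -> U' -> W') (g' : B' -> V' -> X')
    (p1 : A -> A') (q1 : B -> B') (p2 : U -> U') (q2 : V -> V')
    (p : W -> W') (q : X -> X') :
  bilin f -> bilin g -> bilin f' -> bilin g' ->
  linear p1 -> linear q1 -> linear p2 -> linear q2 -> linear p -> linear q ->
  (forall a u, p (f a u) = f' (p1 a) (p2 u)) ->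
  (forall b v, q (g b v) = g' (q1 b) (q2 v)) ->
  forall s t, tmap p q (tmap2 f g s t) = tmap2 f' g' (tmap p1 q1 s) (tmap p2 q2 t).
Proof.
move=> fB gB f'B g'B p1L q1L p2L q2L pL qL pf qg.
have b1 := tmap2_bilin fB gB; have b2 := tmap2_bilin f'B g'B.
have l1 := tmap_lin p1L q1L; have l2 := tmap_lin p2L q2L; have l := tmap_lin pL qL.
elim/tens_ind => [a b|s s' IHs IHs'] t; last first.
  by rewrite (bilDl b1) (linD l) (linD l1) (bilDl b2) IHs IHs'.
elim/tens_ind: t => [u v|t t' IHt IHt']; last first.
  by rewrite (bilDr b1) (linD l) (linD l2) (bilDr b2) IHt IHt'.
by rewrite !tmap_pure // !tmap2_pure // tmap_pure // pf qg.
Qed.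

Lemma tmap2A A B C D U V A1 B1 U1 V1 W X
    (f : A1 -> U -> W) (g : B1 -> V -> X) (f1 : A -> C -> A1) (g1 : B -> D -> B1)
    (f' : A -> U1 -> W) (g' : B -> V1 -> X) (f2 : C -> U -> U1) (g2 : D -> V -> V1) :
  bilin f -> bilin g -> bilin f1 -> bilin g1 ->
  bilin f' -> bilin g' -> bilin f2 -> bilin g2 ->
  (forall a c u, f (f1 a c) u = f' a (f2 c u)) ->
  (forall b d v, g (g1 b d) v = g' b (g2 d v)) ->
  forall r s t, tmap2 f g (tmap2 f1 g1 r s) t = tmap2 f' g' r (tmap2 f2 g2 s t).
Proof.
move=> fB gB f1B g1B f'B g'B f2B g2B ff gg.
have b := tmap2_bilin fB gB; have b1 := tmap2_bilin f1B g1B.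
have b' := tmap2_bilin f'B g'B; have b2 := tmap2_bilin f2B g2B.
elim/tens_ind => [x y|r r' IHr IHr'] s t; last first.
  by rewrite (bilDl b1) (bilDl b) (bilDl b') IHr IHr'.
elim/tens_ind: s => [z w|s s' IHs IHs']; last first.
  by rewrite (bilDr b1) (bilDl b) (bilDl b2) (bilDr b') IHs IHs'.
elim/tens_ind: t => [u v|t t' IHt IHt']; last first.
  by rewrite (bilDr b) (bilDr b2) (bilDr b') IHt IHt'.
by rewrite !tmap2_pure // ff gg.
Qed.

Lemma tmap2_tmapl A B A' B' U V U' V' (f : A -> U -> U') (g : B -> V -> V')
    (p : A' -> A) (q : B' -> B) :
  bilin f -> bilin g -> linear p -> linear q -> forall s t,
  tmap2 f g (tmap p q s) t = tmap2 (fun a => f (p a)) (fun b => g (q b)) s t.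
Proof.
move=> fB gB pL qL.
have f'B : bilin (fun a => f (p a)) by exact: (bilin_comp fB).
have g'B : bilin (fun b => g (q b)) by exact: (bilin_comp gB).
have b := tmap2_bilin fB gB; have b' := tmap2_bilin f'B g'B.
elim/tens_ind => [x y|r r' IHr IHr'] t; last first.
  by rewrite (linD (tmap_lin pL qL)) (bilDl b) (bilDl b') IHr IHr'.
by rewrite tmap_pure // !tmap2_purel.
Qed.

Lemma tmap2_flip A B U V U' V' (f : A -> U -> U') (g : B -> V -> V') :
  bilin f -> bilin g -> forall s t,
  tmap2 f g s t = tmap2 (fun u a => f a u) (fun v b => g b v) t s.
Proof.
move=> fB gB.
have b := tmap2_bilin fB gB.
have b' := tmap2_bilin (bilin_flip fB) (bilin_flip gB).
elim/tens_ind => [x y|r r' IHr IHr'] t; last first.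
  by rewrite (bilDl b) (bilDr b') IHr IHr'.
elim/tens_ind: t => [u v|t t' IHt IHt']; last first.
  by rewrite (bilDr b) (bilDl b') IHt IHt'.
by rewrite !tmap2_pure //; exact: bilin_flip.
Qed.

Lemma tmap2_tmapr A B U V U' V' U1 V1 (f : A -> U -> U') (g : B -> V -> V')
    (p : U1 -> U) (q : V1 -> V) :
  bilin f -> bilin g -> linear p -> linear q -> forall s t,
  tmap2 f g s (tmap p q t) = tmap2 (fun a u => f a (p u)) (fun b v => g b (q v)) s t.
Proof.
move=> fB gB pL qL s t.
have f'B : bilin (fun a u => f a (p u)) by exact: (bilin_comp fB).
have g'B : bilin (fun b v => g b (q v)) by exact: (bilin_comp gB).
rewrite tmap2_flip // tmap2_tmapl //; try exact: bilin_flip.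
by rewrite [RHS]tmap2_flip.
Qed.

Lemma eq_tmap2 A B U V U' V' (f f' : A -> U -> U') (g g' : B -> V -> V') :
  (forall a u, f a u = f' a u) -> (forall b v, g b v = g' b v) ->
  forall s t, tmap2 f g s t = tmap2 f' g' s t.
Proof. by move=> ff gg s t; apply: eq_tlift => a b; exact: eq_tmap. Qed.

End Tmap.

Section TensAlg.
Variables (k : fieldType) (H : algType k).

Definition tone2 : tens H H := 1 \ox 1.
Definition tone3 : tens H (tens H H) := 1 \ox tone2.
Definition tone4 : tens H (tens H (tens H H)) := 1 \ox tone3.

Definition tmul2 : tens H H -> tens H H -> tens H H := tmap2 *%R *%R.
Definition tmul3 : tens H (tens H H) -> tens H (tens H H) -> tens H (tens H H) :=
  tmap2 *%R tmul2.
Definition tmul4 : tens H (tens H (tens H H)) -> tens H (tens H (tens H H)) ->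
    tens H (tens H (tens H H)) := tmap2 *%R tmul3.

Lemma mul_bilin : bilin ( *%R : H -> H -> H).
Proof.
apply: bilinI => x a y z /=; first by rewrite mulrDl scalerAl.
by rewrite mulrDr scalerAr.
Qed.

Lemma tmul2_bilin : bilin tmul2.
Proof. exact: (tmap2_bilin mul_bilin mul_bilin). Qed.

Lemma tmul3_bilin : bilin tmul3.
Proof. exact: (tmap2_bilin mul_bilin tmul2_bilin). Qed.

Lemma tmul4_bilin : bilin tmul4.
Proof. exact: (tmap2_bilin mul_bilin tmul3_bilin). Qed.

End TensAlg.

Section Act2.
Variables (k : fieldType) (A B U V : lmodType k).
Variables (mA : A -> A -> A) (mB : B -> B -> B) (eA : A) (eB : B).
Variables (f : A -> U -> U) (g : B -> V -> V).
Hypotheses (mAB : bilin mA) (mBB : bilin mB) (fB : bilin f) (gB : bilin g).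

Lemma act2_1 : (forall u, f eA u = u) -> (forall v, g eB v = v) ->
  forall x, tmap2 f g (eA \ox eB) x = x.
Proof.
move=> f1 g1 x; rewrite tmap2_purel // -[RHS]tmap_id.
by apply: eq_tmap => y; rewrite ?f1 ?g1.
Qed.

Lemma act2M : (forall a b u, f (mA a b) u = f a (f b u)) ->
  (forall a b v, g (mB a b) v = g a (g b v)) ->
  forall s t x, tmap2 f g (tmap2 mA mB s t) x = tmap2 f g s (tmap2 f g t x).
Proof.
move=> fM gM s t x.
exact: (tmap2A fB gB mAB mBB fB gB fB gB fM gM).
Qed.

Lemma act2Mr : (forall a b u, f (mA a b) u = f b (f a u)) ->
  (forall a b v, g (mB a b) v = g b (g a v)) ->
  forall s t x, tmap2 f g (tmap2 mA mB s t) x = tmap2 f g t (tmap2 f g s x).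
Proof.
move=> fM gM s t x; rewrite (tmap2_flip mAB mBB).
by apply: (tmap2A fB gB (bilin_flip mAB) (bilin_flip mBB) fB gB fB gB) => a b u /=;
  rewrite ?fM ?gM.
Qed.

Lemma act2C (A' B' : lmodType k) (f' : A' -> U -> U) (g' : B' -> V -> V) :
  bilin f' -> bilin g' ->
  (forall a a' u, f a (f' a' u) = f' a' (f a u)) ->
  (forall b b' v, g b (g' b' v) = g' b' (g b v)) ->
  forall s s' x, tmap2 f g s (tmap2 f' g' s' x) = tmap2 f' g' s' (tmap2 f g s x).
Proof.
move=> f'B g'B ff gg.
have b := tmap2_bilin fB gB; have b' := tmap2_bilin f'B g'B.
elim/tens_ind => [a c|s t IHs IHt] s' x; last first.
  by rewrite !(bilDl b) (bilDr b') IHs IHt.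
elim/tens_ind: s' => [a' c'|s t IHs IHt]; last first.
  by rewrite !(bilDl b') (bilDr b) IHs IHt.
elim/tens_ind: x => [u v|s t IHs IHt]; last first.
  by rewrite (bilDr b) !(bilDr b') (bilDr b) IHs IHt.
by rewrite !tmap2_pure // ff gg.
Qed.

End Act2.

Section TensAlgTheory.
Variables (k : fieldType) (H : algType k).

Let mB := @mul_bilin k H.
Let m2B := @tmul2_bilin k H.
Let m3B := @tmul3_bilin k H.

Lemma tmul2A : associative (@tmul2 k H).
Proof.
by move=> r s t; symmetry; apply: (act2M mB mB mB mB) => x y z; rewrite mulrA.
Qed.

Lemma tmul3A : associative (@tmul3 k H).
Proof.
move=> r s t; symmetry; apply: (act2M mB m2B mB m2B) => x y z.
  by rewrite mulrA.
by rewrite tmul2A.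
Qed.

Lemma tmul4A : associative (@tmul4 k H).
Proof.
move=> r s t; symmetry; apply: (act2M mB m3B mB m3B) => x y z.
  by rewrite mulrA.
by rewrite tmul3A.
Qed.

Lemma tmul2_1l : left_id (tone2 H) (@tmul2 k H).
Proof. by apply: act2_1 => //; exact: mul1r. Qed.

Lemma tmul3_1l : left_id (tone3 H) (@tmul3 k H).
Proof. by apply: act2_1 => //; [exact: mul1r|exact: tmul2_1l]. Qed.

Lemma tmul4_1l : left_id (tone4 H) (@tmul4 k H).
Proof. by apply: act2_1 => //; [exact: mul1r|exact: tmul3_1l]. Qed.

Lemma tmul2_1r : right_id (tone2 H) (@tmul2 k H).
Proof.
move=> t; rewrite /tmul2 tmap2_flip //.
by apply: act2_1; (exact: bilin_flip || exact: mulr1).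
Qed.

Lemma tmul3_1r : right_id (tone3 H) (@tmul3 k H).
Proof.
move=> t; rewrite /tmul3 tmap2_flip //.
by apply: act2_1; (exact: bilin_flip || exact: mulr1 || exact: tmul2_1r).
Qed.

Lemma tmul4_1r : right_id (tone4 H) (@tmul4 k H).
Proof.
move=> t; rewrite /tmul4 tmap2_flip //.
by apply: act2_1; (exact: bilin_flip || exact: mulr1 || exact: tmul3_1r).
Qed.

End TensAlgTheory.

Record category := Category {
  Ob :> Type;
  Hom : Ob -> Ob -> Type;
  idc : forall X, Hom X X;
  comp : forall X Y Z, Hom Y Z -> Hom X Y -> Hom X Z;
  comp1f : forall X Y (f : Hom X Y), comp (idc Y) f = f;
  compf1 : forall X Y (f : Hom X Y), comp f (idc X) = f;
  compA : forall X Y Z T (h : Hom Z T) (g : Hom Y Z) (f : Hom X Y),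
    comp h (comp g f) = comp (comp h g) f }.

Arguments Hom {c} X Y.
Arguments idc {c} X.
Arguments comp {c X Y Z} g f.

Notation "g \oc f" := (comp g f) (at level 50, left associativity).

Record isom (C : category) (X Y : C) := Isom {
  fwd :> Hom X Y;
  bwd : Hom Y X;
  fwdK : bwd \oc fwd = idc X;
  bwdK : fwd \oc bwd = idc Y }.

Record functor (C D : category) := Functor {
  fobj :> C -> D;
  fmap : forall X Y, Hom X Y -> Hom (fobj X) (fobj Y);
  fmap_id : forall X, fmap (idc X) = idc (fobj X);
  fmap_comp : forall X Y Z (g : Hom Y Z) (f : Hom X Y),
    fmap (g \oc f) = fmap g \oc fmap f }.

Arguments fmap {C D} F {X Y} f : rename.

Definition id_functor (C : category) : functor C C :=
  @Functor C C id (fun _ _ => id) (fun=> erefl) (fun _ _ _ _ _ => erefl).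

Section CompFunctor.
Variables (C D E : category) (G : functor D E) (F : functor C D).

Fact comp_functor_id X : fmap G (fmap F (idc X)) = idc (G (F X)).
Proof. by rewrite !fmap_id. Qed.

Fact comp_functor_comp X Y Z (g : Hom Y Z) (f : Hom X Y) :
  fmap G (fmap F (g \oc f)) = fmap G (fmap F g) \oc fmap G (fmap F f).
Proof. by rewrite !fmap_comp. Qed.

Definition comp_functor : functor C E :=
  Functor comp_functor_id comp_functor_comp.

End CompFunctor.

Record natiso (C D : category) (F G : functor C D) := NatIso {
  ncomp :> forall X, isom (F X) (G X);
  nnat : forall X Y (f : Hom X Y), ncomp Y \oc fmap F f = fmap G f \oc ncomp X }.

Definition is_equivalence (C D : category) (F : functor C D) : Prop :=
  exists G : functor D C,
    inhabited (natiso (id_functor C) (comp_functor G F)) /\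
    inhabited (natiso (comp_functor F G) (id_functor D)).

Record moncat := MonCat {
  mcat :> category;
  munit : mcat;
  mten : mcat -> mcat -> mcat;
  mmap : forall X Y X' Y' : mcat,
    Hom X X' -> Hom Y Y' -> Hom (mten X Y) (mten X' Y');
  massoc : forall X Y Z, isom (mten (mten X Y) Z) (mten X (mten Y Z));
  mlunit : forall X, isom (mten munit X) X;
  mrunit : forall X, isom (mten X munit) X;
  mmap_id : forall X Y, mmap (idc X) (idc Y) = idc (mten X Y);
  mmap_comp : forall (X Y X' Y' X'' Y'' : mcat)
    (f' : Hom X' X'') (g' : Hom Y' Y'') (f : Hom X X') (g : Hom Y Y'),
    mmap (f' \oc f) (g' \oc g) = mmap f' g' \oc mmap f g;
  massoc_nat : forall (X Y Z X' Y' Z' : mcat)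
    (f : Hom X X') (g : Hom Y Y') (h : Hom Z Z'),
    massoc X' Y' Z' \oc mmap (mmap f g) h = mmap f (mmap g h) \oc massoc X Y Z;
  mlunit_nat : forall (X Y : mcat) (f : Hom X Y),
    mlunit Y \oc mmap (idc munit) f = f \oc mlunit X;
  mrunit_nat : forall (X Y : mcat) (f : Hom X Y),
    mrunit Y \oc mmap f (idc munit) = f \oc mrunit X;
  pentagon : forall X Y Z T,
    massoc X Y (mten Z T) \oc massoc (mten X Y) Z T =
    mmap (idc X) (massoc Y Z T) \oc massoc X (mten Y Z) T
      \oc mmap (massoc X Y Z) (idc T);
  triangle : forall X Y,
    mmap (idc X) (mlunit Y) \oc massoc X munit Y = mmap (mrunit X) (idc Y) }.

Arguments munit {m}.
Arguments mten {m} X Y.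
Arguments mmap {m X Y X' Y'} f g.
Arguments massoc {m} X Y Z.
Arguments mlunit {m} X.
Arguments mrunit {m} X.

Notation "X \om Y" := (mten X Y) (at level 40, left associativity).
Notation "f \tm g" := (mmap f g) (at level 40, left associativity).

(* The canonical isomorphisms V = I (x) V and V (x) I = V that are usually    *)
(* suppressed in the two triangle identities are written out.                *)

Record dual (C : moncat) (V : C) := Dual {
  dobj : C;
  dev : Hom (dobj \om V) munit;
  ddb : Hom munit (V \om dobj);
  dual_l : mrunit V \oc (idc V \tm dev) \oc massoc V dobj V \oc
             (ddb \tm idc V) \oc bwd (mlunit V) = idc V;
  dual_r : mlunit dobj \oc (dev \tm idc dobj) \oc bwd (massoc dobj V dobj) \oc
             (idc dobj \tm ddb) \oc bwd (mrunit dobj) = idc dobj }.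

Definition rigid (C : moncat) : Prop := forall V : C, inhabited (dual V).

Section FullSub.
Variables (C : category) (P : C -> Prop).

Definition full_sub : category :=
  @Category {X : C | P X} (fun X Y => Hom (sval X) (sval Y))
    (fun X => idc (sval X)) (fun _ _ _ g f => g \oc f)
    (fun _ _ => @comp1f C _ _) (fun _ _ => @compf1 C _ _)
    (fun _ _ _ _ => @compA C _ _ _ _).

Definition full_isom (X Y : full_sub) (f : isom (sval X) (sval Y)) : isom X Y :=
  @Isom full_sub X Y f (bwd f) (fwdK f) (bwdK f).

End FullSub.

Section FullMonSub.
Variables (C : moncat) (P : C -> Prop).
Hypotheses (P1 : P munit) (PM : forall X Y, P X -> P Y -> P (X \om Y)).

Definition full_unit : full_sub P := exist _ munit P1.

Definition full_ten (X Y : full_sub P) : full_sub P :=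
  exist _ (sval X \om sval Y) (PM (svalP X) (svalP Y)).

Definition full_moncat : moncat :=
  @MonCat (full_sub P) full_unit full_ten
    (fun _ _ _ _ f g => mmap (m := C) f g)
    (fun X Y Z => @full_isom _ _ (full_ten (full_ten X Y) Z)
       (full_ten X (full_ten Y Z)) (massoc (sval X) (sval Y) (sval Z)))
    (fun X => @full_isom _ _ (full_ten full_unit X) X (mlunit (sval X)))
    (fun X => @full_isom _ _ (full_ten X full_unit) X (mrunit (sval X)))
    (fun _ _ => @mmap_id C _ _)
    (fun _ _ _ _ _ _ => @mmap_comp C _ _ _ _ _ _)
    (fun _ _ _ _ _ _ => @massoc_nat C _ _ _ _ _ _)
    (fun _ _ => @mlunit_nat C _ _)
    (fun _ _ => @mrunit_nat C _ _)
    (fun _ _ _ _ => @pentagon C _ _ _ _)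
    (fun _ _ => @triangle C _ _).

End FullMonSub.

Record coalgebra (C : moncat) := Coalgebra {
  coalg :> C;
  comul : Hom coalg (coalg \om coalg);
  counit : Hom coalg munit;
  comulA : massoc coalg coalg coalg \oc (comul \tm idc coalg) \oc comul =
           (idc coalg \tm comul) \oc comul;
  counitl : mlunit coalg \oc (counit \tm idc coalg) \oc comul = idc coalg;
  counitr : mrunit coalg \oc (idc coalg \tm counit) \oc comul = idc coalg }.

Arguments comul {C} c.
Arguments counit {C} c.

Section Comodules.
Variables (C : moncat) (K : coalgebra C).

Record comodule := Comodule {
  comod :> C;
  coact : Hom comod (comod \om K);
  coact_counit : mrunit comod \oc (idc comod \tm counit K) \oc coact = idc comod;
  coactA : massoc comod K K \oc (coact \tm idc K) \oc coact =
           (idc comod \tm comul K) \oc coact }.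

Record comodule_hom (M N : comodule) := ComoduleHom {
  comod_hom :> Hom (comod M) (comod N);
  comod_homP : coact N \oc comod_hom = (comod_hom \tm idc K) \oc coact M }.

Lemma comodule_hom_eq (M N : comodule) (f g : comodule_hom M N) :
  comod_hom f = comod_hom g -> f = g.
Proof.
by case: f g => [f fP] [g gP] /= fg; subst g; congr ComoduleHom; exact: Prop_irrelevance.
Qed.

Fact comodule_idP (M : comodule) :
  coact M \oc idc (comod M) = (idc (comod M) \tm idc K) \oc coact M.
Proof. by rewrite mmap_id comp1f compf1. Qed.

Fact comodule_compP (M N L : comodule) (g : comodule_hom N L) (f : comodule_hom M N) :
  coact L \oc (comod_hom g \oc comod_hom f) =
  ((comod_hom g \oc comod_hom f) \tm idc K) \oc coact M.
Proof.
rewrite compA comod_homP -compA comod_homP compA -mmap_comp.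
by rewrite (comp1f (idc K)).
Qed.

Fact comodule_comp1f (M N : comodule) (f : comodule_hom M N) :
  ComoduleHom (comodule_compP (ComoduleHom (comodule_idP N)) f) = f.
Proof. by apply: comodule_hom_eq; exact: comp1f. Qed.

Fact comodule_compf1 (M N : comodule) (f : comodule_hom M N) :
  ComoduleHom (comodule_compP f (ComoduleHom (comodule_idP M))) = f.
Proof. by apply: comodule_hom_eq; exact: compf1. Qed.

Fact comodule_compA (M N L T : comodule) (h : comodule_hom L T)
    (g : comodule_hom N L) (f : comodule_hom M N) :
  ComoduleHom (comodule_compP h (ComoduleHom (comodule_compP g f))) =
  ComoduleHom (comodule_compP (ComoduleHom (comodule_compP h g)) f).
Proof. by apply: comodule_hom_eq; exact: compA. Qed.

Definition comodule_cat : category :=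
  @Category comodule comodule_hom (fun M => ComoduleHom (comodule_idP M))
    (fun _ _ _ g f => ComoduleHom (comodule_compP g f))
    comodule_comp1f comodule_compf1 comodule_compA.

Lemma bwd_assoc_nat (X Y Z X' Y' Z' : C)
    (f : Hom X X') (g : Hom Y Y') (h : Hom Z Z') :
  bwd (massoc X' Y' Z') \oc (f \tm (g \tm h)) =
  ((f \tm g) \tm h) \oc bwd (massoc X Y Z).
Proof.
rewrite -[LHS]compf1 -(bwdK (massoc X Y Z)) compA.
rewrite -[bwd _ \oc _ \oc massoc X Y Z]compA -massoc_nat.
by rewrite compA fwdK comp1f.
Qed.

Lemma isom_monic (X Y Z : C) (a : isom Y Z) (f g : Hom X Y) :
  a \oc f = a \oc g -> f = g.
Proof.
by move=> afg; rewrite -[f]comp1f -[g]comp1f -(fwdK a) -!compA afg.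
Qed.

Lemma isom_epic (X Y Z : C) (a : isom X Y) (f g : Hom Y Z) :
  f \oc a = g \oc a -> f = g.
Proof.
by move=> afg; rewrite -[f]compf1 -[g]compf1 -(bwdK a) !compA afg.
Qed.

Lemma mmap_compl (X Y X' X'' : C) (f' : Hom X' X'') (f : Hom X X') :
  (f' \oc f) \tm idc Y = (f' \tm idc Y) \oc (f \tm idc Y).
Proof. by rewrite -mmap_comp comp1f. Qed.

Lemma mmap_compr (X Y X' X'' : C) (f' : Hom X' X'') (f : Hom X X') :
  idc Y \tm (f' \oc f) = (idc Y \tm f') \oc (idc Y \tm f).
Proof. by rewrite -mmap_comp comp1f. Qed.

(* Kelly: this coherence identity follows from the pentagon and triangle.     *)
Lemma mrunit_ten (X Y : C) :
  (idc X \tm mrunit Y) \oc massoc X Y munit = mrunit (X \om Y).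
Proof.
have faithful (Z T : C) (f g : Hom Z T) :
    f \tm idc munit = g \tm idc munit -> f = g.
  by move=> fg; apply: (@isom_epic _ _ _ (mrunit Z)); rewrite -!mrunit_nat fg.
apply: faithful; rewrite mmap_compl.
apply: (@isom_monic _ _ _ (massoc X Y munit)).
rewrite compA massoc_nat -[mrunit Y \tm _]triangle mmap_compr.
rewrite -2!compA [(idc X \tm massoc _ _ _) \oc _]compA -pentagon.
rewrite compA -massoc_nat -compA mmap_id.
by rewrite triangle.
Qed.

Section Cofree.
Variable P : C.

Definition cofree_coact : Hom (P \om K) ((P \om K) \om K) :=
  bwd (massoc P K K) \oc (idc P \tm comul K).

Fact cofree_counit :
  mrunit (P \om K) \oc (idc (P \om K) \tm counit K) \oc cofree_coact =
  idc (P \om K).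
Proof.
rewrite /cofree_coact -mrunit_ten compA -[_ \oc bwd _]compA -mmap_id.
rewrite -bwd_assoc_nat compA -[_ \oc massoc _ _ _ \oc bwd _]compA bwdK compf1.
by rewrite -!mmap_compr counitr mmap_id.
Qed.

Fact cofree_coactA :
  massoc (P \om K) K K \oc (cofree_coact \tm idc K) \oc cofree_coact =
  (idc (P \om K) \tm comul K) \oc cofree_coact.
Proof.
rewrite /cofree_coact mmap_compl.
rewrite [RHS]compA -[idc (P \om K)]mmap_id -bwd_assoc_nat -[RHS]compA.
rewrite -mmap_compr -comulA.
apply: (@isom_monic _ _ _ (massoc P K (K \om K))).
rewrite [RHS]compA bwdK comp1f.
rewrite !compA pentagon.
rewrite -[_ \oc (massoc P K K \tm _) \oc _]compA -mmap_compl bwdK mmap_id compf1.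
rewrite -[_ \oc ((idc P \tm _) \tm _)]compA massoc_nat.
rewrite [_ \oc (_ \oc massoc _ _ _)]compA -[_ \oc massoc _ _ _ \oc bwd _]compA bwdK.
by rewrite compf1 -!mmap_compr.
Qed.

Definition cofree : comodule := Comodule cofree_counit cofree_coactA.

End Cofree.

Fact cofree_homP (P Q : C) (f : Hom P Q) :
  coact (cofree Q) \oc (f \tm idc K) =
  ((f \tm idc K) \tm idc K) \oc coact (cofree P).
Proof.
rewrite /= /cofree_coact [RHS]compA -bwd_assoc_nat -!compA mmap_id.
by rewrite -!mmap_comp !comp1f !compf1.
Qed.

Definition cofree_map (P Q : C) (f : Hom P Q) :
  comodule_hom (cofree P) (cofree Q) :=
  @ComoduleHom (cofree P) (cofree Q) (f \tm idc K) (cofree_homP f).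

Fact cofree_map_id (P : C) :
  cofree_map (idc P) = ComoduleHom (comodule_idP (cofree P)).
Proof. by apply: comodule_hom_eq; exact: mmap_id. Qed.

Fact cofree_map_comp (P Q R : C) (g : Hom Q R) (f : Hom P Q) :
  cofree_map (g \oc f) =
  ComoduleHom (comodule_compP (cofree_map g) (cofree_map f)).
Proof. by apply: comodule_hom_eq; exact: mmap_compl. Qed.

Definition cofree_functor : functor C comodule_cat :=
  @Functor C comodule_cat cofree cofree_map cofree_map_id cofree_map_comp.

End Comodules.

Record quasibialgebra (k : fieldType) (H : algType k) := QuasiBialgebra {
  Delta : H -> tens H H;
  eps : H -> k;
  phi : tens H (tens H H);
  phiV : tens H (tens H H);
  Delta_lin : linear Delta;
  Delta_1 : Delta 1 = tone2 H;
  Delta_M : forall g h, Delta (g * h) = tmul2 (Delta g) (Delta h);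
  eps_lin : linear (eps : H -> k^o);
  eps_mon : monoid_morphism eps;
  phiVphi : tmul3 phiV phi = tone3 H;
  phiphiV : tmul3 phi phiV = tone3 H;
  eps_Delta : forall h, tscalel (tmap (eps : H -> k^o) id (Delta h)) = h;
  Delta_eps : forall h, tscaler (tmap id (eps : H -> k^o) (Delta h)) = h;
  Delta_coassoc : forall h,
    tmul3 (tmap id Delta (Delta h)) phi =
    tmul3 phi (tassoc (tmap Delta id (Delta h)));
  (* Both sides are reassociated to H (x) (H (x) (H (x) H)).                  *)
  phi_pentagon :
    tmul4 (tmap id (tmap id Delta) phi) (tassoc (tmap Delta id phi)) =
    tmul4 (tmul4 (1 \ox phi)
                 (tmap id (@tassoc _ _ _ _) (tmap id (tmap Delta id) phi)))
          (tmap id (@tassoc _ _ _ _) (tassoc (phi \ox 1)));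
  phi_eps :
    tmap id (fun t => tscalel (tmap (eps : H -> k^o) id t)) phi = tone2 H }.

Record quasiantipode (k : fieldType) (H : algType k) (Q : quasibialgebra H)
    (S : H -> H) (alpha beta : H) : Prop := QuasiAntipode {
  S_lin : linear S;
  S_1 : S 1 = 1;
  S_anti : forall g h, S (g * h) = S h * S g;
  S_alpha : forall h,
    tlift (fun h1 h2 => S h1 * alpha * h2) (Delta Q h) = eps Q h *: alpha;
  S_beta : forall h,
    tlift (fun h1 h2 => h1 * beta * S h2) (Delta Q h) = eps Q h *: beta;
  S_phi :
    tlift (fun x => tlift (fun y z => x * beta * S y * alpha * z)) (phi Q) = 1;
  S_phiV :
    tlift (fun x => tlift (fun y z => S x * alpha * y * beta * S z)) (phiV Q)
      = 1 }.

Definition is_quasi_hopf (k : fieldType) (H : algType k) (Q : quasibialgebra H) :=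
  exists (S : H -> H) (alpha beta : H), quasiantipode Q S alpha beta.

Lemma mon_inv (T : Type) (m : T -> T -> T) (e a b c d x a' b' c' d' x' : T) :
  associative m -> left_id e m -> right_id e m ->
  m a b = m (m c d) x -> m a a' = e -> m b b' = e ->
  m c' c = e -> m d' d = e -> m x' x = e -> m b' a' = m x' (m d' c').
Proof.
move=> mA m1l m1r P aa bb cc dd xx.
have R : m (m (m c d) x) (m b' a') = e by rewrite -P -mA (mA b) bb m1l aa.
have L : m (m x' (m d' c')) (m (m c d) x) = e.
  by rewrite -!mA (mA c') cc m1l (mA d') dd m1l xx.
by rewrite -[LHS]m1l -L -mA R m1r.
Qed.

Section Aux.
Variables (k : fieldType) (H : algType k) (Q : quasibialgebra H).
Local Notation De := (Delta Q).
Local Notation ep := (eps Q : H -> k^o).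
Implicit Types U V W X : lmodType k.

Let DL : linear De := Delta_lin Q.
Let eL : linear ep := eps_lin Q.
Let idL (U : lmodType k) : linear (@id U) := @lin_id k U.
Let assL U V W : linear (@tassoc k U V W) := @tassoc_lin k U V W.

Lemma tmap_act U V U' V' (f : H -> U -> U) (g : H -> V -> V)
    (f' : H -> U' -> U') (g' : H -> V' -> V') p q :
  bilin f -> bilin g -> bilin f' -> bilin g' -> linear p -> linear q ->
  (forall a u, p (f a u) = f' a (p u)) -> (forall a u, q (g a u) = g' a (q u)) ->
  forall s t, tmap p q (tmap2 f g s t) = tmap2 f' g' s (tmap p q t).
Proof.
move=> fB gB fB' gB' pL qL pf qg s t.
by rewrite (@tmap_tmap2 k _ _ _ _ _ _ _ _ _ _ _ _ f g f' g' id id p q p q) ?tmap_id.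
Qed.

Lemma delta_act_bilin U V (f : H -> U -> U) (g : H -> V -> V) :
  bilin f -> bilin g -> bilin (fun h => tmap2 f g (De h)).
Proof. by move=> fB gB; apply: (bilin_comp (tmap2_bilin fB gB)). Qed.

Lemma eps_act_bilin : bilin (fun (h : H) (c : k^o) => ep h * c : k^o).
Proof.
apply: bilinI => x a y z; first by rewrite eL mulrDl -scalerAl.
by rewrite mulrDr scalerAr.
Qed.

Section Three.
Variables (U V W : lmodType k).
Variables (f : H -> U -> U) (g : H -> V -> V) (h : H -> W -> W).
Hypotheses (fB : bilin f) (gB : bilin g) (hB : bilin h).

Lemma actr a x : tmap2 f (fun b => tmap2 g h (De b)) (De a) x =
  tmap2 f (tmap2 g h) (tmap id De (De a)) x.
Proof. by rewrite tmap2_tmapl //; apply: tmap2_bilin. Qed.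

Lemma actl a x : tassoc (tmap2 (fun b => tmap2 f g (De b)) h (De a) x) =
  tmap2 f (tmap2 g h) (tassoc (tmap De id (De a))) (tassoc x).
Proof.
by rewrite -tassoc_tmap2 // tmap2_tmapl //; apply: tmap2_bilin.
Qed.

Lemma eps_act_l a x :
  tscalel (tmap2 (fun (b : H) (c : k^o) => ep b * c : k^o) g a x) =
  g (tscalel (tmap ep id a)) (tscalel x).
Proof.
have eB := eps_act_bilin; have B := tmap2_bilin eB gB.
have L := tmap_lin eL (@idL H).
elim/tens_ind: a => [a b|s t IHs IHt]; last first.
  by rewrite (bilDl B) (linD L) !(linD (@tscalel_lin _ _)) (bilDl gB) IHs IHt.
elim/tens_ind: x => [c v|s t IHs IHt]; last first.
  by rewrite (bilDr B) !(linD (@tscalel_lin _ _)) (bilDr gB) IHs IHt.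
rewrite tmap2_pure // tmap_pure // !tscalel_pure.
by rewrite (linZ (bilin_l gB _)) (linZ (bilin_r gB _)) scalerA.
Qed.

Lemma eps_act_r a x :
  tscaler (tmap2 g (fun (b : H) (c : k^o) => ep b * c : k^o) a x) =
  g (tscaler (tmap id ep a)) (tscaler x).
Proof.
have eB := eps_act_bilin; have B := tmap2_bilin gB eB.
have L := tmap_lin (@idL H) eL.
elim/tens_ind: a => [a b|s t IHs IHt]; last first.
  by rewrite (bilDl B) (linD L) !(linD (@tscaler_lin _ _)) (bilDl gB) IHs IHt.
elim/tens_ind: x => [v c|s t IHs IHt]; last first.
  by rewrite (bilDr B) !(linD (@tscaler_lin _ _)) (bilDr gB) IHs IHt.
rewrite tmap2_pure // tmap_pure // !tscaler_pure.
by rewrite (linZ (bilin_l gB _)) (linZ (bilin_r gB _)) scalerA.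
Qed.

Lemma act_triangle s x :
  tmap id (@tscalel _ _)
    (tmap2 f (tmap2 (fun (b : H) (c : k^o) => ep b * c : k^o) h) s x) =
  tmap2 f h (tmap id (fun t => tscalel (tmap ep id t)) s)
    (tmap id (@tscalel _ _) x).
Proof.
have eB := eps_act_bilin.
apply: tmap_tmap2 => //.
- exact: tmap2_bilin.
- by apply: lin_comp; [exact: tscalel_lin|exact: tmap_lin].
- exact: tscalel_lin.
- exact: tscalel_lin.
- move=> b v; have B := tmap2_bilin eB hB; have L := tmap_lin eL (@idL H).
  elim/tens_ind: b => [a b|r t IHs IHt]; last first.
    by rewrite (bilDl B) (linD L) !(linD (@tscalel_lin _ _)) (bilDl hB) IHs IHt.
  elim/tens_ind: v => [c v|r t IHs IHt]; last first.
    by rewrite (bilDr B) !(linD (@tscalel_lin _ _)) (bilDr hB) IHs IHt.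
  rewrite tmap2_pure // tmap_pure // !tscalel_pure.
  by rewrite (linZ (bilin_l hB _)) (linZ (bilin_r hB _)) scalerA.
Qed.

End Three.

Section Four.
Variables (U V W X : lmodType k).
Variables (f : H -> U -> U) (g : H -> V -> V) (h : H -> W -> W) (j : H -> X -> X).
Hypotheses (fB : bilin f) (gB : bilin g) (hB : bilin h) (jB : bilin j).

Let fgB := tmap2_bilin fB gB.
Let ghB := tmap2_bilin gB hB.
Let hjB := tmap2_bilin hB jB.

Definition op4 := tmap2 f (tmap2 g (tmap2 h j)).

Lemma pent1 s y : tmap2 f (tmap2 g (fun c => tmap2 h j (De c))) s y =
  op4 (tmap id (tmap id De) s) y.
Proof.
rewrite /op4 tmap2_tmapl //; [|exact: tmap2_bilin|exact: tmap_lin].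
apply: eq_tmap2 => // b v; rewrite tmap2_tmapl //.
Qed.

Lemma pent2 s y : tassoc (tmap2 (fun a => tmap2 f g (De a)) (tmap2 h j) s y) =
  op4 (tassoc (tmap De id s)) (tassoc y).
Proof. by rewrite /op4 -tassoc_tmap2 // tmap2_tmapl. Qed.

Lemma pent3 (f1 : forall u, f 1 u = u) s y :
  tmap id (tmap2 g (tmap2 h j) s) y = op4 (1 \ox s) y.
Proof.
rewrite /op4 tmap2_purel //; last exact: tmap2_bilin.
by apply: eq_tmap => u; rewrite ?f1.
Qed.

Lemma pent4 s y :
  tmap id (@tassoc _ _ _ _) (tmap2 f (tmap2 (fun b => tmap2 g h (De b)) j) s y) =
  op4 (tmap id (@tassoc _ _ _ _) (tmap id (tmap De id) s))
      (tmap id (@tassoc _ _ _ _) y).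
Proof.
have dB := delta_act_bilin gB hB.
have L : linear (tmap De (@id H)) by exact: tmap_lin.
rewrite tmap_comp //; last exact: assL.
apply: tmap_tmap2 => //; try exact: tmap2_bilin; try exact: assL.
- by apply: (lin_comp (@assL _ _ _)).
- by move=> b v; rewrite -[(_ \o _) b]/(tassoc (tmap De id b)) -tassoc_tmap2 // tmap2_tmapl.
Qed.

Lemma pent5 (j1 : forall x, j 1 x = x) s y :
  tmap id (@tassoc _ _ _ _) (tassoc (tmap (tmap2 f (tmap2 g h) s) id y)) =
  op4 (tmap id (@tassoc _ _ _ _) (tassoc (s \ox 1)))
      (tmap id (@tassoc _ _ _ _) (tassoc y)).
Proof.
have f_ghB := tmap2_bilin fB ghB.
have -> : tmap (tmap2 f (tmap2 g h) s) id y =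
    tmap2 (tmap2 f (tmap2 g h)) j (s \ox 1) y.
  by rewrite tmap2_purel //; apply: eq_tmap => // x; rewrite j1.
rewrite tassoc_tmap2 // /op4.
apply: tmap_tmap2 => //; try exact: tmap2_bilin; try exact: assL.
by move=> b v; exact: tassoc_tmap2.
Qed.

End Four.

Lemma tassoc_pentagon U V W X (t : tens (tens (tens U V) W) X) :
  tmap id (@tassoc k V W X)
    (tassoc (tmap (@tassoc k U V W) id t)) = tassoc (tassoc t).
Proof.
have L1 := tmap_lin (@assL U V W) (@idL X).
have L2 := tmap_lin (@idL U) (@assL V W X).
elim/tens_ind: t => [t x|s t IHs IHt]; last first.
  by rewrite (linD L1) !(linD (@assL _ _ _)) (linD L2) IHs IHt.
have pD := fun U V : lmodType k => bilDl (@tpure_bilin k U V).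
elim/tens_ind: t => [t w|s t IHs IHt]; last first.
  by rewrite pD (linD L1) !(linD (@assL _ _ _)) (linD L2) IHs IHt.
elim/tens_ind: t => [u v|s t IHs IHt]; last first.
  by rewrite !pD (linD L1) !(linD (@assL _ _ _)) (linD L2) IHs IHt.
rewrite (tmap_pure (@assL _ _ _) (@idL _)) !tassoc_pure.
by rewrite (tmap_pure (@idL _) (@assL _ _ _)) tassoc_pure.
Qed.

Section Op34.
Variables (U V W X : lmodType k).
Variables (f : H -> U -> U) (g : H -> V -> V) (h : H -> W -> W) (j : H -> X -> X).
Hypotheses (fB : bilin f) (gB : bilin g) (hB : bilin h) (jB : bilin j).

Definition op3 := tmap2 f (tmap2 g h).

Lemma op3_bilin : bilin op3.
Proof. by apply: tmap2_bilin => //; apply: tmap2_bilin. Qed.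

Lemma op3_1 : (forall u, f 1 u = u) -> (forall u, g 1 u = u) ->
  (forall u, h 1 u = u) -> forall x, op3 (tone3 H) x = x.
Proof.
move=> f1 g1 h1; apply: act2_1 => //; first exact: tmap2_bilin.
exact: act2_1.
Qed.

Lemma op3M : (forall a b u, f (a * b) u = f a (f b u)) ->
  (forall a b u, g (a * b) u = g a (g b u)) ->
  (forall a b u, h (a * b) u = h a (h b u)) ->
  forall s t x, op3 (tmul3 s t) x = op3 s (op3 t x).
Proof.
have mB := @mul_bilin k H; have m2B := @tmul2_bilin k H.
have b2 := tmap2_bilin gB hB.
move=> fM gM hM; apply: (act2M mB m2B fB b2 fM).
exact: (act2M mB mB gB hB gM hM).
Qed.

Lemma op4M : (forall a b u, f (a * b) u = f a (f b u)) ->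
  (forall a b u, g (a * b) u = g a (g b u)) ->
  (forall a b u, h (a * b) u = h a (h b u)) ->
  (forall a b u, j (a * b) u = j a (j b u)) ->
  forall s t x, op4 f g h j (tmul4 s t) x =
    op4 f g h j s (op4 f g h j t x).
Proof.
have mB := @mul_bilin k H; have m2B := @tmul2_bilin k H.
have m3B := @tmul3_bilin k H.
have b2 := tmap2_bilin hB jB; have b3 := tmap2_bilin gB b2.
move=> fM gM hM jM; apply: (act2M mB m3B fB b3 fM).
apply: (act2M mB m2B gB b2 gM).
exact: (act2M mB mB hB jB hM jM).
Qed.

Lemma op3Mr : (forall a b u, f (a * b) u = f b (f a u)) ->
  (forall a b u, g (a * b) u = g b (g a u)) ->
  (forall a b u, h (a * b) u = h b (h a u)) ->
  forall s t x, op3 (tmul3 s t) x = op3 t (op3 s x).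
Proof.
have mB := @mul_bilin k H; have m2B := @tmul2_bilin k H.
have b2 := tmap2_bilin gB hB.
move=> fM gM hM; apply: (act2Mr mB m2B fB b2 fM).
exact: (act2Mr mB mB gB hB gM hM).
Qed.

Lemma op4Mr : (forall a b u, f (a * b) u = f b (f a u)) ->
  (forall a b u, g (a * b) u = g b (g a u)) ->
  (forall a b u, h (a * b) u = h b (h a u)) ->
  (forall a b u, j (a * b) u = j b (j a u)) ->
  forall s t x, op4 f g h j (tmul4 s t) x =
    op4 f g h j t (op4 f g h j s x).
Proof.
have mB := @mul_bilin k H; have m2B := @tmul2_bilin k H.
have m3B := @tmul3_bilin k H.
have b2 := tmap2_bilin hB jB; have b3 := tmap2_bilin gB b2.
move=> fM gM hM jM; apply: (act2Mr mB m3B fB b3 fM).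
apply: (act2Mr mB m2B gB b2 gM).
exact: (act2Mr mB mB hB jB hM jM).
Qed.

Section Comm.
Variables (f' : H -> U -> U) (g' : H -> V -> V) (h' : H -> W -> W) (j' : H -> X -> X).
Hypotheses (fB' : bilin f') (gB' : bilin g') (hB' : bilin h') (jB' : bilin j').
Hypotheses (fC : forall a b u, f a (f' b u) = f' b (f a u))
           (gC : forall a b u, g a (g' b u) = g' b (g a u))
           (hC : forall a b u, h a (h' b u) = h' b (h a u))
           (jC : forall a b u, j a (j' b u) = j' b (j a u)).

Lemma op3C s s' x :
  op3 s (tmap2 f' (tmap2 g' h') s' x) = tmap2 f' (tmap2 g' h') s' (op3 s x).
Proof.
have b2 := tmap2_bilin gB hB; have b2' := tmap2_bilin gB' hB'.
by apply: act2C => // b b' v; apply: act2C.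
Qed.

Lemma op4C s s' x : op4 f g h j s (op4 f' g' h' j' s' x) =
  op4 f' g' h' j' s' (op4 f g h j s x).
Proof.
have b2 := tmap2_bilin hB jB; have b2' := tmap2_bilin hB' jB'.
have b3 := tmap2_bilin gB b2; have b3' := tmap2_bilin gB' b2'.
by apply: act2C => // b b' v; apply: act2C => // c c' w; apply: act2C.
Qed.

End Comm.

Lemma op3_nat U' V' W' (f' : H -> U' -> U') (g' : H -> V' -> V')
    (h' : H -> W' -> W') p q r :
  bilin f' -> bilin g' -> bilin h' -> linear p -> linear q -> linear r ->
  (forall a u, p (f a u) = f' a (p u)) ->
  (forall a u, q (g a u) = g' a (q u)) ->
  (forall a u, r (h a u) = h' a (r u)) ->
  forall s x, tmap p (tmap q r) (op3 s x) =
    tmap2 f' (tmap2 g' h') s (tmap p (tmap q r) x).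
Proof.
move=> fB' gB' hB' pL qL rL pf qg rh s x; have qrL := tmap_lin qL rL.
have b := tmap2_bilin gB hB; have b' := tmap2_bilin gB' hB'.
rewrite /op3 (@tmap_tmap2 k _ _ _ _ _ _ _ _ _ _ _ _ _ _ f' (tmap2 g' h')
  id id p (tmap q r)) ?tmap_id //.
by move=> c v; apply: tmap_act.
Qed.

End Op34.

Let mB := @mul_bilin k H.
Let m2B := @tmul2_bilin k H.
Let m3B := @tmul3_bilin k H.

Lemma phiV_coassoc h : tmul3 (phiV Q) (tmap id De (De h)) =
  tmul3 (tassoc (tmap De id (De h))) (phiV Q).
Proof.
rewrite -[LHS]tmul3_1r -(phiphiV Q) -tmul3A [tmul3 _ (tmul3 (phi Q) _)]tmul3A.
by rewrite Delta_coassoc !tmul3A phiVphi tmul3_1l.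
Qed.

Definition phi4A s : tens H (tens H (tens H H)) := tmap id (tmap id De) s.
Definition phi4B s : tens H (tens H (tens H H)) := tassoc (tmap De id s).
Definition phi4C s : tens H (tens H (tens H H)) := 1 \ox s.
Definition phi4D s : tens H (tens H (tens H H)) :=
  tmap id (@tassoc _ _ _ _) (tmap id (tmap De id) s).
Definition phi4E s : tens H (tens H (tens H H)) :=
  tmap id (@tassoc _ _ _ _) (tassoc (s \ox 1)).

Lemma phi4A_1 : phi4A (tone3 H) = tone4 H.
Proof.
by rewrite /phi4A /tone3 tmap_pure //; [rewrite tmap_pure // Delta_1|exact: tmap_lin].
Qed.

Lemma phi4A_M : {morph phi4A : s t / tmul3 s t >-> tmul4 s t}.
Proof.
move=> s t; apply: tmap_tmap2 => //; try exact: tmap_lin.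
move=> b v; apply: tmap_tmap2 => //; exact: Delta_M.
Qed.

Lemma phi4B_1 : phi4B (tone3 H) = tone4 H.
Proof. by rewrite /phi4B /tone3 tmap_pure // Delta_1 tassoc_pure. Qed.

Lemma phi4B_M : {morph phi4B : s t / tmul3 s t >-> tmul4 s t}.
Proof.
move=> s t; rewrite /phi4B.
rewrite (@tmap_tmap2 k _ _ _ _ _ _ _ _ _ _ _ _ _ _ (@tmul2 k H) (@tmul2 k H)
  De id De id De id) //; last exact: Delta_M.
exact: tassoc_tmap2.
Qed.

Lemma phi4C_M : {morph phi4C : s t / tmul3 s t >-> tmul4 s t}.
Proof. by move=> s t; rewrite /phi4C /tmul4 tmap2_pure // mulr1. Qed.

Lemma tassoc_M (s t : tens (tens H H) H) :
  tassoc (tmap2 (@tmul2 k H) *%R s t) = tmul3 (tassoc s) (tassoc t).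
Proof. exact: tassoc_tmap2. Qed.

Lemma phi4D_1 : phi4D (tone3 H) = tone4 H.
Proof.
rewrite /phi4D /tone3 tmap_pure //; last exact: tmap_lin.
rewrite tmap_pure //; last exact: tassoc_lin.
by rewrite tmap_pure // Delta_1 tassoc_pure.
Qed.

Lemma phi4D_M : {morph phi4D : s t / tmul3 s t >-> tmul4 s t}.
Proof.
move=> s t; rewrite /phi4D.
have L : linear (tmap De (@id H)) by exact: tmap_lin.
have B : bilin (tmap2 (@tmul2 k H) ( *%R : H -> H -> H)) by exact: tmap2_bilin.
rewrite (@tmap_tmap2 k _ _ _ _ _ _ _ _ _ _ _ _ _ _ ( *%R : H -> H -> H)
  (tmap2 (@tmul2 k H) ( *%R : H -> H -> H))
  id (tmap De id) id (tmap De id) id (tmap De id)) //; last first.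
  by move=> b v; apply: tmap_tmap2 => //; exact: Delta_M.
apply: tmap_tmap2 => //; try exact: tassoc_lin.
exact: tassoc_M.
Qed.

Lemma phi4E_1 : phi4E (tone3 H) = tone4 H.
Proof.
rewrite /phi4E /tone3 tassoc_pure tmap_pure //; last exact: tassoc_lin.
by rewrite tassoc_pure.
Qed.

Lemma phi4E_M : {morph phi4E : s t / tmul3 s t >-> tmul4 s t}.
Proof.
move=> s t; rewrite /phi4E.
have -> : tmul3 s t \ox 1 =
    tmap2 (@tmul3 k H) ( *%R : H -> H -> H) (s \ox 1) (t \ox 1).
  by rewrite tmap2_pure // mulr1.
have B : bilin (tmap2 (@tmul2 k H) ( *%R : H -> H -> H)) by exact: tmap2_bilin.
rewrite tassoc_tmap2 //; apply: tmap_tmap2 => //; try exact: tassoc_lin.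
exact: tassoc_M.
Qed.

Lemma inv_pentagon :
  tmul4 (phi4B (phiV Q)) (phi4A (phiV Q)) =
  tmul4 (phi4E (phiV Q)) (tmul4 (phi4D (phiV Q)) (phi4C (phiV Q))).
Proof.
have P : tmul4 (phi4A (phi Q)) (phi4B (phi Q)) =
    tmul4 (tmul4 (phi4C (phi Q)) (phi4D (phi Q))) (phi4E (phi Q)).
  exact: phi_pentagon.
have A1 : tmul4 (phi4A (phi Q)) (phi4A (phiV Q)) = tone4 H.
  by rewrite -phi4A_M phiphiV phi4A_1.
have B1 : tmul4 (phi4B (phi Q)) (phi4B (phiV Q)) = tone4 H.
  by rewrite -phi4B_M phiphiV phi4B_1.
have C1 : tmul4 (phi4C (phiV Q)) (phi4C (phi Q)) = tone4 H.
  by rewrite -phi4C_M phiVphi.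
have D1 : tmul4 (phi4D (phiV Q)) (phi4D (phi Q)) = tone4 H.
  by rewrite -phi4D_M phiVphi phi4D_1.
have E1 : tmul4 (phi4E (phiV Q)) (phi4E (phi Q)) = tone4 H.
  by rewrite -phi4E_M phiVphi phi4E_1.
exact: (mon_inv (@tmul4A k H) (@tmul4_1l k H) (@tmul4_1r k H) P A1 B1 C1 D1 E1).
Qed.

Lemma phiV_eps :
  tmap id (fun t => tscalel (tmap ep id t)) (phiV Q) = tone2 H.
Proof.
have L : linear (fun t : tens H H => tscalel (tmap ep id t)).
  by apply: lin_comp; [exact: tscalel_lin|exact: tmap_lin].
have L1 := tmap_lin (@idL H) L.
pose E s := tmap id (fun t => tscalel (tmap ep id t)) s : tens H H.
have EM : {morph E : s t / tmul3 s t >-> tmul2 s t}.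
  move=> s t; apply: tmap_tmap2 => // b v.
  rewrite -(@eps_act_l _ _ mB); congr tscalel.
  rewrite (@tmap_tmap2 k _ _ _ _ _ _ _ _ _ _ _ _ _ _
    (fun (h : H) (c : k^o) => ep h * c : k^o) *%R id id ep id) ?tmap_id //.
    exact: eps_act_bilin.
  by move=> a u; rewrite (eps_mon Q).2.
have E1 : E (tone3 H) = tone2 H.
  rewrite /E tmap_pure // tmap_pure // tscalel_pure (eps_mon Q).1.
  by rewrite scale1r.
rewrite -[LHS]/(E _) -[LHS]tmul2_1r -{1}(phi_eps Q).
by rewrite -[tmap id _ (phi Q)]/(E _) -EM phiVphi E1.
Qed.

End Aux.

Section Modules.
Variables (k : fieldType) (H : algType k).

Record lmodule := LModule {
  lcar :> lmodType k;
  lact : H -> lcar -> lcar;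
  lact_bilin : bilin lact;
  lact1 : forall v, lact 1 v = v;
  lactM : forall g h v, lact (g * h) v = lact g (lact h v) }.

Record lmodule_hom (U V : lmodule) := LModuleHom {
  lhom :> U -> V;
  lhom_lin : linear lhom;
  lhom_act : forall h u, lhom (lact h u) = lact h (lhom u) }.

Lemma lmodule_hom_eq (U V : lmodule) (f g : lmodule_hom U V) :
  lhom f =1 lhom g -> f = g.
Proof.
case: f g => [f fL fA] [g gL gA] /= /funext fg; subst g.
by congr LModuleHom; exact: Prop_irrelevance.
Qed.

Definition lmodule_id (U : lmodule) : lmodule_hom U U :=
  @LModuleHom U U id (@lin_id k U) (fun _ _ => erefl).

Fact lmodule_comp_act (U V W : lmodule) (g : lmodule_hom V W)
    (f : lmodule_hom U V) h u : g (f (lact h u)) = lact h (g (f u)).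
Proof. by rewrite !lhom_act. Qed.

Definition lmodule_comp (U V W : lmodule) (g : lmodule_hom V W)
    (f : lmodule_hom U V) : lmodule_hom U W :=
  LModuleHom (lin_comp (lhom_lin g) (lhom_lin f)) (lmodule_comp_act g f).

Fact lmodule_comp1f (U V : lmodule) (f : lmodule_hom U V) :
  lmodule_comp (lmodule_id V) f = f.
Proof. exact: lmodule_hom_eq. Qed.

Fact lmodule_compf1 (U V : lmodule) (f : lmodule_hom U V) :
  lmodule_comp f (lmodule_id U) = f.
Proof. exact: lmodule_hom_eq. Qed.

Fact lmodule_compA (U V W X : lmodule) (h : lmodule_hom W X)
    (g : lmodule_hom V W) (f : lmodule_hom U V) :
  lmodule_comp h (lmodule_comp g f) = lmodule_comp (lmodule_comp h g) f.
Proof. exact: lmodule_hom_eq. Qed.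

Definition lmodule_cat : category :=
  Category lmodule_comp1f lmodule_compf1 lmodule_compA.

Section LIso.
Variables (U V : lmodule) (f : U -> V) (g : V -> U).
Hypotheses (fL : linear f) (fA : forall h u, f (lact h u) = lact h (f u)).
Hypotheses (fgK : cancel f g) (gfK : cancel g f).

Fact linv_lin : linear g.
Proof. by move=> a x y; rewrite -{1}[x]gfK -{1}[y]gfK -fL fgK. Qed.

Fact linv_act h v : g (lact h v) = lact h (g v).
Proof. by rewrite -{1}[v]gfK -fA fgK. Qed.

Definition lmodule_isom : isom (C := lmodule_cat) U V :=
  @Isom lmodule_cat U V (LModuleHom fL fA) (LModuleHom linv_lin linv_act)
    (lmodule_hom_eq (f := lmodule_comp (LModuleHom linv_lin linv_act)
       (LModuleHom fL fA)) (g := lmodule_id U) fgK)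
    (lmodule_hom_eq (f := lmodule_comp (LModuleHom fL fA)
       (LModuleHom linv_lin linv_act)) (g := lmodule_id V) gfK).

End LIso.

Variable Q : quasibialgebra H.
Local Notation De := (Delta Q).
Local Notation ep := (eps Q : H -> k^o).

Section LTens.
Variables U V : lmodule.

Definition ltens_act (h : H) (t : tens U V) : tens U V :=
  tmap2 (@lact U) (@lact V) (De h) t.

Fact ltens_bilin : bilin ltens_act.
Proof. by apply: delta_act_bilin; exact: lact_bilin. Qed.

Fact ltens_1 t : ltens_act 1 t = t.
Proof.
rewrite /ltens_act Delta_1.
by apply: act2_1; (exact: lact_bilin || exact: lact1).
Qed.

Fact ltens_M g h t : ltens_act (g * h) t = ltens_act g (ltens_act h t).
Proof.
rewrite /ltens_act Delta_M.
by apply: act2M; (exact: lact_bilin || exact: mul_bilin || exact: lactM).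
Qed.

Definition ltens : lmodule := LModule ltens_bilin ltens_1 ltens_M.

End LTens.

Fact lunit_bilin : bilin (fun (h : H) (c : k^o) => ep h * c : k^o).
Proof. exact: eps_act_bilin. Qed.

Fact lunit_1 (c : k^o) : ep 1 * c = c.
Proof. by rewrite (eps_mon Q).1 mul1r. Qed.

Fact lunit_M g h (c : k^o) : ep (g * h) * c = ep g * (ep h * c).
Proof. by rewrite (eps_mon Q).2 mulrA. Qed.

Definition lunit : lmodule := LModule lunit_bilin lunit_1 lunit_M.

Section LTmap.
Variables (U V U' V' : lmodule) (f : lmodule_hom U U') (g : lmodule_hom V V').

Fact ltmap_act h t :
  tmap f g (lact h (t : ltens U V)) = lact h (tmap f g t : ltens U' V').
Proof.
by apply: tmap_act; (exact: lact_bilin || exact: lhom_lin || exact: lhom_act).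
Qed.

Definition ltmap : lmodule_hom (ltens U V) (ltens U' V') :=
  @LModuleHom (ltens U V) (ltens U' V') (tmap f g)
    (tmap_lin (lhom_lin f) (lhom_lin g)) ltmap_act.

End LTmap.

Section LAssoc.
Variables U V W : lmodule.

Local Notation lact3 := (op3 (@lact U) (@lact V) (@lact W)).

Let lB := lact_bilin.

Fact lact3_bilin : bilin lact3.
Proof. exact: op3_bilin. Qed.

Fact lact3_M r s t : lact3 (tmul3 r s) t = lact3 r (lact3 s t).
Proof. by apply: op3M => //; exact: lactM. Qed.

Fact lact3_1 t : lact3 (tone3 H) t = t.
Proof. by apply: op3_1 => //; exact: lact1. Qed.

Definition lassoc (t : tens (tens U V) W) : tens U (tens V W) :=
  tmap2 (@lact U) (tmap2 (@lact V) (@lact W)) (phi Q) (tassoc t).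

Definition lassocV (t : tens U (tens V W)) : tens (tens U V) W :=
  tassocV (tmap2 (@lact U) (tmap2 (@lact V) (@lact W)) (phiV Q) t).

Fact lassoc_lin : linear lassoc.
Proof. exact: (lin_comp (bilin_r lact3_bilin _) (@tassoc_lin _ _ _ _)). Qed.

Fact lassocK : cancel lassoc lassocV.
Proof. by move=> t; rewrite /lassocV /lassoc -/lact3 -lact3_M phiVphi lact3_1 tassocK. Qed.

Fact lassocVK : cancel lassocV lassoc.
Proof. by move=> t; rewrite /lassoc /lassocV tassocVK -/lact3 -lact3_M phiphiV lact3_1. Qed.

Fact lassoc_act h t : lassoc (lact h (t : ltens (ltens U V) W)) =
  lact h (lassoc t : ltens U (ltens V W)).
Proof.
rewrite /= /ltens_act /= /ltens_act actr; try exact: lact_bilin.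
rewrite -/lact3 -lact3_M Delta_coassoc lact3_M; congr lact3.
by rewrite actl //; exact: lact_bilin.
Qed.

Definition lassoc_isom :
    isom (C := lmodule_cat) (ltens (ltens U V) W) (ltens U (ltens V W)) :=
  @lmodule_isom (ltens (ltens U V) W) (ltens U (ltens V W))
    lassoc lassocV lassoc_lin lassoc_act lassocK lassocVK.

End LAssoc.

Section LUnit.
Variable U : lmodule.

Fact lunitl_act h t :
  tscalel (lact h (t : ltens lunit U)) = lact h (tscalel t).
Proof.
by rewrite /= /ltens_act eps_act_l ?eps_Delta //; exact: lact_bilin.
Qed.

Fact lunitl_K : cancel (fun v : U => (1 : k^o) \ox v) (@tscalel k U).
Proof. by move=> v; rewrite tscalel_pure scale1r. Qed.

Definition lunitl_isom : isom (C := lmodule_cat) (ltens lunit U) U :=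
  @lmodule_isom (ltens lunit U) U _ _ (@tscalel_lin k U) lunitl_act
    (@tscalelK k U) lunitl_K.

Fact lunitr_act h t :
  tscaler (lact h (t : ltens U lunit)) = lact h (tscaler t).
Proof.
by rewrite /= /ltens_act eps_act_r ?Delta_eps //; exact: lact_bilin.
Qed.

Fact lunitr_K : cancel (fun v : U => v \ox (1 : k^o)) (@tscaler k U).
Proof. by move=> v; rewrite tscaler_pure scale1r. Qed.

Definition lunitr_isom : isom (C := lmodule_cat) (ltens U lunit) U :=
  @lmodule_isom (ltens U lunit) U _ _ (@tscaler_lin k U) lunitr_act
    (@tscalerK k U) lunitr_K.

End LUnit.

Fact ltmap_id U V :
  ltmap (lmodule_id U) (lmodule_id V) = lmodule_id (ltens U V).
Proof. by apply: lmodule_hom_eq => t; exact: tmap_id. Qed.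

Fact ltmap_comp U V U' V' U'' V''
    (f' : lmodule_hom U' U'') (g' : lmodule_hom V' V'')
    (f : lmodule_hom U U') (g : lmodule_hom V V') :
  ltmap (lmodule_comp f' f) (lmodule_comp g' g) =
  lmodule_comp (ltmap f' g') (ltmap f g).
Proof.
by apply: lmodule_hom_eq => t; rewrite /= tmap_comp //; exact: lhom_lin.
Qed.

Fact lassoc_nat U V W U' V' W' (f : lmodule_hom U U')
    (g : lmodule_hom V V') (h : lmodule_hom W W') t :
  lassoc (tmap (tmap f g) h t) = tmap f (tmap g h) (lassoc t).
Proof.
rewrite /lassoc tassoc_tmap; try exact: lhom_lin.
by symmetry; apply: op3_nat;
  (exact: lact_bilin || exact: lhom_lin || exact: lhom_act).
Qed.

Fact tscalel_nat (U V : lmodType k) (f : U -> V) (fL : linear f) t :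
  tscalel (tmap (id : k^o -> k^o) f t) = f (tscalel t).
Proof.
have L := tmap_lin (@lin_id k k^o) fL.
elim/tens_ind: t => [c v|s t IHs IHt].
  by rewrite tmap_pure // !tscalel_pure (linZ fL).
by rewrite (linD L) !(linD (@tscalel_lin _ _)) (linD fL) IHs IHt.
Qed.

Fact tscaler_nat (U V : lmodType k) (f : U -> V) (fL : linear f) t :
  tscaler (tmap f (id : k^o -> k^o) t) = f (tscaler t).
Proof.
have L := tmap_lin fL (@lin_id k k^o).
elim/tens_ind: t => [v c|s t IHs IHt].
  by rewrite tmap_pure // !tscaler_pure (linZ fL).
by rewrite (linD L) !(linD (@tscaler_lin _ _)) (linD fL) IHs IHt.
Qed.

Fact tassoc_triangle (U V : lmodType k) t :
  tmap id (@tscalel k V) (tassoc t) = tmap (@tscaler k U) id t.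
Proof.
have L1 := tmap_lin (@lin_id k U) (@tscalel_lin k V).
have L2 := tmap_lin (@tscaler_lin k U) (@lin_id k V).
elim/tens_ind: t => [t w|s t IHs IHt]; last first.
  by rewrite (linD (@tassoc_lin _ _ _ _)) (linD L1) (linD L2) IHs IHt.
have pB := fun U V : lmodType k => @tpure_bilin k U V.
elim/tens_ind: t => [v c|s t IHs IHt]; last first.
  by rewrite !(bilDl (pB _ _)) (linD (@tassoc_lin _ _ _ _)) (linD L1) (linD L2) IHs IHt.
rewrite tassoc_pure !tmap_pure; try exact: lin_id; try exact: tscalel_lin; try exact: tscaler_lin.
by rewrite tscalel_pure tscaler_pure (linZ (bilin_l (pB _ _) _)) (linZ (bilin_r (pB _ _) _)).
Qed.

Fact lpentagon (U V W X : lmodule) (t : tens (tens (tens U V) W) X) :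
  @lassoc U V (ltens W X) (@lassoc (ltens U V) W X t) =
  tmap id (@lassoc V W X) (@lassoc U (ltens V W) X (tmap (@lassoc U V W) id t)).
Proof.
have aL U V W := @tassoc_lin k U V W.
have lB := lact_bilin.
rewrite /lassoc /= /ltens_act.
rewrite pent1 // pent2 //.
have -> : tmap (fun x => tmap2 (@lact U) (tmap2 (@lact V) (@lact W)) (phi Q)
    (tassoc x)) id t = tmap (op3 (@lact U) (@lact V) (@lact W) (phi Q)) id (tmap (@tassoc _ _ _ _) id t).
  by rewrite tmap_comp //; (exact: aL || exact: (bilin_r (@lact3_bilin _ _ _))).
have -> z : tmap id (fun x => tmap2 (@lact V) (tmap2 (@lact W) (@lact X)) (phi Q)
    (tassoc x)) z = tmap (id : U -> U) (op3 (@lact V) (@lact W) (@lact X) (phi Q)) (tmap id (@tassoc _ _ _ _) z).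
  by rewrite tmap_comp //; (exact: aL || exact: (bilin_r (@lact3_bilin _ _ _))).
rewrite pent4 // (pent3 (lB U)) //; last exact: lact1.
rewrite (pent5 (lB U) (lB V) (lB W) (lB X)) //; last exact: lact1.
rewrite tassoc_pentagon.
by rewrite -!op4M ?phi_pentagon ?tmul4A //; exact: lactM.
Qed.

Fact ltriangle (U V : lmodule) (t : tens (tens U k^o) V) :
  tmap id (@tscalel k V) (@lassoc U lunit V t) = tmap (@tscaler k U) id t.
Proof.
rewrite /lassoc act_triangle; try exact: lact_bilin.
by rewrite phi_eps act2_1 ?tassoc_triangle //; (exact: lact_bilin || exact: lact1).
Qed.

Definition lmodule_moncat : moncat.
Proof.
apply: (@MonCat lmodule_cat lunit ltens ltmap lassoc_isom lunitl_isom lunitr_isom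
  ltmap_id ltmap_comp).
- by move=> U V W U' V' W' f g h; apply: lmodule_hom_eq => t; exact: lassoc_nat.
- move=> U V f; apply: lmodule_hom_eq => t.
  exact: (tscalel_nat (lhom_lin f)).
- move=> U V f; apply: lmodule_hom_eq => t.
  exact: (tscaler_nat (lhom_lin f)).
- by move=> U V W X; apply: lmodule_hom_eq => t; exact: lpentagon.
- by move=> U V; apply: lmodule_hom_eq => t; exact: ltriangle.
Defined.

Definition fin_dim (V : lmodType k) : Prop :=
  exists (n : nat) (e : 'I_n -> V), forall v,
    exists c : 'I_n -> k, v = \sum_(i < n) c i *: e i.

Fact fin_dim_unit : fin_dim (munit : lmodule_moncat).
Proof.
exists 1%N, (fun=> 1 : k^o) => v; exists (fun=> v).
by rewrite big_ord1 /= -[_ *: _]/(_ * _) mulr1.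
Qed.

Fact fin_dim_tens (U V : lmodule_moncat) :
  fin_dim U -> fin_dim V -> fin_dim (U \om V).
Proof.
move=> [n [e eP]] [m [e' eP']].
pose I := ('I_n * 'I_m)%type.
exists #|{: I}|, (fun i => e (enum_val i).1 \ox e' (enum_val i).2).
have pB := @tpure_bilin k U V.
elim/tens_ind => [u v|s t [c ->] [d ->]]; last first.
  exists (fun i => c i + d i); rewrite -big_split; apply: eq_bigr => i _.
  by rewrite scalerDl.
have [c ->] := eP u; have [d ->] := eP' v.
exists (fun i => c (enum_val i).1 * d (enum_val i).2).
rewrite (lin_sum (bilin_l pB _)).
under eq_bigr => i _ do rewrite (lin_sum (bilin_r pB _)).
rewrite pair_big /= (reindex (@enum_val _ (mem {: I}))) /=; last first.
  by exists enum_rank => i _; rewrite ?enum_valK ?enum_rankK.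
apply: eq_big => [i|i _]; first by [].

by rewrite (linZ (bilin_l pB _)) (linZ (bilin_r pB _)) scalerA.
Qed.

Definition fin_lmodule_moncat : moncat :=
  @full_moncat lmodule_moncat (fun V : lmodule => fin_dim V)
    fin_dim_unit fin_dim_tens.

(* [ract h v] is v.h: the ring element comes first on both sides, so that     *)
(* left and right actions can be fed to [tmap2] in the same way.              *)
Record bimodule := BiModule {
  blmod :> lmodule;
  ract : H -> blmod -> blmod;
  ract_bilin : bilin ract;
  ract1 : forall v, ract 1 v = v;
  ractM : forall g h v, ract (g * h) v = ract h (ract g v);
  lractC : forall g h v, lact g (ract h v) = ract h (lact g v) }.

Record bimodule_hom (U V : bimodule) := BiModuleHom {
  bhom :> lmodule_hom U V;
  bhom_ract : forall h u, bhom (ract h u) = ract h (bhom u) }.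

Lemma bimodule_hom_eq (U V : bimodule) (f g : bimodule_hom U V) :
  bhom f =1 bhom g -> f = g.
Proof.
case: f g => [f fA] [g gA] /= /lmodule_hom_eq fg; subst g.
by congr BiModuleHom; exact: Prop_irrelevance.
Qed.

Definition bimodule_id (U : bimodule) : bimodule_hom U U :=
  @BiModuleHom U U (lmodule_id U) (fun _ _ => erefl).

Fact bimodule_comp_ract (U V W : bimodule) (g : bimodule_hom V W)
    (f : bimodule_hom U V) h u :
  lmodule_comp g f (ract h u) = ract h (lmodule_comp g f u).
Proof. by rewrite /= !bhom_ract. Qed.

Definition bimodule_comp (U V W : bimodule) (g : bimodule_hom V W)
    (f : bimodule_hom U V) : bimodule_hom U W :=
  BiModuleHom (bimodule_comp_ract g f).

Fact bimodule_comp1f (U V : bimodule) (f : bimodule_hom U V) :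
  bimodule_comp (bimodule_id V) f = f.
Proof. exact: bimodule_hom_eq. Qed.

Fact bimodule_compf1 (U V : bimodule) (f : bimodule_hom U V) :
  bimodule_comp f (bimodule_id U) = f.
Proof. exact: bimodule_hom_eq. Qed.

Fact bimodule_compA (U V W X : bimodule) (h : bimodule_hom W X)
    (g : bimodule_hom V W) (f : bimodule_hom U V) :
  bimodule_comp h (bimodule_comp g f) = bimodule_comp (bimodule_comp h g) f.
Proof. exact: bimodule_hom_eq. Qed.

Definition bimodule_cat : category :=
  Category bimodule_comp1f bimodule_compf1 bimodule_compA.

Section BIso.
Variables (U V : bimodule) (f : U -> V) (g : V -> U).
Hypotheses (fL : linear f) (fA : forall h u, f (lact h u) = lact h (f u)).
Hypotheses (fR : forall h u, f (ract h u) = ract h (f u)).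
Hypotheses (fgK : cancel f g) (gfK : cancel g f).

Fact binv_ract h v : g (ract h v) = ract h (g v).
Proof. by rewrite -{1}[v]gfK -fR fgK. Qed.

Definition biso_fwd : bimodule_hom U V :=
  @BiModuleHom U V (LModuleHom fL fA) fR.

Definition biso_bwd : bimodule_hom V U :=
  @BiModuleHom V U (LModuleHom (linv_lin fL fgK gfK) (linv_act fA fgK gfK))
    binv_ract.

Definition bimodule_isom : isom (C := bimodule_cat) U V :=
  @Isom bimodule_cat U V biso_fwd biso_bwd
    (bimodule_hom_eq (f := bimodule_comp biso_bwd biso_fwd)
       (g := bimodule_id U) fgK)
    (bimodule_hom_eq (f := bimodule_comp biso_fwd biso_bwd)
       (g := bimodule_id V) gfK).

End BIso.

Section BTens.
Variables U V : bimodule.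

Definition btens_ract (h : H) (t : ltens U V) : ltens U V :=
  tmap2 (@ract U) (@ract V) (De h) t.

Fact btens_bilin : bilin btens_ract.
Proof. by apply: delta_act_bilin; exact: ract_bilin. Qed.

Fact btens_1 t : btens_ract 1 t = t.
Proof.
rewrite /btens_ract Delta_1.
by apply: act2_1; (exact: ract_bilin || exact: ract1).
Qed.

Fact btens_M g h t : btens_ract (g * h) t = btens_ract h (btens_ract g t).
Proof.
rewrite /btens_ract Delta_M.
by apply: act2Mr; (exact: ract_bilin || exact: mul_bilin || exact: ractM).
Qed.

Fact btens_C g h t : lact g (btens_ract h t) = btens_ract h (lact g t).
Proof.
by apply: act2C; (exact: ract_bilin || exact: lact_bilin || exact: lractC).
Qed.

Definition btens : bimodule := BiModule btens_bilin btens_1 btens_M btens_C.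

End BTens.

Fact bunit_M g h (c : k^o) : ep (g * h) * c = ep h * (ep g * c).
Proof. by rewrite (eps_mon Q).2 mulrA [ep h * _]mulrC. Qed.

Fact bunit_C g h (c : k^o) : ep g * (ep h * c) = ep h * (ep g * c).
Proof. by rewrite mulrCA. Qed.

Definition bunit : bimodule :=
  @BiModule lunit (fun (h : H) (c : k^o) => ep h * c : k^o)
    lunit_bilin lunit_1 bunit_M bunit_C.

Section BTmap.
Variables (U V U' V' : bimodule) (f : bimodule_hom U U') (g : bimodule_hom V V').

Fact btmap_ract h t :
  ltmap f g (ract h (t : btens U V)) = ract h (ltmap f g t : btens U' V').
Proof.
by apply: tmap_act; (exact: ract_bilin || exact: lhom_lin || exact: bhom_ract).
Qed.

Definition btmap : bimodule_hom (btens U V) (btens U' V') :=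
  @BiModuleHom (btens U V) (btens U' V') (ltmap f g) btmap_ract.

End BTmap.

Section BAssoc.
Variables U V W : bimodule.
Local Notation lact3 := (op3 (@lact U) (@lact V) (@lact W)).
Local Notation ract3 := (op3 (@ract U) (@ract V) (@ract W)).

Let lB := lact_bilin.
Let rB := ract_bilin.

Fact ract3_bilin : bilin ract3.
Proof. exact: op3_bilin. Qed.

Fact ract3_M r s t : ract3 (tmul3 r s) t = ract3 s (ract3 r t).
Proof. by apply: op3Mr => //; exact: ractM. Qed.

Fact ract3_1 t : ract3 (tone3 H) t = t.
Proof. by apply: op3_1 => //; exact: ract1. Qed.

Fact lract3_C r s t : lact3 r (ract3 s t) = ract3 s (lact3 r t).
Proof. by apply: op3C => //; exact: lractC. Qed.

Definition bassoc (t : tens (tens U V) W) : tens U (tens V W) :=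
  tmap2 (@ract U) (tmap2 (@ract V) (@ract W)) (phiV Q) (lassoc t).

Definition bassocV (t : tens U (tens V W)) : tens (tens U V) W :=
  lassocV (tmap2 (@ract U) (tmap2 (@ract V) (@ract W)) (phi Q) t).

Fact bassoc_lin : linear bassoc.
Proof. exact: (lin_comp (bilin_r ract3_bilin _) (@lassoc_lin _ _ _)). Qed.

Fact bassocK : cancel bassoc bassocV.
Proof.
move=> t; rewrite /bassocV /bassoc -/ract3 -ract3_M phiVphi ract3_1.
exact: lassocK.
Qed.

Fact bassocVK : cancel bassocV bassoc.
Proof.
by move=> t; rewrite /bassoc /bassocV lassocVK -/ract3 -ract3_M phiphiV ract3_1.
Qed.

Fact bassoc_act h t : bassoc (lact h (t : btens (btens U V) W)) =
  lact h (bassoc t : btens U (btens V W)).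
Proof.
rewrite /bassoc lassoc_act /= /ltens_act /= /ltens_act actr //.
by rewrite -/ract3 -lract3_C actr.
Qed.

Fact bassoc_ract h t : bassoc (ract h (t : btens (btens U V) W)) =
  ract h (bassoc t : btens U (btens V W)).
Proof.
rewrite /bassoc /lassoc /= /btens_ract /= /btens_ract.
rewrite actl // actr // -/lact3 -/ract3.
by rewrite lract3_C -!ract3_M phiV_coassoc.
Qed.

Definition bassoc_isom :
    isom (C := bimodule_cat) (btens (btens U V) W) (btens U (btens V W)) :=
  @bimodule_isom (btens (btens U V) W) (btens U (btens V W))
    bassoc bassocV bassoc_lin bassoc_act bassoc_ract bassocK bassocVK.

End BAssoc.

Section BUnit.
Variable U : bimodule.

Fact bunitl_ract h t :
  tscalel (ract h (t : btens bunit U)) = ract h (tscalel t).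
Proof.
by rewrite /= /btens_ract eps_act_l ?eps_Delta //; exact: ract_bilin.
Qed.

Definition bunitl_isom : isom (C := bimodule_cat) (btens bunit U) U :=
  @bimodule_isom (btens bunit U) U _ _ (@tscalel_lin k U) (@lunitl_act U)
    bunitl_ract (@tscalelK k U) (@lunitl_K U).

Fact bunitr_ract h t :
  tscaler (ract h (t : btens U bunit)) = ract h (tscaler t).
Proof.
by rewrite /= /btens_ract eps_act_r ?Delta_eps //; exact: ract_bilin.
Qed.

Definition bunitr_isom : isom (C := bimodule_cat) (btens U bunit) U :=
  @bimodule_isom (btens U bunit) U _ _ (@tscaler_lin k U) (@lunitr_act U)
    bunitr_ract (@tscalerK k U) (@lunitr_K U).

End BUnit.

Fact bassoc_nat (U V W U' V' W' : bimodule) (f : bimodule_hom U U')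
    (g : bimodule_hom V V') (h : bimodule_hom W W') t :
  bassoc (tmap (tmap f g) h t) = tmap f (tmap g h) (bassoc t).
Proof.
rewrite /bassoc lassoc_nat.
by symmetry; apply: op3_nat;
  (exact: ract_bilin || exact: lhom_lin || exact: bhom_ract).
Qed.

Fact bpentagon (U V W X : bimodule) (t : tens (tens (tens U V) W) X) :
  @bassoc U V (btens W X) (@bassoc (btens U V) W X t) =
  tmap id (@bassoc V W X) (@bassoc U (btens V W) X (tmap (@bassoc U V W) id t)).
Proof.
have aL U V W := @tassoc_lin k U V W.
have lB := lact_bilin; have rB := ract_bilin.
have l3L U V W s := bilin_r (@lact3_bilin U V W) s.
have r3L U V W s := bilin_r (@ract3_bilin U V W) s.
have idL (Y : lmodType k) : linear (@id Y) by exact: lin_id.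
rewrite /bassoc /lassoc /= /ltens_act /btens_ract.
rewrite !pent1 // !pent2 //.
have -> : tmap (fun x => tmap2 (@ract U) (tmap2 (@ract V) (@ract W)) (phiV Q)
      (tmap2 (@lact U) (tmap2 (@lact V) (@lact W)) (phi Q) (tassoc x))) id t =
    tmap (op3 (@ract U) (@ract V) (@ract W) (phiV Q)) id
      (tmap (op3 (@lact U) (@lact V) (@lact W) (phi Q)) id
        (tmap (@tassoc _ _ _ _) id t)).
  rewrite !tmap_comp //; try exact: aL; try exact: l3L; try exact: r3L.
  exact: (lin_comp (r3L _ _ _ _) (l3L _ _ _ _)).
have -> z : tmap id (fun x =>
      tmap2 (@ract V) (tmap2 (@ract W) (@ract X)) (phiV Q)
      (tmap2 (@lact V) (tmap2 (@lact W) (@lact X)) (phi Q) (tassoc x))) z =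
    tmap (id : U -> U) (op3 (@ract V) (@ract W) (@ract X) (phiV Q))
      (tmap (id : U -> U) (op3 (@lact V) (@lact W) (@lact X) (phi Q))
        (tmap id (@tassoc _ _ _ _) z)).
  rewrite !tmap_comp //; try exact: aL; try exact: l3L; try exact: r3L.
  exact: (lin_comp (r3L _ _ _ _) (l3L _ _ _ _)).
rewrite !pent4 //.
rewrite (pent3 (rB U) (rB V) (rB W) (rB X) (@ract1 U)).
rewrite (pent3 (lB U) (lB V) (lB W) (lB X) (@lact1 U)).
rewrite (pent5 (rB U) (rB V) (rB W) (rB X)) //; last exact: ract1.
rewrite (pent5 (lB U) (lB V) (lB W) (lB X)) //; last exact: lact1.
rewrite tassoc_pentagon.
have LR s s' y : op4 (@lact U) (@lact V) (@lact W) (@lact X) s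
      (op4 (@ract U) (@ract V) (@ract W) (@ract X) s' y) =
    op4 (@ract U) (@ract V) (@ract W) (@ract X) s'
      (op4 (@lact U) (@lact V) (@lact W) (@lact X) s y).
  by apply: op4C => //; exact: lractC.
rewrite !LR.
rewrite -!(op4M (lB U) (lB V) (lB W) (lB X)); try exact: lactM.
rewrite -!(op4Mr (rB U) (rB V) (rB W) (rB X)); try exact: ractM.
rewrite [tmul4 (tassoc (tmap De id (phiV Q))) _]inv_pentagon -!tmul4A.
by rewrite phi_pentagon -tmul4A.
Qed.

Fact btriangle (U V : bimodule) (t : tens (tens U k^o) V) :
  tmap id (@tscalel k V) (@bassoc U bunit V t) = tmap (@tscaler k U) id t.
Proof.
rewrite /bassoc act_triangle; try exact: ract_bilin.
by rewrite phiV_eps act2_1 ?ltriangle //; (exact: ract_bilin || exact: ract1).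
Qed.

Definition bimodule_moncat : moncat.
Proof.
apply: (@MonCat bimodule_cat bunit btens btmap bassoc_isom bunitl_isom bunitr_isom).
- by move=> U V; apply: bimodule_hom_eq => t; exact: tmap_id.
- move=> U V U' V' U'' V'' f' g' f g; apply: bimodule_hom_eq => t.
  by rewrite /= tmap_comp //; exact: lhom_lin.
- by move=> U V W U' V' W' f g h; apply: bimodule_hom_eq => t; exact: bassoc_nat.
- move=> U V f; apply: bimodule_hom_eq => t.
  exact: (tscalel_nat (lhom_lin f)).
- move=> U V f; apply: bimodule_hom_eq => t.
  exact: (tscaler_nat (lhom_lin f)).
- by move=> U V W X; apply: bimodule_hom_eq => t; exact: bpentagon.
- by move=> U V; apply: bimodule_hom_eq => t; exact: btriangle.
Defined.

Definition lregular : lmodule :=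
  @LModule H *%R (@mul_bilin k H) (@mul1r H) (fun g h v => esym (mulrA g h v)).

Definition regular : bimodule :=
  @BiModule lregular (fun h v => v * h) (bilin_flip (@mul_bilin k H))
    (@mulr1 H) (fun g h v => mulrA v g h) (fun g h v => mulrA g v h).

Fact regular_Delta_ract h u :
  De (ract h (u : regular)) = ract h (De u : btens regular regular).
Proof.
rewrite /= /btens_ract Delta_M.
exact: (tmap2_flip (@mul_bilin k H) (@mul_bilin k H)).
Qed.

Definition regular_comul : bimodule_hom regular (btens regular regular) :=
  @BiModuleHom regular (btens regular regular)
    (@LModuleHom lregular (ltens lregular lregular) De (Delta_lin Q) (Delta_M Q))
    regular_Delta_ract.

Fact regular_eps_ract h u :
  ep (ract h (u : regular)) = ract h (ep u : bunit).
Proof. by rewrite /= (eps_mon Q).2 mulrC. Qed.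

Definition regular_counit : bimodule_hom regular bunit :=
  @BiModuleHom regular bunit
    (@LModuleHom lregular lunit ep (eps_lin Q) (eps_mon Q).2) regular_eps_ract.

Fact regular_comulA h :
  @bassoc regular regular regular (tmap De id (De h)) = tmap id De (De h).
Proof.
have mB := @mul_bilin k H.
have flip s t : tmap2 (@ract regular) (tmap2 (@ract regular) (@ract regular)) s t =
    tmul3 t s.
  rewrite /tmul3 (tmap2_flip mB (@tmul2_bilin k H)); apply: eq_tmap2 => // b v.
  by rewrite /tmul2 (tmap2_flip mB mB).
rewrite /bassoc flip /lassoc -[tmap2 _ _ (phi Q) _]/(tmul3 _ _).
by rewrite -Delta_coassoc -tmul3A phiphiV tmul3_1r.
Qed.

Definition regular_coalgebra : coalgebra bimodule_moncat.
Proof.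
apply: (@Coalgebra bimodule_moncat regular regular_comul regular_counit).
- by apply: bimodule_hom_eq => h; exact: regular_comulA.
- by apply: bimodule_hom_eq => h; exact: eps_Delta.
- by apply: bimodule_hom_eq => h; exact: Delta_eps.
Defined.

Definition hopf_module_cat : category := comodule_cat regular_coalgebra.

Section Triv.
Variable V : lmodule.

Definition triv_ract (h : H) (v : V) : V := eps Q h *: v.

Fact triv_bilin : bilin triv_ract.
Proof.
apply: bilinI => x a y z; rewrite /triv_ract.
  by rewrite (eps_lin Q) scalerDl scalerA.
by rewrite scalerDr !scalerA mulrC.
Qed.

Fact triv_1 v : triv_ract 1 v = v.
Proof. by rewrite /triv_ract (eps_mon Q).1 scale1r. Qed.

Fact triv_M g h v : triv_ract (g * h) v = triv_ract h (triv_ract g v).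
Proof. by rewrite /triv_ract (eps_mon Q).2 scalerA mulrC. Qed.

Fact triv_C g h v : lact g (triv_ract h v) = triv_ract h (lact g v).
Proof. exact: (linZ (bilin_r (@lact_bilin V) g)). Qed.

Definition triv : bimodule := BiModule triv_bilin triv_1 triv_M triv_C.

End Triv.

Fact triv_hom_ract (U V : lmodule) (f : lmodule_hom U V) h u :
  f (ract h (u : triv U)) = ract h (f u : triv V).
Proof. exact: (linZ (lhom_lin f)). Qed.

Definition triv_hom (U V : lmodule) (f : lmodule_hom U V) :
  bimodule_hom (triv U) (triv V) :=
  @BiModuleHom (triv U) (triv V) f (triv_hom_ract f).

Definition triv_functor : functor lmodule_cat bimodule_cat.
Proof.
by apply: (@Functor lmodule_cat bimodule_cat triv triv_hom) => *;
  exact: bimodule_hom_eq.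
Defined.

Definition R_functor : functor lmodule_moncat hopf_module_cat :=
  comp_functor (cofree_functor regular_coalgebra) triv_functor.

End Modules.

(* Main.v *)
From Pilot Require Import Defs.
From mathcomp Require Import all_boot all_algebra falgebra.
From HB Require Import structures.
From mathcomp Require Import boolp.
(* [Hom] is also defined in [vector]; this restores the field of [category]. *)
Import Pilot.Defs.

(* (1) => (2) is as for Hopf algebras: V^* is a dual of V, with h acting      *)
(* through S h, and with ev and db twisted by alpha and beta.                 *)
(*                                                                            *)
(* (2) => (3).  R is always fully faithful, with left adjoint M |-> M / MH^+. *)
(* If ev and d = sum b (x) a in H (x) A exhibit A as a dual of the regular    *)
(* module H, then G(m, h) = phi1 m_0 b ev(phi2 m_1 a (x) phi3 h) satisfies    *)
(* G(m j, h) = eps(j) G(m, h) and G(m_0, m_1) = m, and this forces the unit   *)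
(* M -> (M / MH^+) (x) H to be bijective.                                     *)
(*                                                                            *)
(* (3) => (1).  Let P be H with left action through eps and regular right     *)
(* action.  The Hopf module P (x) H is isomorphic to some R(V) = V (x) H, and *)
(* left multiplication on P gives a second action q.v of H on V, commuting    *)
(* with the first one, for which V^n and H^n are isomorphic, n = dim H.  By a *)
(* cancellation of Krull-Schmidt type V is free on some v0 for this action.   *)
(* S is defined by h v0 = (S h).v0, while alpha and beta.v0 are the images    *)
(* under id (x) eps of the elements corresponding to v0 (x) 1 in P (x) H and  *)
(* to 1 (x) 1 in V (x) H.                                                     *)

(** A quasiantipode turns the linear dual of a finite-dimensional module into a categorical dual:
    the axioms on alpha and beta make evaluation and coevaluation H-linear, and those on phi and
    phi^-1 give the two triangle identities ([quasi_hopf_rigid]).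

    A dual of the single module H in turn controls every Hopf module M. It yields the operator
    [recon], which factors through M / MH^+ ([recon_ract]), recovers m from its coaction
    ([recon_rho]) and is natural ([recon_nat]). The first two make the unit M -> R(M / MH^+)
    injective, and naturality makes it surjective; with [R_faithful] and [R_full] this is
    [rigid_equivalence].

    Finally, let psi : R(V) -> P (x) H be an isomorphism. Both sides are cofree, so psi and psi^-1
    are determined by their composites [vtau] and [vpi] with id (x) eps. Once V is free on v0
    ([act_cyclic], [act_free]), these read vtau(q.v0 (x) h) = q alpha h and vpi(p (x) h) = (p beta
    S(h)).v0. Their H-linearity gives the axioms on alpha and beta, and psi psi^-1 = id, psi^-1 psi
    = id give those on phi and phi^-1 ([quasi_hopf_of_isom]). *)

Set Implicit Arguments.
Unset Strict Implicit.
Unset Printing Implicit Defensive.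
Import GRing.Theory.
Local Open Scope ring_scope.

(** * Equivalences, coherence and cofree comodules *)

Section Equivalence.
Variables (C D : category) (F : functor C D).

(** Preimages of objects and morphisms are chosen with [cid]; faithfulness makes these choices
    functorial and natural. *)
Lemma equivalence_of_fully_faithful :
  (forall (X Y : C) (f g : Hom X Y), fmap F f = fmap F g -> f = g) ->
  (forall (X Y : C) (u : Hom (F X) (F Y)), exists f, fmap F f = u) ->
  (forall Y : D, exists X : C, inhabited (isom (F X) Y)) ->
  is_equivalence F.
Proof.
move=> faith full surj.
have e0 Y : {X : C & isom (F X) Y}.
  have /cid [] // : exists _ : {X : C & isom (F X) Y}, True.
  by have [X [i]] := surj Y; exists (existT _ X i).
pose G0 Y := projT1 (e0 Y); pose e Y : isom (F (G0 Y)) Y := projT2 (e0 Y).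
pose G1 Y Z (u : Hom Y Z) := sval (cid (full _ _ (bwd (e Z) \oc (u \oc e Y)))).
have G1E Y Z (u : Hom Y Z) : fmap F (G1 _ _ u) = bwd (e Z) \oc (u \oc e Y).
  exact: (svalP (cid (full _ _ (bwd (e Z) \oc (u \oc e Y))))).
have eG Y Z (u : Hom Y Z) : e Z \oc fmap F (G1 _ _ u) = u \oc e Y.
  by rewrite G1E compA bwdK comp1f.
have Gid Y : G1 _ _ (idc Y) = idc _.
  by apply: faith; rewrite G1E comp1f fwdK fmap_id.
have Gcomp X Y Z (v : Hom Y Z) (u : Hom X Y) :
    G1 _ _ (v \oc u) = G1 _ _ v \oc G1 _ _ u.
  by apply: faith; rewrite fmap_comp [LHS]G1E [fmap F (G1 Y Z v)]G1E -!compA eG.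
pose G := Functor Gid Gcomp.
pose a X := sval (cid (full _ _ (bwd (e (F X))))).
have aE X : fmap F (a X) = bwd (e (F X)) by exact: (svalP (cid (full _ _ (bwd (e (F X)))))).
pose b X := sval (cid (full _ _ (fwd (e (F X))))).
have bE X : fmap F (b X) = e (F X) by exact: (svalP (cid (full _ _ (fwd (e (F X)))))).
have ba X : b X \oc a X = idc X by apply: faith; rewrite fmap_comp aE bE bwdK fmap_id.
have ab X : a X \oc b X = idc _ by apply: faith; rewrite fmap_comp aE bE fwdK fmap_id.
exists G; split; constructor.
- exists (fun X => @Isom C X (G (F X)) (a X) (b X) (ba X) (ab X)) => X Y f.
  by apply: faith; rewrite /= !fmap_comp !aE G1E -!compA bwdK compf1.
- exact: (@NatIso D D (comp_functor F G) (id_functor D) e eG).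
Qed.

End Equivalence.

Section Comodules.
Variable C : moncat.

(* Kelly's coherence identity, in the mirror image of [mrunit_ten].           *)
Lemma mlunit_ten (X Y : C) :
  mlunit (X \om Y) \oc massoc munit X Y = mlunit X \tm idc Y.
Proof.
have faithful (Z T : C) (f g : Hom Z T) :
    idc munit \tm f = idc munit \tm g -> f = g.
  by move=> fg; apply: (@isom_epic _ _ _ _ (mlunit Z)); rewrite -!mlunit_nat fg.
apply: faithful; rewrite mmap_compr.
apply: (@isom_epic _ _ _ _ (massoc munit (munit \om X) Y)).
have epi (Z : C) (f g : Hom (munit \om (munit \om X) \om Y) Z) :
    f \oc (massoc munit munit X \tm idc Y) = g \oc (massoc munit munit X \tm idc Y) ->
    f = g.
  move=> /(congr1 (comp^~ (bwd (massoc munit munit X) \tm idc Y))).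
  by rewrite -!compA -!mmap_compl bwdK mmap_id !compf1.
apply: epi.
rewrite -!compA [_ \oc (massoc munit _ _ \oc _)]compA -pentagon.
rewrite compA triangle -[idc (X \om Y)]mmap_id -massoc_nat.
by rewrite compA -massoc_nat -compA -mmap_compl triangle.
Qed.

Variable K : coalgebra C.
Local Notation pr P := (mrunit P \oc (idc P \tm counit K)).

Lemma cofree_coact_pr (P : C) :
  (pr P \tm idc K) \oc cofree_coact K P = idc (P \om K).
Proof.
rewrite mmap_compl -triangle /cofree_coact -!compA [_ \oc (bwd _ \oc _)]compA.
rewrite -bwd_assoc_nat [massoc _ _ _ \oc _]compA [massoc _ _ _ \oc _]compA bwdK comp1f.
by rewrite -!mmap_compr compA counitl mmap_id.
Qed.

(** Uniqueness in the universal property of the cofree comodule: colinearity moves u past the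
    coaction, where [cofree_coact_pr] applies. [cofree_lift] is the existence part. *)
Lemma cofree_hom_pr (N : comodule K) (P : C) (u : comodule_hom N (cofree K P)) :
  comod_hom u = ((pr P \oc u) \tm idc K) \oc coact N.
Proof.
have := comod_homP u; rewrite /= => uP.
rewrite mmap_compl -compA -uP compA.
by rewrite cofree_coact_pr comp1f.
Qed.

Lemma cofree_lift_proof (M : comodule K) (P : C) (q : Hom (comod M) P) :
  coact (cofree K P) \oc ((q \tm idc K) \oc coact M) =
  (((q \tm idc K) \oc coact M) \tm idc K) \oc coact M.
Proof.
rewrite /= /cofree_coact mmap_compl -compA.
rewrite [(idc P \tm comul K) \oc _]compA -mmap_comp comp1f compf1.
have -> : q \tm comul K = (q \tm (idc K \tm idc K)) \oc (idc _ \tm comul K).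
  by rewrite mmap_id -mmap_comp comp1f compf1.
by rewrite -compA -coactA !compA bwd_assoc_nat -!compA [bwd _ \oc _]compA fwdK comp1f.
Qed.

Definition cofree_lift (M : comodule K) (P : C) (q : Hom (comod M) P) :
  comodule_hom M (cofree K P) := ComoduleHom (cofree_lift_proof q).

End Comodules.

(** * Cancellation for modules over a finite-dimensional algebra *)

Definition lfun_of (k : fieldType) (U V : vectType k) (f : U -> V)
    (fL : linear f) : 'Hom(U, V) :=
  linfun (HB.pack f (GRing.isLinear.Build k U V *:%R f fL) : {linear U -> V}).

Lemma lfun_ofE (k : fieldType) (U V : vectType k) (f : U -> V)
  (fL : linear f) : lfun_of fL =1 f.
Proof. by move=> x; rewrite lfunE. Qed.

Lemma lfun_ker_exists (k : fieldType) (U V : vectType k) (f : 'Hom(U, V)) :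
  (dim V < dim U)%N -> exists2 u, u != 0 & f u = 0.
Proof.
move=> VU; exists (vpick (lker f)); last by apply/eqP; rewrite -memv_ker memv_pick.
rewrite vpick0 -dimv_eq0 -lt0n -(ltn_add2r (\dim (limg f))) add0n.
have := limg_ker_dim f fullv; rewrite capfv dimvf => ->.
by apply: leq_ltn_trans VU; rewrite -dimvf dimvS ?subvf.
Qed.

Section Cyclic.
Variables (k : fieldType) (H : falgType k) (V : vectType k) (act : H -> V -> V).
Hypotheses (actB : bilin act) (act1 : forall x, act 1 x = x).
Hypothesis actM : forall g h x, act (g * h) x = act g (act h x).

Definition stable (C : {vspace V}) := forall h x, x \in C -> act h x \in C.

Definition orbm v : 'Hom(H, V) := lfun_of (bilin_l actB v).
Definition orb v := limg (orbm v).

Lemma orbP v x : reflect (exists h, x = act h v) (x \in orb v).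
Proof.
apply: (iffP memv_imgP) => [[h _ ->]|[h ->]]; first by exists h; rewrite lfun_ofE.
by exists h; rewrite ?memvf ?lfun_ofE.
Qed.

Lemma orb_stable v : stable (orb v).
Proof. by move=> h x /orbP[g ->]; apply/orbP; exists (h * g); rewrite actM. Qed.

Lemma orb_id v : v \in orb v.
Proof. by apply/orbP; exists 1; rewrite act1. Qed.

Lemma orb_sub v (C : {vspace V}) : stable C -> v \in C -> (orb v <= C)%VS.
Proof. by move=> Cs vC; apply/subvP => x /orbP[h ->]; exact: Cs. Qed.

Lemma stable_add (C D : {vspace V}) : stable C -> stable D -> stable (C + D)%VS.
Proof.
move=> Cs Ds h x /memv_addP[c cC [d dD ->]].
by rewrite (linD (bilin_r actB h)) memv_add ?Cs ?Ds.
Qed.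

Lemma stable_cap (C D : {vspace V}) : stable C -> stable D -> stable (C :&: D)%VS.
Proof. by move=> Cs Ds h x /memv_capP[xC xD]; apply/memv_capP; rewrite Cs ?Ds. Qed.

(** The minimum runs over all pairs (v, C), because C has to be compared with supplements of other
    cyclic submodules. *)
Lemma minimal_supplement : exists v (C : {vspace V}),
  [/\ stable C, (orb v + C)%VS = fullv &
    forall v' (C' : {vspace V}), stable C' -> (orb v' + C')%VS = fullv ->
      (\dim C <= \dim C')%N].
Proof.
pose P d := `[< exists v (C : {vspace V}),
  [/\ stable C, (orb v + C)%VS = fullv & \dim C = d] >].
have exP : exists d, P d.
  exists (\dim (fullv : {vspace V})); apply/asboolP; exists 0, fullv; split=> //.
    by move=> h x _; rewrite memvf.
  by rewrite addvf.
case: (ex_minnP exP) => d /asboolP[v [C [Cs vC dC]]] dmin.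
exists v, C; split=> // v' C' Cs' vC'; rewrite dC; apply: dmin.
by apply/asboolP; exists v', C'.
Qed.

(** Take N of maximal dimension among the proper submodules above W; the last clause says that V / N
    is simple. *)
Lemma maximal_stable (W : {vspace V}) : stable W -> W <> fullv ->
  exists N : {vspace V}, [/\ stable N, (W <= N)%VS, N <> fullv &
    forall D : {vspace V}, stable D -> ~~ (D <= N)%VS -> (D + N)%VS = fullv].
Proof.
move=> Ws Wf.
pose P d := `[< exists N : {vspace V},
  [/\ stable N, (W <= N)%VS, N <> fullv & \dim N = d] >].
have exP : exists d, P d by exists (\dim W); apply/asboolP; exists W.
have ubP d : P d -> (d <= \dim (fullv : {vspace V}))%N.
  by move=> /asboolP[N [_ _ _ <-]]; apply: dimvS; exact: subvf.
case: (ex_maxnP exP ubP) => d /asboolP[N [Ns WN Nf dN]] dmax.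
exists N; split=> // D Ds; apply: contraNP => DNf.
have le_d : (\dim (D + N) <= \dim N)%N.
  rewrite dN; apply: dmax; apply/asboolP; exists (D + N)%VS; split=> //.
    exact: stable_add.
  exact: subv_trans WN (addvSr _ _).
have := geq_leqif (dimv_leqif_sup (addvSr D N)); rewrite le_d => /esym.
exact: subv_trans (addvSl _ _).
Qed.

(* The heart of the cancellation: at a minimal supplement C of a cyclic       *)
(* submodule Hv, the left ideal L = {y | y v \in C} kills V / N.  Otherwise,  *)
(* for some w in C, L (v + w) is not contained in N, and N :&: C is a smaller *)
(* supplement of H (v + w).                                                   *)
Lemma supplement_kills v (C N : {vspace V}) :
  stable C -> (orb v + C)%VS = fullv ->
  (forall v' (C' : {vspace V}), stable C' -> (orb v' + C')%VS = fullv ->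
      (\dim C <= \dim C')%N) ->
  stable N -> (orb v <= N)%VS -> N <> fullv ->
  (forall D : {vspace V}, stable D -> ~~ (D <= N)%VS -> (D + N)%VS = fullv) ->
  forall y x, act y v \in C -> act y x \in N.
Proof.
move=> Cs vC Cmin Ns vN Nf Nmax y x yvC.
have killC w : w \in C -> act y (v + w) \in N.
  move=> wC; apply: contraTT isT => ywN.
  pose D := (orbm (v + w) @: (orbm v @^-1: C))%VS.
  have DP z : z \in D -> exists2 h, act h v \in C & z = act h (v + w).
    by move=> /memv_imgP[h]; rewrite -memv_preim lfun_ofE => hC ->; exists h; rewrite ?lfun_ofE.
  have PD h : act h v \in C -> act h (v + w) \in D.
    by move=> hC; apply/memv_imgP; exists h; rewrite -?memv_preim lfun_ofE.
  have Ds : stable D by move=> h z /DP[g gC ->]; rewrite -actM PD // actM Cs.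
  have DC : (D <= C)%VS.
    apply/subvP => z /DP[g gC ->].
    by rewrite (linD (bilin_r actB g)) rpredD // Cs.
  have DNf : (D + N)%VS = fullv.
    by apply: Nmax => //; apply: contra ywN => /subvP; apply; exact: PD.
  have DO : (D <= orb (v + w))%VS.
    by apply/subvP => z /DP[g _ ->]; apply/orbP; exists g.
  (* Modular law: D lies in C and D + N is everything, so C = D + (N :&: C). *)
  have CD : (C <= orb (v + w) + (N :&: C))%VS.
    apply: subv_trans (addvS DO (subvv _)).
    by rewrite vspace_modl // DNf capfv.
  have Cs' := stable_cap Ns Cs.
  have vC' : (orb (v + w) + (N :&: C))%VS = fullv.
    have S := stable_add (@orb_stable (v + w)) Cs'.
    apply/eqP; rewrite eqEsubv subvf -vC subv_add CD andbT.
    apply: orb_sub => //; rewrite -[v in v \in _](addrK w) rpredB //.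
      exact: (subvP (addvSl _ _)) _ (orb_id _).
    exact: (subvP CD).
  (* Minimality forces N :&: C = C, so N contains both Hv and C, although it is proper. *)
  have := geq_leqif (dimv_leqif_sup (capvSr N C)); rewrite (Cmin (v + w)) // => /esym.
  rewrite subv_cap subvv andbT => CN.
  by case: Nf; apply/eqP; rewrite eqEsubv subvf -vC subv_add vN CN.
have : x \in (orb v + C)%VS by rewrite vC memvf.
move=> /memv_addP[u uO [c cC ->]].
have yvN : act y v \in N by apply: (subvP vN); apply/orbP; exists y.
rewrite (linD (bilin_r actB y)) rpredD //.
  by apply: Ns; exact: (subvP vN).
by have := killC c cC; rewrite (linD (bilin_r actB y)) rpredDl.
Qed.

(* If V were not cyclic, the kernel of V -> T := V / N and the maps           *)
(* f_t : h v + c |-> h t would give an injection of (T (+) k)^n into          *)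
(* Hom_H(V^n, T), hence into T^n since n elements generate V^n.               *)
Lemma power_generated_cyclic (n : nat) (th : 'I_n -> 'I_n -> V) :
  (0 < n)%N ->
  (forall x : 'I_n -> V, exists q : 'I_n -> H,
     forall i, x i = \sum_(j < n) act (q j) (th j i)) ->
  exists v, forall x, exists h, x = act h v.
Proof.
move=> n_gt0 gen.
have [v [C [Cs vC Cmin]]] := minimal_supplement.
exists v => x; apply/orbP; move: x.
have [/eqP|/eqP vf] := eqVneq (orb v) fullv.
  by move=> /eqP -> x; rewrite memvf.
have [N [Ns vN Nf Nmax]] := maximal_stable (@orb_stable v) vf.
have kill := supplement_kills Cs vC Cmin Ns vN Nf Nmax.
(* V / N is modelled by the complement [N^C], with p as quotient map; g acts on a class t by
   [p (act g (vsval t))]. *)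
pose T : vectType k := subvs_of (N^C)%VS.
have vsL : linear (vsval : T -> V) by [].
pose p x : T := vsproj (N^C)%VS (daddv_pi N^C N x).
have pL : linear p by move=> a x y; rewrite /p !linearP.
have capN : ((N^C) :&: N = 0)%VS by rewrite capvC capv_compl.
have pval (t : T) : p (vsval t) = t.
  by rewrite /p daddv_pi_id ?subvsP // vsvalK.
have pE x : p x = 0 <-> x \in N.
  have xE : daddv_pi N^C N x + daddv_pi N N^C x = x.
    by apply: daddv_pi_add => //; rewrite addvC addv_complf memvf.
  split=> [/(congr1 vsval)|xN].
    rewrite /= vsprojK ?memv_pi // => x0.
    by rewrite -xE x0 add0r memv_pi.
  have : daddv_pi N^C N x = 0.
    move: xE; rewrite [daddv_pi N _ x]daddv_pi_id ?capv_compl //.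
    by move=> /(canRL (addrK _)); rewrite subrr.
  by rewrite /p => ->; rewrite linear0.
have pB u z : p (u - z) = p u - p z.
  by rewrite (linD pL) -[in LHS]scaleN1r (linZ pL) scaleN1r.
have actBr g u z : act g (u - z) = act g u - act g z.
  by rewrite (linD (bilin_r actB g)) -[in LHS]scaleN1r (linZ (bilin_r actB g)) scaleN1r.
have pact g x y : p x = p y -> p (act g x) = p (act g y).
  move=> pxy; apply: subr0_eq; rewrite -pB -actBr; apply/pE/Ns/pE.
  by rewrite pB pxy subrr.
(* A linear choice of coefficients: [act (h x) v] is a component of x in Hv, for V = Hv + C. *)
pose h x : H := (orbm v)^-1%VF (addv_pi1 (orb v) C x).
have hL : linear h by move=> a x y; rewrite /h !linearP.
have hv x : x - act (h x) v \in C.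
  have -> : act (h x) v = addv_pi1 (orb v) C x.
    rewrite -[LHS](lfun_ofE (bilin_l actB v)) -/(orbm v) limg_lfunVK //.
    exact: memv_pi1.
  rewrite -[x in x - _](@addv_pi1_pi2 _ _ (orb v) C x) ?vC ?memvf //.
  by rewrite addrAC subrr add0r memv_pi2.
(* Changing [h x] by some y with y v in C has no effect, by [kill]; hence [f t] is H-linear and
   sends v to t. *)
pose f (t : T) x := p (act (h x) (vsval t)).
have kill_eq g g' z : act g v - act g' v \in C -> p (act g z) = p (act g' z).
  rewrite -scaleN1r -(linZ (bilin_l actB v)) -(linD (bilin_l actB v)).
  move=> /(kill _ z)/pE.
  rewrite (linD (bilin_l actB z)) (linZ (bilin_l actB z)) (linD pL) (linZ pL).
  by rewrite scaleN1r => /eqP; rewrite subr_eq0 => /eqP.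
have fv t : f t v = t.
  by rewrite /f (kill_eq _ 1) ?act1 ?pval // -opprB rpredN.
have f_act t g x : f t (act g x) = p (act g (vsval (f t x))).
  have pp : p (act (h x) (vsval t)) = p (vsval (f t x)) by rewrite pval.
  rewrite -(pact g _ _ pp) -actM; apply: kill_eq.
  have := Cs g _ (hv x); have := hv (act g x).
  rewrite actBr -actM => a b; have := rpredB b a; by rewrite opprB addrC subrKA.
have fB : bilin f.
  apply: bilinI => [x|t] a y z; rewrite /f.
    by rewrite vsL (bilin_r actB) pL.
  by rewrite hL (bilin_l actB) pL.
pose F (w : {ffun 'I_n -> (T * k^o)%type}) i x := f (w i).1 x + (w i).2 *: p x.
have F_act w i g x : F w i (act g x) = p (act g (vsval (F w i x))).
  rewrite /F f_act (linD vsL) (linZ vsL) (linD (bilin_r actB g)) (linZ (bilin_r actB g)).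
  rewrite (linD pL) (linZ pL); congr (_ + _ *: _).
  by apply: pact; rewrite pval.
pose Psi w : {ffun 'I_n -> T} := [ffun j => \sum_(i < n) F w i (th j i)].
have PsiL : linear Psi.
  move=> a w w'; apply/ffunP => j; rewrite !ffunE scaler_sumr -big_split /=.
  apply: eq_bigr => i _; rewrite /F !ffunE /= (bilin_l fB) scalerDl scalerDr.
  by rewrite -scalerA addrACA.
(* The dimensions are n (dim T + 1) and n dim T, and n > 0. *)
have [|w wN0 wPsi] := @lfun_ker_exists _ _ _ (lfun_of PsiL).
  by rewrite /dim /= card_ord ltn_pmul2l // -addn1.
have FE (x : 'I_n -> V) : \sum_i F w i (x i) = 0.
  have [q qE] := gen x; under eq_bigr => i _ do rewrite qE.
  have Fsum i (G : 'I_n -> V) : F w i (\sum_j G j) = \sum_j F w i (G j).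
    rewrite /F (lin_sum (bilin_r fB _)) (lin_sum pL) scaler_sumr.
    by rewrite -big_split.
  under eq_bigr => i _ do rewrite Fsum.
  rewrite exchange_big big1 // => j _.
  under eq_bigr => i _ do rewrite F_act.
  have gL : linear (fun t : T => p (act (q j) (vsval t))).
    by move=> a t t'; rewrite vsL (bilin_r actB) pL.
  rewrite -(lin_sum gL); have := congr1 (fun z : {ffun 'I_n -> T} => z j) wPsi.
  by rewrite lfun_ofE !ffunE => ->; rewrite (lin0 gL).
have F0 i x : F w i x = 0.
  have := FE (fun j => if j == i then x else 0).
  rewrite (bigD1 i) //= eqxx big1 ?addr0 // => j /negPf ->.
  by rewrite /F (lin0 (bilin_r fB _)) (lin0 pL) scaler0 addr0.
(* At v the map p vanishes while [f t] gives t, so the T-components of w are 0; then so are its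
   scalars, as p is nonzero. *)
have pv : p v = 0 by apply/pE/(subvP vN)/orb_id.
have w1 i : (w i).1 = 0 by have := F0 i v; rewrite /F fv pv scaler0 addr0.
have /eqP[] := wN0; apply/ffunP => i; rewrite ffunE; apply: injective_projections.
  exact: w1.
apply: contra_notP Nf => /eqP w2; apply/eqP; rewrite eqEsubv subvf.
apply/subvP => x _; apply/pE.
have := F0 i x; rewrite /F w1 (lin0 (bilin_l fB _)) add0r => /eqP.
by rewrite scaler_eq0 (negPf w2) => /eqP.
Qed.

End Cyclic.

(** * Duals over a quasi-Hopf algebra *)

(** A spanning family of minimal length is free, since a relation would eliminate one of its
    members; c is the dual basis. *)
Lemma fin_dim_basis (k : fieldType) (V : lmodType k) : fin_dim V ->
  exists (n : nat) (e : 'I_n -> V) (c : 'I_n -> V -> k),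
    [/\ forall i, linear (c i : V -> k^o),
        forall v, v = \sum_(i < n) c i v *: e i &
        forall i j, c i (e j) = (i == j)%:R].
Proof.
pose P n := `[< exists e : 'I_n -> V, forall v,
    exists c : 'I_n -> k, v = \sum_(i < n) c i *: e i >].
move=> [m [e0 e0P]]; have exP : exists n, P n by exists m; apply/asboolP; exists e0.
case: (ex_minnP exP) => n /asboolP[e eP] nmin {m e0 e0P exP}.
have free (a : 'I_n -> k) : \sum_i a i *: e i = 0 -> forall i, a i = 0.
  case: n e eP nmin a => [|n] e eP nmin a a0 i; first by case: i.
  apply/eqP/negPn/negP => ai; have := nmin n; rewrite ltnn => contra.
  suff /contra : P n by [].
  apply/asboolP; exists (fun j => e (lift i j)) => v.
  have [c ->] := eP v.
  exists (fun j => c (lift i j) - c i * (a i)^-1 * a (lift i j)).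
  have ei : e i = - \sum_(j < n) ((a i)^-1 * a (lift i j)) *: e (lift i j).
    have := a0; rewrite (bigD1_ord i) //= => /(canRL (addrK _)) /(congr1 ( *:%R (a i)^-1)).
    rewrite scalerA mulVf // scale1r => ->; rewrite sub0r scalerN scaler_sumr.
    by congr (- _); apply: eq_bigr => j _; rewrite scalerA.
  rewrite (bigD1_ord i) //= ei scalerN scaler_sumr addrC -sumrB.
  by apply: eq_bigr => j _; rewrite scalerBl scalerA mulrA.
have /choice[c cE] := eP.
have inj (a b : 'I_n -> k) : \sum_i a i *: e i = \sum_i b i *: e i -> forall i, a i = b i.
  move=> /eqP; rewrite -subr_eq0 -sumrB => /eqP ab i.
  apply/eqP; rewrite -subr_eq0; apply/eqP; apply: (free (fun i => a i - b i)).
  by rewrite -[RHS]ab; apply: eq_bigr => j _; rewrite scalerBl.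
exists n, e, (fun i v => c v i); split=> //.
- move=> i a x y; apply: (inj (c (a *: x + y)) (fun i => a * c x i + c y i)).
  rewrite -cE [in LHS](cE x) [in LHS](cE y) scaler_sumr -big_split /=.
  by apply: eq_bigr => j _; rewrite scalerDl scalerA.
- move=> i j; apply: (inj (c (e j)) (fun i => (i == j)%:R)).
  rewrite -cE (bigD1 j) //= eqxx scale1r big1 ?addr0 // => l /negPf ->.
  by rewrite scale0r.
Qed.

Section Tensor.
Variable k : fieldType.
Implicit Types U V W X : lmodType k.

(** Identities in phi are proved by generalizing phi: both sides are linear in it, so pure tensors
    suffice. *)
Lemma tens3_ext U V W X (f g : tens U (tens V W) -> X) : linear f -> linear g ->
  (forall u v w, f (u \ox (v \ox w)) = g (u \ox (v \ox w))) -> f =1 g.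
Proof.
move=> fL gL fg; apply: tens_ext => // u.
have pL := bilin_r (@tpure_bilin k U (tens V W)) u.
by apply: tens_ext => //; apply: lin_comp.
Qed.

Definition tlift3 U V W X (F : U -> V -> W -> X) : tens U (tens V W) -> X :=
  tlift (fun u => tlift (F u)).

Section Tlift3.
Variables (U V W X : lmodType k) (F : U -> V -> W -> X).
Hypotheses (F1 : forall v w, linear (fun u => F u v w)) (F2 : forall u, bilin (F u)).

Lemma tlift3_bilin : bilin (fun u => tlift (F u)).
Proof. by apply: bilinI => x; [exact: tlift_linfun|exact: tlift_lin]. Qed.

Lemma tlift3_lin : linear (tlift3 F).
Proof. exact: tlift_lin tlift3_bilin. Qed.

Lemma tlift3_pure u v w : tlift3 F (u \ox (v \ox w)) = F u v w.
Proof. by rewrite /tlift3 tlift_pure ?tlift_pure //; exact: tlift3_bilin. Qed.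

End Tlift3.

End Tensor.

Section QuasiHopfRigid.
Variables (k : fieldType) (H : algType k) (Q : quasibialgebra H).
Variables (S : H -> H) (alpha beta : H).
Hypothesis SP : quasiantipode Q S alpha beta.

Section Dual.
Variables (V : lmodule H) (n : nat) (e : 'I_n -> V) (c : 'I_n -> V -> k).
Hypotheses (cL : forall i, linear (c i : V -> k^o))
  (cE : forall v, v = \sum_(i < n) c i v *: e i)
  (ce : forall i j, c i (e j) = (i == j)%:R).

(** A functional is stored as the tuple of its values on the basis e; [dpair] evaluates it. *)
Definition dualT : lmodType k := {ffun 'I_n -> k^o}.
Definition dpair (w : dualT) (v : V) : k^o := \sum_i w i * c i v.
Definition dbas (i : 'I_n) : dualT := [ffun j => (i == j)%:R].

Lemma dpair_bilin : bilin dpair.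
Proof.
apply: bilinI => x a y z; rewrite /dpair /= [in RHS]scaler_sumr -big_split /=.
  by apply: eq_bigr => i _; rewrite !ffunE /= mulrDl -scalerAl.
by apply: eq_bigr => i _; rewrite cL mulrDr scalerAr.
Qed.

Lemma dpair_bas i v : dpair (dbas i) v = c i v.
Proof.
rewrite /dpair (bigD1 i) //= ffunE eqxx mul1r big1 ?addr0 // => j /negPf ji.
by rewrite ffunE eq_sym ji mul0r.
Qed.

Lemma dpair_e w j : dpair w (e j) = w j.
Proof.
rewrite /dpair (bigD1 j) //= ce eqxx mulr1 big1 ?addr0 // => i /negPf ij.
by rewrite ce ij mulr0.
Qed.

Lemma dpair_ext w w' : (forall v, dpair w v = dpair w' v) -> w = w'.
Proof. by move=> ww; apply/ffunP => i; rewrite -!dpair_e. Qed.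

Definition dact (h : H) (w : dualT) : dualT := [ffun i => dpair w (lact (S h) (e i))].

Lemma dpair_act h w v : dpair (dact h w) v = dpair w (lact (S h) v).
Proof.
rewrite [in RHS](cE v) (lin_sum (bilin_r (@lact_bilin _ _ V) _)).
rewrite (lin_sum (bilin_r dpair_bilin w)); apply: eq_bigr => i _.
rewrite (linZ (bilin_r (@lact_bilin _ _ V) _)) (linZ (bilin_r dpair_bilin w)).
by rewrite ffunE mulrC.
Qed.

Lemma dact_bilin : bilin dact.
Proof.
have dB := dpair_bilin; have lB := @lact_bilin _ _ V.
apply: bilinI => x a y z; apply: dpair_ext => v.
  rewrite dpair_act (S_lin SP) (bilin_l lB) (bilin_r dB).
  by rewrite (bilin_l dB) !dpair_act.
by rewrite dpair_act !(bilin_l dB) !dpair_act.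
Qed.

Lemma dact1 w : dact 1 w = w.
Proof. by apply: dpair_ext => v; rewrite dpair_act (S_1 SP) lact1. Qed.

Lemma dactM g h w : dact (g * h) w = dact g (dact h w).
Proof. by apply: dpair_ext => v; rewrite !dpair_act (S_anti SP) lactM. Qed.

Definition dual_mod : lmodule H := LModule dact_bilin dact1 dactM.

Definition dual_ev (t : tens dualT V) : k^o :=
  tlift (fun w v => dpair w (lact alpha v)) t.

Lemma dual_ev_bilin : bilin (fun w v => dpair w (lact alpha v)).
Proof.
apply: (bilin_comp dpair_bilin) => //; exact: bilin_r (@lact_bilin _ _ V) _.
Qed.

Lemma dual_ev_lin : linear dual_ev.
Proof. exact: tlift_lin dual_ev_bilin. Qed.

Lemma dual_ev_pure w v : dual_ev (w \ox v) = dpair w (lact alpha v).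
Proof. exact: (tlift_pure _ _ dual_ev_bilin). Qed.

(** For s = Delta h, [S_alpha] turns the inner element into eps(h) alpha, so [dual_ev] is
    H-linear. *)
Lemma dual_ev_act2 s w v : dual_ev (tmap2 dact (@lact _ _ V) s (w \ox v)) =
  dpair w (lact (tlift (fun h1 h2 => S h1 * alpha * h2) s) v).
Proof.
have lB := @lact_bilin _ _ V.
have fB : bilin (fun h1 h2 => S h1 * alpha * h2).
  apply: (bilin_comp (@mul_bilin k H) (p := fun h => S h * alpha)) => //.
  by apply: (lin_comp (bilin_l (@mul_bilin k H) alpha)); exact: S_lin SP.
move: s; apply: tens_ext.
- apply: (lin_comp dual_ev_lin (g := fun s => _)).
  exact: (bilin_l (tmap2_bilin dact_bilin lB)).
- apply: (lin_comp (bilin_r dpair_bilin w)).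
  apply: (lin_comp (bilin_l lB v)); exact: tlift_lin.
move=> h1 h2; rewrite tmap2_pure //; last exact: dact_bilin.
by rewrite dual_ev_pure dpair_act tlift_pure // !lactM.
Qed.

Lemma dual_ev_act h (t : ltens Q dual_mod V) :
  dual_ev (lact h t) = lact h (dual_ev t : lunit Q).
Proof.
move: t; apply: tens_ext.
- apply: (lin_comp dual_ev_lin); exact: bilin_r (@lact_bilin _ _ (ltens Q dual_mod V)) h.
- by apply: lin_comp dual_ev_lin; exact: (bilin_r (@lact_bilin _ _ (lunit Q)) h).
move=> w v; rewrite [LHS]dual_ev_act2 (S_alpha SP) /= dual_ev_pure.
by rewrite (linZ (bilin_l (@lact_bilin _ _ V) v)) (linZ (bilin_r dpair_bilin w)).
Qed.

Definition dual_db (a : k^o) : tens V dualT :=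
  (a : k) *: (\sum_i lact beta (e i) \ox dbas i : tens V dualT).

Lemma dual_db_lin : linear dual_db.
Proof. by move=> a x y; rewrite /dual_db scalerDl scalerA. Qed.

Lemma dual_sum w : w = \sum_i w i *: dbas i :> dualT.
Proof.
apply/ffunP => j; rewrite sum_ffunE (bigD1 j) //= !ffunE eqxx.
rewrite big1 ?addr0 => [|i /negPf ij]; first exact: (esym (mulr1 _)).
by rewrite !ffunE ij; exact: mulr0.
Qed.

(** In the canonical element of V (x) [dualT], h crosses from the dual factor to V as S h. *)
Lemma dual_swap (X : lmodType k) (f : V -> X) h : linear f ->
  \sum_i f (e i) \ox dact h (dbas i) =
  \sum_i f (lact (S h) (e i)) \ox dbas i :> tens X dualT.
Proof.
move=> fL; have pB := @tpure_bilin k X dualT.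
under eq_bigr => i _.
  rewrite (dual_sum (dact h (dbas i))) (lin_sum (bilin_r pB _)).
  under eq_bigr => j _ do rewrite (linZ (bilin_r pB _)) ffunE dpair_bas.
  over.
rewrite exchange_big; apply: eq_bigr => j _ /=.
rewrite [in RHS](cE (lact (S h) (e j))) (lin_sum fL) (lin_sum (bilin_l pB _)).
by apply: eq_bigr => i _; rewrite (linZ fL) (linZ (bilin_l pB _)).
Qed.

Lemma dual_db_act h a :
  dual_db (lact h (a : lunit Q)) = lact h (dual_db a : ltens Q V dual_mod).
Proof.
have lB := @lact_bilin _ _ V; have dB := dact_bilin.
have B := tmap2_bilin lB dB; have pB := @tpure_bilin k V dualT.
rewrite /dual_db /= /ltens_act (linZ (bilin_r B _)) (lin_sum (bilin_r B _)).
rewrite -scalerA scalerA mulrC -scalerA; congr (_ *: _).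
have fB : bilin (fun h1 h2 => h1 * beta * S h2).
  apply: (bilin_comp (@mul_bilin k H) (p := fun h => h * beta)).
    exact: (bilin_l (@mul_bilin k H) beta).
  exact: S_lin SP.
transitivity (\sum_i lact (tlift (fun h1 h2 => h1 * beta * S h2) (Delta Q h)) (e i)
    \ox dbas i : tens V dualT).
  rewrite (S_beta SP) scaler_sumr; apply: eq_bigr => i _.
  by rewrite (linZ (bilin_l lB _)) (linZ (bilin_l pB _)).
move: (Delta Q h); apply: tens_ext => [a' x y|a' x y|h1 h2].
- rewrite scaler_sumr -big_split; apply: eq_bigr => i _ /=.
  by rewrite (tlift_lin fB) (bilin_l lB) (bilin_l pB).
- rewrite scaler_sumr -big_split; apply: eq_bigr => i _ /=.
  by rewrite (bilin_l B).
under [RHS]eq_bigr => i _ do rewrite tmap2_pure //.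
rewrite (@dual_swap V (fun v => lact h1 (lact beta v))); last first.
  by apply: (lin_comp (bilin_r lB _)); exact: bilin_r lB _.
by apply: eq_bigr => i _; rewrite tlift_pure // !lactM.
Qed.

(** With x (x) y (x) z in place of phi, the composite sends v to x beta S(y) alpha z v; [S_phi]
    concludes. *)
Lemma dual_l_eq v : tscaler (tmap id dual_ev
    (@lassoc _ _ Q V dual_mod V (tmap dual_db id ((1 : k^o) \ox v)))) = v.
Proof.
have lB := @lact_bilin _ _ V; have dB := dact_bilin; have eL := dual_ev_lin.
have B := tmap2_bilin lB (tmap2_bilin dB lB).
have pB := @tpure_bilin k (tens V dualT) V.
rewrite tmap_pure //; last exact: dual_db_lin.
rewrite /lassoc; set t := tassoc _.
pose F x y z := x * beta * S y * alpha * z.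
have F1 y z : linear (fun x => F x y z).
  by move=> a u u'; rewrite /F !(mulrDl, scalerAl).
have F2 x : bilin (F x).
  apply: bilinI => [z|y] a u u'; rewrite /F.
    by rewrite (S_lin SP) !(mulrDl, mulrDr) -!(scalerAl, scalerAr).
  by rewrite mulrDr -scalerAr.
rewrite -[RHS](@lact1 _ _ V) -(S_phi SP) -[tlift _ _]/(tlift3 F (phi Q)).
have tE : t = \sum_i lact beta (e i) \ox (dbas i \ox v).
  rewrite /t /dual_db scale1r (lin_sum (bilin_l pB v)) (lin_sum (@tassoc_lin _ _ _ _)).
  by apply: eq_bigr => i _; rewrite tassoc_pure.
move: (phi Q); apply: tens3_ext.
- apply: (lin_comp (@tscaler_lin _ _)); apply: lin_comp; first exact: tmap_lin.
  exact: (bilin_l B).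
- apply: (lin_comp (bilin_l lB v)); exact: tlift3_lin.
move=> x y z; rewrite tlift3_pure // tE (lin_sum (bilin_r B _)).
rewrite (lin_sum (tmap_lin (@lin_id _ _) eL)) (lin_sum (@tscaler_lin _ _)).
rewrite /F !lactM [in RHS](cE (lact (S y) _)) !(lin_sum (bilin_r lB _)).
apply: eq_bigr => i _; rewrite tmap2_pure //; last exact: tmap2_bilin.
rewrite tmap2_pure // tmap_pure // tscaler_pure !(linZ (bilin_r lB _)).
by rewrite dual_ev_pure dpair_act dpair_bas.
Qed.

(** With x (x) y (x) z in place of phi^-1, the result evaluated at v is w(S(x) alpha y beta S(z) v);
    [S_phiV] concludes. *)
Lemma dual_r_eq w : tscalel (tmap dual_ev id
    (@lassocV _ _ Q dual_mod V dual_mod (tmap id dual_db (w \ox (1 : k^o))))) = w.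
Proof.
have lB := @lact_bilin _ _ V; have dB := dact_bilin; have eL := dual_ev_lin.
have B := tmap2_bilin dB (tmap2_bilin lB dB).
have pB := @tpure_bilin k dualT (tens V dualT).
have ddL := bilin_r dpair_bilin.
rewrite tmap_pure //; last exact: dual_db_lin.
rewrite /lassocV; set t := w \ox _.
pose F x y z := S x * alpha * y * beta * S z.
have F1 y z : linear (fun x => F x y z).
  by move=> a u u'; rewrite /F (S_lin SP) !(mulrDl, scalerAl).
have F2 x : bilin (F x).
  apply: bilinI => [z|y] a u u'; rewrite /F.
    by rewrite !(mulrDl, mulrDr) -!(scalerAl, scalerAr).
  by rewrite (S_lin SP) mulrDr -scalerAr.
have tE : t = \sum_i w \ox (lact beta (e i) \ox dbas i).
  by rewrite /t /dual_db scale1r (lin_sum (bilin_r pB w)).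
apply: dpair_ext => v.
rewrite -[in RHS](@lact1 _ _ V v) -(S_phiV SP) -[tlift _ (phiV Q)]/(tlift3 F (phiV Q)).
have tL : linear (tmap dual_ev (@id dualT)) by exact: tmap_lin.
move: (phiV Q); apply: tens3_ext.
- apply: (lin_comp (bilin_l dpair_bilin v)); apply: (lin_comp (@tscalel_lin _ _)).
  apply: (lin_comp tL); apply: (lin_comp (@tassocV_lin _ _ _ _)).
  exact: (bilin_l B).
- apply: (lin_comp (ddL w)); apply: (lin_comp (bilin_l lB v)); exact: tlift3_lin.
move=> x y z; rewrite tlift3_pure // tE (lin_sum (bilin_r B _)).
rewrite (lin_sum (@tassocV_lin _ _ _ _)) (lin_sum tL) (lin_sum (@tscalel_lin _ _)).
rewrite (lin_sum (bilin_l dpair_bilin v)).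
rewrite /F !lactM [in RHS](cE (lact (S z) _)) !(lin_sum (bilin_r lB _)) (lin_sum (ddL w)).
apply: eq_bigr => i _; rewrite tmap2_pure //; last exact: tmap2_bilin.
rewrite tmap2_pure // tassocV_pure tmap_pure // tscalel_pure !(linZ (bilin_r lB _)).
rewrite (linZ (ddL w)) dual_ev_pure dpair_act (linZ (bilin_l dpair_bilin v)).
by rewrite dpair_act dpair_bas -[LHS]/(_ * _) mulrC.
Qed.

End Dual.

Lemma quasi_hopf_rigid : rigid (fin_lmodule_moncat Q).
Proof.
move=> [V Vf].
have [n [e [c [cL cE ce]]]] := fin_dim_basis Vf.
have Df : fin_dim (dual_mod cL cE ce).
  by exists n, (dbas (n := n)) => w; exists (fun i => w i); exact: dual_sum.
constructor.
apply: (@Dual (fin_lmodule_moncat Q) (exist _ V Vf) (exist _ (dual_mod cL cE ce) Df)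
  (@LModuleHom _ _ (ltens Q (dual_mod cL cE ce) V) (lunit Q) _ (dual_ev_lin cL)
     (@dual_ev_act V n e c cL cE ce))
  (@LModuleHom _ _ (lunit Q) (ltens Q V (dual_mod cL cE ce)) _ (@dual_db_lin V n e)
     (@dual_db_act V n e c cL cE ce))).
- apply: lmodule_hom_eq => v; exact: (@dual_l_eq V n e c cL cE ce).
- apply: lmodule_hom_eq => w; exact: (@dual_r_eq V n e c cL cE ce).
Qed.

End QuasiHopfRigid.

(** * Coinvariants and the unit of the adjunction *)

Section Coinvariants.
Local Open Scope quotient_scope.
Variables (k : fieldType) (H : algType k) (Q : quasibialgebra H) (M : bimodule H).
Local Notation ep := (eps Q).
Implicit Type W : lmodType k.

Definition eps_invariant W (f : M -> W) :=
  linear f /\ forall h m, f (ract h m) = ep h *: f m.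

(** M / MH^+, with H^+ the kernel of eps, is built from its universal property: elements are
    identified when no linear map killing MH^+ separates them. *)
Definition coinv_eqv : rel M := fun x y =>
  `[< forall W (f : M -> W), eps_invariant f -> f x = f y >].

Lemma coinv_is_equiv : equiv_class_of coinv_eqv.
Proof.
split=> [x|x y|y x z].
- exact/asboolP.
- by apply/asboolP/asboolP => xy W f fI; rewrite xy.
- by move=> /asboolP xy /asboolP yz; apply/asboolP => W f fI; rewrite xy // yz.
Qed.

Canonical coinv_equiv := EquivRelPack coinv_is_equiv.

Definition coinv : Type := {eq_quot coinv_eqv}.
HB.instance Definition _ := Choice.on coinv.

Definition cpi (m : M) : coinv := \pi_({eq_quot coinv_eqv}) m.
Definition crepr (x : coinv) : M := repr (x : {eq_quot coinv_eqv}).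
Definition clift W (f : M -> W) (x : coinv) : W := f (crepr x).

Lemma creprK x : cpi (crepr x) = x.
Proof. exact: reprK. Qed.

Lemma clift_pi W (f : M -> W) m : eps_invariant f -> clift f (cpi m) = f m.
Proof.
move=> fI; have /eqP := creprK (cpi m).
by rewrite /cpi eqmodE => /asboolP; apply.
Qed.

Lemma coinv_eq x y :
  (forall W (f : M -> W), eps_invariant f -> clift f x = clift f y) -> x = y.
Proof.
move=> xy; rewrite -(creprK x) -(creprK y); apply/eqP.
by rewrite /cpi eqmodE; apply/asboolP => W f fI; exact: xy.
Qed.

Definition cadd x y := cpi (crepr x + crepr y).
Definition cscale (a : k) x := cpi (a *: crepr x).

Lemma clift_add W (f : M -> W) x y : eps_invariant f ->
  clift f (cadd x y) = clift f x + clift f y.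
Proof. by move=> fI; rewrite clift_pi // (linD fI.1). Qed.

Lemma clift_scale W (f : M -> W) a x : eps_invariant f ->
  clift f (cscale a x) = a *: clift f x.
Proof. by move=> fI; rewrite clift_pi // (linZ fI.1). Qed.

Lemma clift_zero W (f : M -> W) : eps_invariant f -> clift f (cpi 0) = 0.
Proof. by move=> fI; rewrite clift_pi // (lin0 fI.1). Qed.

Fact caddA : associative cadd.
Proof. by move=> r s t; apply: coinv_eq => W f fI; rewrite !clift_add ?addrA. Qed.

Fact caddC : commutative cadd.
Proof. by move=> s t; apply: coinv_eq => W f fI; rewrite !clift_add // addrC. Qed.

Fact cadd0 : left_id (cpi 0) cadd.
Proof. by move=> t; apply: coinv_eq => W f fI; rewrite clift_add // clift_zero // add0r. Qed.

Fact caddN : left_inverse (cpi 0) (cscale (-1)) cadd.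
Proof.
move=> t; apply: coinv_eq => W f fI.
by rewrite clift_add // clift_zero // clift_scale // scaleN1r addNr.
Qed.

HB.instance Definition _ := GRing.isZmodule.Build coinv caddA caddC cadd0 caddN.

Fact cscaleA a b t : cscale a (cscale b t) = cscale (a * b) t.
Proof. by apply: coinv_eq => W f fI; rewrite !clift_scale // scalerA. Qed.

Fact cscale1 : left_id 1 cscale.
Proof. by move=> t; apply: coinv_eq => W f fI; rewrite clift_scale // scale1r. Qed.

Fact cscaleDr : right_distributive cscale +%R.
Proof.
move=> a s t; apply: coinv_eq => W f fI.
by rewrite clift_scale // !clift_add // !clift_scale // scalerDr.
Qed.

Fact cscaleDl t : {morph cscale^~ t : a b / a + b}.
Proof.
move=> a b; apply: coinv_eq => W f fI.
by rewrite clift_add // !clift_scale // scalerDl.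
Qed.

HB.instance Definition _ :=
  GRing.Zmodule_isLmodule.Build k coinv cscaleA cscale1 cscaleDr cscaleDl.

Lemma clift_lin W (f : M -> W) : eps_invariant f -> linear (clift f).
Proof. by move=> fI; apply: linI => [s t|a t]; [exact: clift_add|exact: clift_scale]. Qed.

Lemma cpi_lin : linear cpi.
Proof.
move=> a x y; apply: coinv_eq => W f fI.
by rewrite clift_lin // !clift_pi // fI.1.
Qed.

Lemma cpi_ract h m : cpi (ract h m) = ep h *: cpi m.
Proof.
apply: coinv_eq => W f fI.
by rewrite (linZ (clift_lin fI)) !clift_pi // fI.2.
Qed.

Definition cact (h : H) (x : coinv) : coinv := cpi (lact h (crepr x)).

Lemma clift_act_inv W (f : M -> W) h : eps_invariant f ->
  eps_invariant (fun m => f (lact h m)).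
Proof.
move=> fI; split; first exact: (lin_comp fI.1 (bilin_r (@lact_bilin _ _ M) h)).
by move=> g m; rewrite lractC fI.2.
Qed.

Lemma clift_act W (f : M -> W) h x : eps_invariant f ->
  clift f (cact h x) = clift (fun m => f (lact h m)) x.
Proof. by move=> fI; rewrite clift_pi. Qed.

Lemma cpi_lact h m : cpi (lact h m) = cact h (cpi m).
Proof.
apply: coinv_eq => W f fI; rewrite clift_act // !clift_pi //.
exact: clift_act_inv.
Qed.

Fact cact_bilin : bilin cact.
Proof.
apply: bilinI => [x|h] a y z; last first.
  rewrite -(creprK y) -(creprK z) -cpi_lin -!cpi_lact.
  by rewrite (bilin_r (@lact_bilin _ _ M)) cpi_lin.
by rewrite -(creprK x) -!cpi_lact (bilin_l (@lact_bilin _ _ M)) cpi_lin.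
Qed.

Fact cact_1 x : cact 1 x = x.
Proof. by rewrite -(creprK x) -cpi_lact lact1. Qed.

Fact cact_M g h x : cact (g * h) x = cact g (cact h x).
Proof. by rewrite -(creprK x) -!cpi_lact lactM. Qed.

Definition coinv_mod : lmodule H := LModule cact_bilin cact_1 cact_M.

Definition coinv_pi : bimodule_hom M (triv Q coinv_mod) :=
  @BiModuleHom k H M (triv Q coinv_mod)
    (@LModuleHom k H M coinv_mod cpi cpi_lin cpi_lact) cpi_ract.

End Coinvariants.

Section ComoduleElements.
Variables (k : fieldType) (H : algType k) (Q : quasibialgebra H).
Variable M : comodule (regular_coalgebra Q).
Local Notation bM := (comod M : bimodule H).

Definition rho (m : bM) : tens bM H := coact M m.

Lemma rho_lin : linear rho.
Proof. exact: (lhom_lin (coact M)). Qed.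

Lemma rho_ract h m : rho (ract h m) =
  tmap2 (@ract _ _ bM) (fun h v : H => v * h) (Delta Q h) (rho m).
Proof. exact: (bhom_ract (coact M)). Qed.

Lemma rho_counit m : tscaler (tmap id (eps Q : H -> k^o) (rho m)) = m.
Proof. exact: (congr1 (fun f : bimodule_hom _ _ => f m) (coact_counit M)). Qed.

Local Notation lact3 := (op3 (@lact _ _ bM) ( *%R : H -> H -> H) ( *%R : H -> H -> H)).
Local Notation ract3 := (op3 (@ract _ _ bM) (fun h v : H => v * h) (fun h v : H => v * h)).

(** Coassociativity, multiplied on the right by phi to clear phi^-1. *)
Lemma rhoA m : lact3 (phi Q) (tassoc (tmap rho id (rho m))) =
  ract3 (phi Q) (tmap id (Delta Q) (rho m)).
Proof.
have : bassoc Q (tmap rho id (rho m) : tens (tens bM (regular H)) (regular H)) =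
    tmap id (Delta Q) (rho m).
  exact: (congr1 (fun f : bimodule_hom _ _ => f m) (coactA M)).
move=> <-; rewrite /bassoc -[tmap2 _ _ (phiV Q) _]/(ract3 _ _) -[RHS]/(ract3 _ _).
by rewrite -(@ract3_M _ _ bM (regular H) (regular H)) phiVphi ract3_1.
Qed.

End ComoduleElements.

(** * Reconstruction of Hopf modules from a dual of the regular module *)

Section Reconstruction.
Variables (k : fieldType) (H : algType k) (Q : quasibialgebra H).
Local Notation De := (Delta Q).
Local Notation ep := (eps Q : H -> k^o).
Local Notation mul := ( *%R : H -> H -> H).
Local Notation rmul := (fun h v : H => v * h).
Variables (A : lmodule H) (ev : tens A H -> k^o) (d : tens H A).
Hypotheses (evL : linear ev)
  (ev_act : forall h t, ev (tmap2 (@lact _ _ A) mul (De h) t) = ep h * ev t)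
  (d_act : forall h, tmap2 mul (@lact _ _ A) (De h) d = eps Q h *: d)
  (d_dual : tscaler (tmap id ev
     (op3 mul (@lact _ _ A) mul (phi Q) (tassoc (d \ox 1)))) = 1).

Let mB := @mul_bilin k H.
Let rB : bilin rmul := bilin_flip mB.
Let aB := @lact_bilin k H A.
Let evB := tmap2_bilin aB mB.

Lemma ev_form_lin t : linear (fun s => ev (tmap2 (@lact _ _ A) mul s t)).
Proof. by apply: (lin_comp evL); exact: (bilin_l evB). Qed.

Section Bimodule.
Variable M : bimodule H.
Let lB := @lact_bilin k H M.
Let rcB := @ract_bilin k H M.
Local Notation lact3 := (op3 (@lact _ _ M) mul mul).
Local Notation ract3 := (op3 (@ract _ _ M) rmul rmul).

Definition contract_at (x : tens M (tens H H)) (b : H) (a : A) : M :=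
  tscaler (tmap (ract b) (fun s => ev (tmap2 (@lact _ _ A) mul s (a \ox 1))) x).

Definition contract (t : tens H A) (x : tens M (tens H H)) : M :=
  tlift (contract_at x) t.

Lemma contract_at_lin b a : linear (fun x => contract_at x b a).
Proof.
apply: (lin_comp (@tscaler_lin _ _)); apply: tmap_lin; first exact: bilin_r.
exact: ev_form_lin.
Qed.

Lemma contract_at_pure m s b a : contract_at (m \ox s) b a =
  (ev (tmap2 (@lact _ _ A) mul s (a \ox 1)) : k) *: ract b m.
Proof.
rewrite /contract_at tmap_pure ?tscaler_pure //; first exact: bilin_r.
exact: ev_form_lin.
Qed.

Lemma contract_at_bilin x : bilin (contract_at x).
Proof.
have pB := @tpure_bilin k A H.
apply: bilinI => y a u v; move: x; apply: tens_ext => [||m s].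
1,4: exact: contract_at_lin.
1,3: move=> c x x'; rewrite !contract_at_lin !scalerDr !scalerA mulrC !addrA.
1,2: by congr (_ + _); rewrite -!addrA; congr (_ + _); rewrite addrC.
- by rewrite !contract_at_pure (bilin_l rcB) scalerDr !scalerA mulrC.
- rewrite !contract_at_pure (bilin_l pB) (bilin_r evB) evL.
  by rewrite scalerDl scalerA.
Qed.

Lemma contract_bilin : bilin contract.
Proof.
apply: bilinI => [x|t]; first exact: tlift_lin (contract_at_bilin x).
by apply: tlift_linfun => b a; exact: contract_at_lin.
Qed.

Lemma contract_pure b a x : contract (b \ox a) x = contract_at x b a.
Proof. exact: (tlift_pure _ _ (contract_at_bilin x)). Qed.

(** By linearity of ev, Delta g leaves the factor eps(g); the rest is the triangle composite, which
    [d_dual] makes 1 for t = d and s = phi. *)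
Lemma contract_ract3 m g s t :
  contract t (ract3 s (m \ox De g)) = eps Q g *:
    ract (tscaler (tmap id ev (op3 mul (@lact _ _ A) mul s (tassoc (t \ox 1))))) m.
Proof.
have cB := contract_bilin; have r2B := tmap2_bilin rB rB.
have r3B := tmap2_bilin rcB r2B; have l3B := tmap2_bilin mB evB.
have pB := @tpure_bilin k (tens H A) H.
have eL := tmap_lin (@lin_id k H) evL.
have rmL : linear (fun y => eps Q g *: ract (tscaler (tmap id ev y)) m).
  apply: lin_scale; apply: (lin_comp (bilin_l rcB m)).
  exact: (lin_comp (@tscaler_lin _ _)).
move: s; apply: tens_ext => [||x s].
- by apply: (lin_comp (bilin_r cB t)); exact: (bilin_l r3B).
- by apply: (lin_comp rmL); exact: (bilin_l l3B).
move: t; apply: tens_ext => [||b a].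
- exact: (bilin_l cB).
- apply: (lin_comp rmL); apply: (lin_comp (bilin_r l3B _)).
  by apply: (lin_comp (@tassoc_lin _ _ _ _)); exact: (bilin_l pB).
rewrite contract_pure /op3 tmap2_pure // contract_at_pure.
rewrite tassoc_pure tmap2_pure // tmap_pure // tscaler_pure.
have -> : tmap2 rmul rmul s (De g) = tmul2 (De g) s by rewrite -(tmap2_flip mB mB).
rewrite (act2M mB mB aB mB (@lactM _ _ A) (fun a b c => esym (mulrA a b c))).
by rewrite ev_act (linZ (bilin_l rcB m)) scalerA ractM.
Qed.

(** Associativity moves both right factors onto u; for t = Delta j and u = d, [d_act] turns them
    into eps(j). *)
Lemma contract_ractl t s r h u :
  contract u (lact3 s (tassoc (tmap2 (@ract _ _ M) rmul t r \ox h))) =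
  contract (tmap2 mul (@lact _ _ A) t u) (lact3 s (tassoc (r \ox h))).
Proof.
have cB := contract_bilin; have rrB := tmap2_bilin rcB rB.
have l2B := tmap2_bilin mB mB; have l3B := tmap2_bilin lB l2B.
have pB := @tpure_bilin k (tens M H) H; have mlB := tmap2_bilin mB aB.
have asL := @tassoc_lin k M H H.
have L1 u' s' : linear (fun y => contract u' (lact3 s' (tassoc (y \ox h)))).
  apply: (lin_comp (bilin_r cB u')); apply: (lin_comp (bilin_r l3B _)).
  by apply: (lin_comp asL); exact: (bilin_l pB).
move: u; apply: tens_ext => [||b a].
- exact: (bilin_l cB).
- by apply: (lin_comp (bilin_l cB _)); exact: (bilin_r mlB).
move: t; apply: tens_ext => [||j1 j2].
- by apply: (lin_comp (L1 _ _)); exact: (bilin_l rrB).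
- by apply: (lin_comp (bilin_l cB _)); exact: (bilin_l mlB).
move: r; apply: tens_ext => [||m g].
- by apply: (lin_comp (L1 _ _)); exact: (bilin_r rrB).
- exact: L1.
move: s; apply: tens3_ext => [||x y z].
- by apply: (lin_comp (bilin_r cB _)); exact: (bilin_l l3B).
- by apply: (lin_comp (bilin_r cB _)); exact: (bilin_l l3B).
rewrite !tmap2_pure // !tassoc_pure /op3 !tmap2_pure //.
rewrite !contract_pure !contract_at_pure !tmap2_pure // ractM lractC.
by rewrite -lactM mulrA.
Qed.

End Bimodule.

Lemma contract_nat (M N : bimodule H) (f : bimodule_hom M N) t x :
  f (contract t x) = contract t (tmap f id x).
Proof.
have fL := lhom_lin f; have iL := @lin_id k (tens H H).
move: t; apply: tens_ext => [||b a].
- by apply: (lin_comp fL); exact: (bilin_l (@contract_bilin M)).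
- exact: (bilin_l (@contract_bilin N)).
rewrite !contract_pure; move: x; apply: tens_ext => [||m s].
- by apply: (lin_comp fL); exact: contract_at_lin.
- by apply: (lin_comp (@contract_at_lin N _ _)); exact: tmap_lin.
by rewrite tmap_pure // !contract_at_pure (linZ fL) bhom_ract.
Qed.

Section HopfModule.
Variable M : comodule (regular_coalgebra Q).
Local Notation bM := (comod M : bimodule H).
Let lB := @lact_bilin k H bM.
Let rcB := @ract_bilin k H bM.
Local Notation lact3 := (op3 (@lact _ _ bM) mul mul).
Local Notation ract3 := (op3 (@ract _ _ bM) rmul rmul).

Let l3B : bilin lact3.
Proof. by apply: tmap2_bilin => //; exact: tmap2_bilin. Qed.

Definition recon (m : bM) (h : H) : bM :=
  contract d (lact3 (phi Q) (tassoc (rho m \ox h))).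

Lemma recon_bilin : bilin recon.
Proof.
apply: (bilin_post (p := fun y => contract d (lact3 (phi Q) (tassoc y)))).
  by apply: bilin_comp; [exact: tpure_bilin|exact: rho_lin|exact: lin_id].
apply: (lin_comp (bilin_r (@contract_bilin bM) d)).
by apply: (lin_comp (bilin_r l3B _)); exact: tassoc_lin.
Qed.

Lemma recon_ract j m h : recon (ract j m) h = eps Q j *: recon m h.
Proof.
rewrite /recon rho_ract contract_ractl d_act.
exact: (linZ (bilin_l (@contract_bilin bM) _)).
Qed.

(** [rhoA] trades phi on the left for phi on the right of (id (x) Delta) rho(m), where
    [contract_ract3] leaves (id (x) eps) rho(m) = m. *)
Lemma recon_rho m : tlift recon (rho m) = m.
Proof.
have cL := bilin_r (@contract_bilin bM) d.
have rL := @rho_lin _ _ _ M; have iL := @lin_id k H.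
transitivity (contract d (lact3 (phi Q) (tassoc (tmap (@rho _ _ _ M) id (rho m))))).
  move: (rho m); apply: tens_ext => [||u v]; first exact: tlift_lin recon_bilin.
    apply: (lin_comp cL); apply: (lin_comp (bilin_r l3B _)).
    by apply: (lin_comp (@tassoc_lin _ _ _ _)); exact: tmap_lin.
  by rewrite tmap_pure // (tlift_pure _ _ recon_bilin).
rewrite rhoA -[RHS]rho_counit.
have r3B : bilin ract3 by apply: tmap2_bilin => //; exact: tmap2_bilin.
have dL := Delta_lin Q; have eL := eps_lin Q.
move: (rho m); apply: tens_ext => [||u g].
- by apply: (lin_comp cL); apply: (lin_comp (bilin_r r3B _)); exact: tmap_lin.
- by apply: (lin_comp (@tscaler_lin _ _)); exact: tmap_lin.
by rewrite tmap_pure // contract_ract3 d_dual ract1 tmap_pure // tscaler_pure.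
Qed.

End HopfModule.

Lemma recon_nat (M N : comodule (regular_coalgebra Q)) (f : comodule_hom M N) m h :
  (comod_hom f : bimodule_hom _ _) (recon m h) =
  recon ((comod_hom f : bimodule_hom _ _) m) h.
Proof.
rewrite /recon (@contract_nat (comod M) (comod N) (comod_hom f)); congr contract.
set F := comod_hom f : bimodule_hom (comod M) (comod N).
have fL : linear F by exact: lhom_lin.
have -> : rho (F m) = tmap F id (rho m).
  exact: (congr1 (fun g : bimodule_hom _ _ => g m) (comod_homP f)).
have iL := @lin_id k H.
rewrite -[RHS]/(op3 _ _ _ _ _).
have -> : tmap F id (rho m) \ox h = tmap (tmap F id) id (rho m \ox h).
  by rewrite tmap_pure //; exact: tmap_lin.
rewrite tassoc_tmap //; transitivity (tmap F (tmap id id)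
    (op3 (@lact _ _ (comod M)) mul mul (phi Q) (tassoc (rho m \ox h)))).
  by apply: eq_tmap => // x; rewrite tmap_id.
by apply: op3_nat => //; (exact: lact_bilin || exact: lhom_act).
Qed.

End Reconstruction.

Section ComoduleIsom.
Variables (C : moncat) (K : coalgebra C) (M N : comodule K).

Lemma comodule_isom (f : comodule_hom M N) (i : isom (comod M) (comod N)) :
  comod_hom f = fwd i -> inhabited (isom (C := comodule_cat K) M N).
Proof.
move=> fi.
have gP : coact M \oc bwd i = (bwd i \tm idc K) \oc coact N.
  have := comod_homP f; rewrite fi => iP.
  rewrite -[coact M]comp1f -mmap_id -[in LHS](fwdK i) mmap_compl.
  by rewrite -[_ \oc coact M]compA -iP -!compA bwdK compf1.
constructor; apply: (@Isom (comodule_cat K) M N f (ComoduleHom gP)).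
  by apply: comodule_hom_eq; rewrite /= fi fwdK.
by apply: comodule_hom_eq; rewrite /= fi bwdK.
Qed.

End ComoduleIsom.

(** * Full faithfulness of [R_functor] and bijectivity of M -> R(M / MH^+) *)

Section Functor_R.
Variables (k : fieldType) (H : algType k) (Q : quasibialgebra H).
Local Notation ep := (eps Q : H -> k^o).

Lemma hopf_module_isom (M N : comodule (regular_coalgebra Q)) (f : comodule_hom M N) :
  let F : comod M -> comod N := fun m => (comod_hom f : bimodule_hom _ _) m in
  injective F -> (forall n, exists m, F m = n) ->
  inhabited (isom (C := hopf_module_cat Q) M N).
Proof.
move=> F Finj /choice[G GK].
have FK : cancel F G by move=> m; apply: Finj; rewrite GK.
pose i := @bimodule_isom k H (comod M) (comod N) F G (lhom_lin _) (lhom_act _)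
  (bhom_ract _) FK GK.
apply: (@comodule_isom _ _ _ _ f i).
by apply: bimodule_hom_eq.
Qed.

Definition cofree_pr (P : lmodType k) (z : tens P H) : P := tscaler (tmap id ep z).

Lemma cofree_pr_lin P : linear (@cofree_pr P).
Proof.
apply: (lin_comp (@tscaler_lin _ _)).
by apply: tmap_lin => //; exact: eps_lin.
Qed.

Lemma cofree_pr_pure (P : lmodType k) (p : P) h : cofree_pr (p \ox h) = eps Q h *: p.
Proof. by rewrite /cofree_pr tmap_pure ?tscaler_pure //; exact: eps_lin. Qed.

Lemma cofree_pr_ract (P : bimodule H) h (z : btens Q P (regular H)) :
  cofree_pr (ract h z) = ract h (cofree_pr z).
Proof.
exact: (bhom_ract (bimodule_comp (fwd (bunitr_isom Q P))
  (btmap Q (bimodule_id P) (regular_counit Q)))).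
Qed.

Lemma cofree_pr_lact (P : bimodule H) h (z : btens Q P (regular H)) :
  cofree_pr (lact h z) = lact h (cofree_pr z).
Proof.
exact: (lhom_act (bimodule_comp (fwd (bunitr_isom Q P))
  (btmap Q (bimodule_id P) (regular_counit Q)))).
Qed.

Lemma cofree_hom_prE (N : comodule (regular_coalgebra Q)) (P : bimodule H)
    (u : comodule_hom N (cofree (regular_coalgebra Q) P)) (n : comod N) :
  (comod_hom u : bimodule_hom _ _) n =
  tmap (fun n => cofree_pr ((comod_hom u : bimodule_hom _ _) n)) id (rho n).
Proof. exact: (congr1 (fun f : bimodule_hom _ _ => f n) (cofree_hom_pr u)). Qed.

Lemma cofree_rho_pr (P : bimodule H) (z : btens Q P (regular H)) :
  tmap (@cofree_pr P) id (@rho _ _ _ (cofree (regular_coalgebra Q) P) z) = z.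
Proof.
exact: (congr1 (fun f : bimodule_hom _ _ => f z)
  (@cofree_coact_pr _ (regular_coalgebra Q) P)).
Qed.

Lemma R_ract (V : lmodule H) (v : V) g h :
  ract h (v \ox g : btens Q (triv Q V) (regular H)) = v \ox (g * h).
Proof.
rewrite -[in RHS](eps_Delta Q h) /= /btens_ract.
have rB := bilin_flip (@mul_bilin k H); have tB := @ract_bilin _ _ (triv Q V).
have eL := eps_lin Q; have pB := @tpure_bilin k V H.
move: (Delta Q h); apply: tens_ext => [||h1 h2].
- exact: (bilin_l (tmap2_bilin tB rB)).
- apply: (lin_comp (bilin_r pB v)); apply: (lin_comp (bilin_r (@mul_bilin k H) g)).
  by apply: (lin_comp (@tscalel_lin _ _)); exact: tmap_lin.
rewrite tmap2_pure // tmap_pure // tscalel_pure -scalerAr (linZ (bilin_r pB _)).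
exact: (linZ (bilin_l pB _)).
Qed.

Lemma R_faithful (U V : lmodule H) (f g : lmodule_hom U V) :
  fmap (R_functor Q) (f : Hom (c := lmodule_moncat Q) U V) = fmap (R_functor Q) g -> f = g.
Proof.
move=> fg; apply: lmodule_hom_eq => u.
have : tmap f id (u \ox (1 : H)) = tmap g id (u \ox (1 : H)).
  exact: (congr1 (fun F : comodule_hom (R_functor Q U) (R_functor Q V) =>
    (comod_hom F : bimodule_hom (btens Q (triv Q U) (regular H))
       (btens Q (triv Q V) (regular H))) (u \ox 1)) fg).
rewrite !tmap_pure; try exact: lhom_lin; try exact: lin_id.
move=> /(congr1 (@cofree_pr V)); rewrite !cofree_pr_pure.
by rewrite (eps_mon Q).1 !scale1r.
Qed.

(** The candidate is f(v) = (id (x) eps) u(v (x) 1). Since U (x) 1 generates U (x) H on the right,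
    (id (x) eps) u = f (id (x) eps), and uniqueness for cofree comodules gives u = R(f). *)
Lemma R_full (U V : lmodule H)
    (u : Hom (R_functor Q U) (R_functor Q V)) :
  exists f : lmodule_hom U V,
    fmap (R_functor Q) (f : Hom (c := lmodule_moncat Q) U V) = u.
Proof.
pose F (z : tens U H) : tens V H := (comod_hom u : bimodule_hom _ _) z.
have FL : linear F by exact: (lhom_lin (comod_hom u)).
have FR h z : F (ract h (z : btens Q (triv Q U) (regular H))) =
    ract h (F z : btens Q (triv Q V) (regular H)).
  exact: (bhom_ract (comod_hom u)).
have FA h z : F (lact h (z : btens Q (triv Q U) (regular H))) =
    lact h (F z : btens Q (triv Q V) (regular H)).
  exact: (lhom_act (comod_hom u)).
pose f v := cofree_pr (F (v \ox 1)).
have pB := @tpure_bilin k U H.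
have fL : linear f.
  by apply: (lin_comp (@cofree_pr_lin _)); apply: (lin_comp FL); exact: (bilin_l pB).
have FE : forall z, cofree_pr (F z) = f (cofree_pr z).
  apply: tens_ext => [||v h].
  - exact: (lin_comp (@cofree_pr_lin _)).
  - apply: (lin_comp _ (@cofree_pr_lin _)); apply: (lin_comp (@cofree_pr_lin _)).
    by apply: (lin_comp FL); exact: (bilin_l pB).
  have -> : v \ox h = ract h (v \ox 1 : btens Q (triv Q U) (regular H)).
    by rewrite R_ract mul1r.
  rewrite FR (@cofree_pr_ract (triv Q V)) R_ract mul1r cofree_pr_pure.
  by rewrite (linZ fL).
have fA h v : f (lact h v) = lact h (f v).
  have pv : cofree_pr (v \ox 1) = v by rewrite cofree_pr_pure (eps_mon Q).1 scale1r.
  rewrite -[in LHS]pv -(@cofree_pr_lact (triv Q U)) -FE FA.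
  exact: (@cofree_pr_lact (triv Q V)).
exists (LModuleHom fL fA); apply: comodule_hom_eq; apply: bimodule_hom_eq => z.
have := cofree_hom_prE u z; rewrite -[LHS]/(F z) => uE.
rewrite -[RHS]/(F z) uE -[LHS]/(tmap f id z) -{1}[z](@cofree_rho_pr (triv Q U)).
rewrite tmap_comp //; last exact: cofree_pr_lin.
by apply: eq_tmap => // y /=; rewrite -FE.
Qed.

Section Unit.
Variables (A : lmodule H) (ev : tens A H -> k^o) (d : tens H A).
Hypotheses (evL : linear ev)
  (ev_act : forall h t, ev (tmap2 (@lact _ _ A) *%R (Delta Q h) t) = ep h * ev t)
  (d_act : forall h, tmap2 *%R (@lact _ _ A) (Delta Q h) d = eps Q h *: d)
  (d_dual : tscaler (tmap id ev
     (op3 *%R (@lact _ _ A) *%R (phi Q) (tassoc (d \ox 1)))) = 1).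

Variable M : comodule (regular_coalgebra Q).
Local Notation V := (coinv_mod Q (comod M)).
Local Notation X := (R_functor Q V : comodule (regular_coalgebra Q)).

Definition hopf_unit : comodule_hom M X :=
  @cofree_lift _ (regular_coalgebra Q) M (triv Q V) (coinv_pi Q (comod M)).

Definition hopf_unit_fun (m : comod M) : tens V H :=
  (comod_hom hopf_unit : bimodule_hom _ _) m.

Lemma hopf_unitE m : hopf_unit_fun m = tmap (@cpi _ _ Q (comod M)) id (rho m).
Proof. by []. Qed.

Lemma hopf_unit_lin : linear hopf_unit_fun.
Proof. exact: (lhom_lin (comod_hom hopf_unit)). Qed.

(** [recon] descends to M / MH^+ in its first argument, and the induced map is a left inverse by
    [recon_rho]. *)
Lemma hopf_unit_inj : injective hopf_unit_fun.
Proof.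
have cL := @cpi_lin _ _ Q (comod M); have iL := @lin_id k H.
have rcB := @recon_bilin _ _ Q A ev d evL M.
pose r h : V -> comod M := clift (fun m => recon ev d m h).
have rI h : eps_invariant Q (fun m => recon ev d m h : comod M).
  by split=> [|j m]; [exact: (bilin_l rcB h)|exact: (recon_ract evL d_act)].
have rB : bilin (fun v h => r h v).
  apply: bilinI => [h|v]; first exact: (clift_lin (rI h)).
  rewrite -(creprK v) => a h h'; rewrite /r !clift_pi //.
  exact: (bilin_r rcB).
have K : cancel hopf_unit_fun (tlift (fun v h => r h v)).
  move=> m; rewrite hopf_unitE -[RHS](recon_rho evL ev_act d_dual).
  move: (rho m); apply: tens_ext => [||u h].
  - by apply: (lin_comp (tlift_lin rB)); exact: tmap_lin.
  - exact: tlift_lin.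
  by rewrite tmap_pure // !tlift_pure // /r clift_pi.
exact: can_inj K.
Qed.

(* Modulo X H^+, which [recon] kills, every element of X = R(M / MH^+) comes  *)
(* from M; hence [recon] takes its values in the image of M, and so does      *)
(* x = recon x_0 x_1.                                                         *)
Lemma hopf_unit_surj x : exists m, hopf_unit_fun m = x.
Proof.
have rcB := @recon_bilin _ _ Q A ev d evL X.
have hL := hopf_unit_lin.
have im_add y z : (exists m, hopf_unit_fun m = y) -> (exists m, hopf_unit_fun m = z) ->
    exists m, hopf_unit_fun m = y + z.
  by move=> [m <-] [n <-]; exists (m + n); rewrite (linD hL).
have recR (v : V) g h : recon ev d (v \ox g : comod X) h =
    eps Q g *: recon ev d (v \ox 1 : comod X) h.
  by rewrite -(recon_ract evL d_act) R_ract mul1r.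
have im_recon y h : exists m, hopf_unit_fun m = recon ev d (y : comod X) h.
  move: y; apply: tens_ind => [v g|s t IHs IHt]; last first.
    by rewrite (bilDl rcB); exact: im_add.
  (* For a representative m of v, naturality sends [recon m h] to [recon] of the unit of m, which is
     v (x) 1 modulo X H^+. *)
  rewrite -(creprK v); exists (eps Q g *: recon ev d (crepr v) h).
  rewrite recR (linZ hL); congr (_ *: _).
  have -> : hopf_unit_fun (recon ev d (crepr v) h) =
      recon ev d (hopf_unit_fun (crepr v) : comod X) h.
    exact: (recon_nat d evL hopf_unit (crepr v) h).
  have cL := @cpi_lin _ _ Q (comod M); have iL := @lin_id k H.
  have pB := @tpure_bilin k V H; have eL := eps_lin Q.
  rewrite hopf_unitE -[in RHS](rho_counit (crepr v)).
  move: (rho (crepr v)); apply: tens_ext => [||u j].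
  - by apply: (lin_comp (bilin_l rcB h)); exact: tmap_lin.
  - apply: (lin_comp (bilin_l rcB h)); apply: (lin_comp (bilin_l pB 1)).
    apply: (lin_comp cL); apply: (lin_comp (@tscaler_lin _ _)); exact: tmap_lin.
  have -> : tmap (@cpi _ _ Q (comod M)) id (u \ox j) = cpi Q u \ox j by exact: tmap_pure.
  have -> : tscaler (tmap id ep (u \ox j)) = eps Q j *: u by exact: cofree_pr_pure.
  rewrite (recR (cpi Q u) j h) (linZ cL).
  have -> : (eps Q j *: cpi Q u) \ox 1 = eps Q j *: (cpi Q u \ox 1) :> tens V H.
    exact: (linZ (bilin_l pB 1)).
  by symmetry; exact: (linZ (bilin_l rcB h)).
rewrite -[x](@recon_rho _ _ _ _ _ _ evL ev_act d_dual X).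
move: (rho _); apply: tens_ind => [y h|s t IHs IHt].
  by rewrite (tlift_pure _ _ rcB); exact: im_recon.
by rewrite (linD (tlift_lin rcB)); exact: im_add.
Qed.

End Unit.
End Functor_R.

Lemma fin_dim_vect (k : fieldType) (V : vectType k) : fin_dim V.
Proof.
exists (\dim {:V}), (fun i => (vbasis {:V})`_i) => v.
by exists (fun i => coord (vbasis {:V}) i v); exact: coord_vbasis (memvf v).
Qed.

(** Rigidity is applied to the regular module; d is the coevaluation at 1, and [dD] is a triangle
    identity evaluated at 1. *)
Lemma rigid_equivalence (k : fieldType) (H : falgType k) (Q : quasibialgebra H) :
  rigid (fin_lmodule_moncat Q) -> is_equivalence (R_functor Q).
Proof.
move=> /(_ (exist _ (lregular H) (fin_dim_vect H)))[[[A Af] ev db dl _]].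
apply: equivalence_of_fully_faithful.
- exact: R_faithful.
- exact: R_full.
move=> M; exists (coinv_mod Q (comod M)).
pose e : tens A H -> k^o := lhom ev.
pose d' : k^o -> tens H A := lhom (db : lmodule_hom (lunit Q) (ltens Q (lregular H) A)).
have d'L : linear d' := lhom_lin (db : lmodule_hom (lunit Q) (ltens Q (lregular H) A)).
pose d := d' 1.
have eL : linear e := lhom_lin ev.
have eA h t : e (tmap2 (@lact _ _ A) *%R (Delta Q h) t) = eps Q h * e t.
  exact: (lhom_act ev).
have dA h : tmap2 *%R (@lact _ _ A) (Delta Q h) d = eps Q h *: d.
  rewrite -[LHS](lhom_act (db : lmodule_hom (lunit Q) (ltens Q (lregular H) A)) h 1).
  by rewrite -(linZ d'L).
have dD : tscaler (tmap id e (op3 *%R (@lact _ _ A) *%R (phi Q) (tassoc (d \ox 1)))) = 1 :> H.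
  have := congr1 (fun f : lmodule_hom (lregular H) (lregular H) => f 1) dl.
  have E : tmap d' id ((1 : k^o) \ox (1 : H)) = d \ox 1.
    by apply: tmap_pure; [exact: d'L|exact: lin_id].
  by rewrite -E => /= E1; exact: E1.
have [i] : inhabited (isom (C := hopf_module_cat Q) M (R_functor Q (coinv_mod Q (comod M)))).
  apply: (@hopf_module_isom _ _ _ _ _ (hopf_unit M)).
    exact: (hopf_unit_inj eL eA dA dD).
  exact: (hopf_unit_surj eL eA dA dD).
by constructor; exact: (Isom (bwdK i) (fwdK i)).
Qed.

(** * The quasiantipode *)

Section FinDim.
Variable k : fieldType.

Lemma fin_dim_image (U V : lmodType k) (f : U -> V) : linear f ->
  (forall v, exists u, v = f u) -> fin_dim U -> fin_dim V.
Proof.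
move=> fL fS [n [e eP]]; exists n, (fun i => f (e i)) => v.
have [u ->] := fS v; have [c ->] := eP u; exists c.
by rewrite (lin_sum fL); apply: eq_bigr => i _; rewrite (linZ fL).
Qed.

Lemma fin_dim_coord (V : lmodType k) : fin_dim V ->
  exists (W : vectType k) (f : V -> W) (g : W -> V),
    [/\ linear f, linear g, cancel f g & cancel g f].
Proof.
move=> /fin_dim_basis[n [e [c [cL cE ce]]]].
pose f v : {ffun 'I_n -> k^o} := [ffun i => c i v].
pose g (w : {ffun 'I_n -> k^o}) := \sum_i (w i : k) *: e i.
exists {ffun 'I_n -> k^o}, f, g; split=> [a x y|a x y|v|w].
- by apply/ffunP => i; rewrite !ffunE cL.
- rewrite /g scaler_sumr -big_split; apply: eq_bigr => i _ /=.
  by rewrite !ffunE scalerDl scalerA.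
- by rewrite [RHS]cE; apply: eq_bigr => i _; rewrite ffunE.
- apply/ffunP => i; rewrite ffunE (lin_sum (cL i)) (bigD1 i) //=.
  rewrite (linZ (cL i)) ce eqxx big1 ?addr0 => [|j /negPf ji]; first exact: mulr1.
  by rewrite (linZ (cL i)) ce eq_sym ji; exact: mulr0.
Qed.

Lemma fin_dim_surj_inj (V : lmodType k) (f : V -> V) : fin_dim V -> linear f ->
  (forall y, exists x, y = f x) -> injective f.
Proof.
move=> /fin_dim_coord[W [p [q [pL qL pK qK]]]] fL fS.
have hL : linear (fun w => p (f (q w))).
  by apply: (lin_comp pL); exact: lin_comp.
pose h := lfun_of hL.
have hS : limg h = fullv.
  apply/eqP; rewrite eqEsubv subvf; apply/subvP => w _.
  have [x xE] := fS (q w); rewrite -[w]qK xE -[x]pK -(lfun_ofE hL).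
  exact: memv_img (memvf _).
have : \dim (lker h) == 0%N.
  have := limg_ker_dim h fullv; rewrite hS capfv => /eqP.
  by rewrite -[X in _ == X]add0n eqn_add2r.
rewrite dimv_eq0 => /lker0P hI x y xy; apply: (can_inj pK); apply: hI.
by rewrite !lfun_ofE !pK xy.
Qed.

End FinDim.

(** * Counit identities for phi, and coactions of generators of P (x) H and R(V) *)

Section EpsPhi.
Variables (k : fieldType) (H : algType k) (Q : quasibialgebra H).
Local Notation ep := (eps Q : H -> k^o).

Definition eps_l (W : lmodType k) (s : tens H W) : W := tscalel (tmap ep id s).

Lemma eps_l_lin W : linear (@eps_l W).
Proof.
apply: (lin_comp (@tscalel_lin _ _)); apply: tmap_lin => //; exact: eps_lin.
Qed.

Lemma eps_l_pure (W : lmodType k) h (w : W) : eps_l (h \ox w) = eps Q h *: w.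
Proof. by rewrite /eps_l tmap_pure ?tscalel_pure //; exact: eps_lin. Qed.

Lemma lunit_ten (X Y : lmodule H) (t : tens (tens k^o X) Y) :
  tscalel (@lassoc _ _ Q (lunit Q) X Y t) = tmap (@tscalel _ _) id t.
Proof.
exact: (congr1 (fun f : lmodule_hom (ltens Q (ltens Q (lunit Q) X) Y) (ltens Q X Y) =>
  lhom f t) (@mlunit_ten (lmodule_moncat Q) X Y)).
Qed.

(** [phi_eps] has eps in the middle; with eps on the left, this is the coherence [mlunit_ten] for
    two regular modules, evaluated at 1. *)
Lemma eps_l_phi : eps_l (phi Q) = tone2 H.
Proof.
have := @lunit_ten (lregular H) (lregular H) (1 \ox 1 \ox 1).
have sL := @tscalel_lin k H; have iL := @lin_id k H.
have -> : tmap (@tscalel k H) id ((1 : k^o) \ox (1 : H) \ox (1 : H)) = tone2 H.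
  by rewrite tmap_pure // tscalel_pure scale1r.
move=> <-; rewrite /lassoc tassoc_pure.
have eB := eps_act_bilin Q; have mB := @mul_bilin k H.
have m2B := @tmul2_bilin k H; have B := tmap2_bilin eB m2B.
move: (phi Q); apply: tens_ext => [||h s].
- exact: eps_l_lin.
- by apply: (lin_comp (@tscalel_lin _ _)); exact: (bilin_l B).
rewrite eps_l_pure tmap2_pure // tscalel_pure.
rewrite -[tmap2 _ _ s _]/(tmul2 s (tone2 H)) tmul2_1r.
by rewrite -[X in _ = X *: _]/(eps Q h * 1) mulr1.
Qed.

Lemma eps_l_phiV : eps_l (phiV Q) = tone2 H.
Proof.
have := @lunit_ten (lregular H) (lregular H)
  (@lassocV _ _ Q (lunit Q) (lregular H) (lregular H) (1 \ox (1 \ox 1))).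
have sL := @tscalel_lin k H; have iL := @lin_id k H.
rewrite lassocVK tscalel_pure scale1r -/(tone2 H) => ->.
have eB := eps_act_bilin Q; have mB := @mul_bilin k H.
have m2B := @tmul2_bilin k H; have pB := @tpure_bilin k H H.
have B := tmap2_bilin eB m2B; have B2 := tmap2_bilin mB mB.
rewrite /lassocV; move: (phiV Q); apply: tens3_ext => [||x y z].
- exact: eps_l_lin.
- apply: (lin_comp (tmap_lin sL iL)); apply: (lin_comp (@tassocV_lin _ _ _ _)).
  exact: (bilin_l B).
rewrite eps_l_pure !tmap2_pure // tassocV_pure tmap_pure // tscalel_pure.
by rewrite /= !mulr1 (linZ (bilin_l pB _)).
Qed.

End EpsPhi.

Section EpsRegular.
Variables (k : fieldType) (H : algType k) (Q : quasibialgebra H).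
Local Notation ep := (eps Q : H -> k^o).
Local Notation rmul := (fun h v : H => v * h).
Let mB := @mul_bilin k H.

Fact epsl_bilin (V : lmodType k) : bilin (fun (h : H) (v : V) => eps Q h *: v).
Proof.
apply: bilinI => x a y z; first by rewrite (eps_lin Q) scalerDl scalerA.
by rewrite scalerDr !scalerA mulrC.
Qed.

Fact epsl_1 v : eps Q 1 *: v = v :> H.
Proof. by rewrite (eps_mon Q).1 scale1r. Qed.

Fact epsl_M g h v : eps Q (g * h) *: v = eps Q g *: (eps Q h *: v) :> H.
Proof. by rewrite (eps_mon Q).2 scalerA. Qed.

(** The bimodule P. As its left action goes through eps, left multiplications are bimodule maps;
    they induce the second action on V. *)
Definition eps_regular : bimodule H :=
  @BiModule k H (@LModule k H H _ (@epsl_bilin H) epsl_1 epsl_M) rmul (bilin_flip mB)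
    (@mulr1 H) (fun g h v => mulrA v g h) (fun g h v => scalerAl _ _ _).

Definition eps_regular_mul (q : H) : bimodule_hom eps_regular eps_regular :=
  @BiModuleHom k H eps_regular eps_regular
    (@LModuleHom k H eps_regular eps_regular ( *%R q) (bilin_r mB q)
      (fun h u => esym (scalerAr _ _ _))) (fun h u => mulrA q u h).

Lemma eps_regular_lact h p g :
  lact h (p \ox g : btens Q eps_regular (regular H)) = p \ox (h * g).
Proof.
rewrite -[in RHS](eps_Delta Q h) /= /ltens_act.
have pB := @tpure_bilin k H H; have eB := @epsl_bilin H.
move: (Delta Q h); apply: tens_ext => [||h1 h2].
- exact: (bilin_l (tmap2_bilin eB mB)).
- apply: (lin_comp (bilin_r pB p)); apply: (lin_comp (bilin_l mB g)).
  exact: eps_l_lin.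
rewrite tmap2_pure // -/(eps_l Q _) eps_l_pure -scalerAl (linZ (bilin_r pB _)).
exact: (linZ (bilin_l pB _)).
Qed.

Lemma eps_act_l2 (V W : lmodType k) (f : H -> V -> V) (g : tens H H -> W -> W) s v w :
  (forall h v, f h v = eps Q h *: v) -> bilin g ->
  tmap2 f g s (v \ox w) = v \ox g (eps_l Q s) w.
Proof.
move=> fE gB; have {fE} -> : f = fun h v => eps Q h *: v.
  by apply/funext => h; apply/funext.
have eB := @epsl_bilin V; have pB := @tpure_bilin k V W.
move: s; apply: tens_ext => [||h t].
- exact: (bilin_l (tmap2_bilin eB gB)).
- apply: (lin_comp (bilin_r pB v)); apply: (lin_comp (bilin_l gB w)).
  exact: eps_l_lin.
rewrite tmap2_pure // eps_l_pure (linZ (bilin_l gB _)).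
by rewrite (linZ (bilin_l pB _)) (linZ (bilin_r pB _)).
Qed.

(** In phi^-1 (1 (x) 1 (x) 1) phi the left factor acts on P through eps and disappears by
    [eps_l_phiV]. *)
Lemma rho_eps_regular :
  @rho _ _ _ (cofree (regular_coalgebra Q) eps_regular) (1 \ox 1) = tassocV (phi Q).
Proof.
have rB : bilin rmul := bilin_flip mB.
have m2B := @tmul2_bilin k H; have r2B := tmap2_bilin rB rB.
have DL := Delta_lin Q.
rewrite -[LHS]/(@bassocV _ _ Q eps_regular (regular H) (regular H)
  (tmap id (Delta Q) (1 \ox 1))) /bassocV tmap_pure // Delta_1.
have -> : tmap2 (@ract _ _ eps_regular) (tmap2 rmul rmul) (phi Q) (1 \ox tone2 H) = phi Q.
  rewrite -[RHS](@tmul3_1l k H) /tmul3 (tmap2_flip mB m2B).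
  by apply: eq_tmap2 => // s t; rewrite /tmul2 [RHS](tmap2_flip mB mB).
rewrite /lassocV; congr tassocV.
move: (phi Q); apply: tens_ext => //.
  exact: (bilin_r (tmap2_bilin (@epsl_bilin H) m2B)).
move=> x t; rewrite (@eps_act_l2 H (tens H H) _ (@tmul2 k H)) //.
by rewrite eps_l_phiV tmul2_1l.
Qed.

Lemma rho_R (V : lmodule H) (v : V) :
  @rho _ _ _ (R_functor Q V) (v \ox 1 : btens Q (triv Q V) (regular H)) =
  tassocV (tmap2 (@lact _ _ V) (@tmul2 k H) (phiV Q) (v \ox tone2 H)).
Proof.
have rB : bilin rmul := bilin_flip mB.
have r2B := tmap2_bilin rB rB; have DL := Delta_lin Q.
rewrite -[LHS]/(@bassocV _ _ Q (triv Q V) (regular H) (regular H)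
  (tmap id (Delta Q) (v \ox 1))) /bassocV tmap_pure // Delta_1.
rewrite (@eps_act_l2 V (tens H H) _ (tmap2 rmul rmul)) //.
have -> : tmap2 rmul rmul (eps_l Q (phi Q)) (tone2 H) = tone2 H.
  by rewrite eps_l_phi tmap2_pure // mulr1.
by [].
Qed.

End EpsRegular.

(** * From an isomorphism of R(V) with P (x) H to a quasiantipode *)

Section Quasiantipode.
Variables (k : fieldType) (H : falgType k) (Q : quasibialgebra H).
Local Notation ep := (eps Q : H -> k^o).
Local Notation P := (eps_regular Q).
Local Notation PH := (btens Q P (regular H)).
Local Notation M := (cofree (regular_coalgebra Q) P).
Variable V : lmodule H.
Local Notation VH := (btens Q (triv Q V) (regular H)).
Local Notation RV := (R_functor Q V : comodule (regular_coalgebra Q)).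
Variable psi : isom (C := hopf_module_cat Q) RV M.
Variable acth : H -> lmodule_hom V V.

Definition psif (z : tens V H) : tens H H :=
  (comod_hom (fwd psi : comodule_hom RV M) : bimodule_hom VH PH) z.
Definition psib (y : tens H H) : tens V H :=
  (comod_hom (bwd psi : comodule_hom M RV) : bimodule_hom PH VH) y.

Hypothesis psi_acth : forall q z,
  psif (tmap (acth q) id z) = tmap ( *%R q) id (psif z).

Local Notation act q := (lhom (acth q)).

Let mB := @mul_bilin k H.
Let lB := @lact_bilin k H V.

Lemma psifK : cancel psif psib.
Proof.
move=> z; exact: (congr1 (fun f : comodule_hom RV RV =>
  (comod_hom f : bimodule_hom VH VH) z) (fwdK psi)).
Qed.

Lemma psibK : cancel psib psif.
Proof.
move=> z; exact: (congr1 (fun f : comodule_hom M M =>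
  (comod_hom f : bimodule_hom PH PH) z) (bwdK psi)).
Qed.

Lemma psif_lin : linear psif.
Proof. exact: (lhom_lin (comod_hom (fwd psi : comodule_hom RV M) : bimodule_hom VH PH)). Qed.

Lemma psib_lin : linear psib.
Proof. exact: (lhom_lin (comod_hom (bwd psi : comodule_hom M RV) : bimodule_hom PH VH)). Qed.

Lemma psi_actb q y : psib (tmap ( *%R q) id y) = tmap (act q) id (psib y).
Proof. by rewrite -[y in LHS]psibK -psi_acth psifK. Qed.

Definition vpi (y : tens H H) : V := cofree_pr Q (psib y).
Definition vtau (z : tens V H) : H := cofree_pr Q (psif z).

Lemma vpi_lin : linear vpi.
Proof. exact: (lin_comp (@cofree_pr_lin _ _ Q V) psib_lin). Qed.

Lemma vtau_lin : linear vtau.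
Proof. exact: (lin_comp (@cofree_pr_lin _ _ Q H) psif_lin). Qed.

Lemma cofree_pr_nat (U W : lmodType k) (f : U -> W) z : linear f ->
  cofree_pr Q (tmap f id z) = f (cofree_pr Q z).
Proof.
move=> fL; have iL := @lin_id k H; move: z; apply: tens_ext => [||u h].
- by apply: (lin_comp (@cofree_pr_lin _ _ _ _)); exact: tmap_lin.
- by apply: (lin_comp fL); exact: cofree_pr_lin.
by rewrite tmap_pure // !cofree_pr_pure (linZ fL).
Qed.

Lemma vpi_mul q y : vpi (tmap ( *%R q) id y) = act q (vpi y).
Proof. by rewrite /vpi psi_actb cofree_pr_nat //; exact: lhom_lin. Qed.

Lemma vtau_act q z : vtau (tmap (act q) id z) = q * vtau z.
Proof. by rewrite /vtau psi_acth cofree_pr_nat //; exact: bilin_r. Qed.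

Lemma vpi_lact h y : vpi (lact h (y : PH)) = lact h (vpi y).
Proof.
rewrite -(@cofree_pr_lact _ _ _ (triv Q V)); congr cofree_pr.
exact: (lhom_act (comod_hom (bwd psi : comodule_hom M RV) : bimodule_hom PH VH)).
Qed.

Lemma vpi_ract h y : vpi (ract h (y : PH)) = eps Q h *: vpi y.
Proof.
rewrite -[RHS](@cofree_pr_ract _ _ _ (triv Q V)); congr cofree_pr.
exact: (bhom_ract (comod_hom (bwd psi : comodule_hom M RV) : bimodule_hom PH VH)).
Qed.

Lemma vtau_lact h z : vtau (lact h (z : VH)) = eps Q h *: vtau z.
Proof.
rewrite -[RHS](@cofree_pr_lact _ _ _ P); congr cofree_pr.
exact: (lhom_act (comod_hom (fwd psi : comodule_hom RV M) : bimodule_hom VH PH)).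
Qed.

Lemma vtau_ract h z : vtau (ract h (z : VH)) = vtau z * h.
Proof.
rewrite -[RHS](@cofree_pr_ract _ _ _ P); congr cofree_pr.
exact: (bhom_ract (comod_hom (fwd psi : comodule_hom RV M) : bimodule_hom VH PH)).
Qed.

Lemma psif_rho z : psif z = tmap vtau id (@rho _ _ _ RV z).
Proof. exact: (@cofree_hom_prE _ _ Q RV P (fwd psi) z). Qed.

Lemma psib_rho y : psib y = tmap vpi id (@rho _ _ _ M y).
Proof. exact: (@cofree_hom_prE _ _ Q M (triv Q V) (bwd psi) y). Qed.

Lemma cofree_pr1 (U : lmodType k) (u : U) : cofree_pr Q (u \ox 1) = u.
Proof. by rewrite cofree_pr_pure (eps_mon Q).1 scale1r. Qed.

(** [acth] is a mere family compatible with psi; this formula shows that it is linear in q and a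
    module structure. *)
Lemma actE q v : act q v = vpi (tmap ( *%R q) id (psif (v \ox 1))).
Proof.
rewrite vpi_mul /vpi psifK; congr (act q _); by rewrite cofree_pr1.
Qed.

Lemma act_bilin : bilin (fun q v => act q v).
Proof.
have iL := @lin_id k H.
apply: bilinI => [v|q]; last exact: lhom_lin.
move=> a q q'; rewrite !actE -vpi_lin; congr vpi.
have pB := @tpure_bilin k H H.
move: (psif _); apply: tens_ext => [||x y].
- by apply: tmap_lin => //; exact: bilin_r.
- by apply: lin_add; [apply: lin_scale|]; apply: tmap_lin => //; exact: bilin_r.
rewrite !tmap_pure //; try exact: bilin_r.
by rewrite (bilin_l mB) (bilin_l pB).
Qed.

Lemma act1v v : act 1 v = v.
Proof.
rewrite actE -[RHS](@cofree_pr1 V) -[v \ox 1 in RHS]psifK -/(vpi _).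
congr vpi; rewrite -[RHS]tmap_id; apply: eq_tmap => // x; exact: mul1r.
Qed.

Lemma actMv q q' v : act (q * q') v = act q (act q' v).
Proof.
have iL := @lin_id k H.
rewrite (actE (q * q')) (actE q' v) -vpi_mul; congr vpi.
rewrite tmap_comp //; try exact: bilin_r.
by apply: eq_tmap => // x; rewrite /= mulrA.
Qed.

Lemma fin_dim_V : fin_dim V.
Proof.
apply: (fin_dim_image vpi_lin (U := tens H H)).
  by move=> v; exists (psif (v \ox 1)); rewrite /vpi psifK cofree_pr1.
exact: (@fin_dim_tens k H Q (lregular H) (lregular H) (fin_dim_vect H) (fin_dim_vect H)).
Qed.

(* V (x) H is isomorphic to P (x) H, so that n := dim H elements generate V^n *)
(* over H.                                                                    *)
Lemma act_cyclic : exists v0, forall v, exists q, v = act q v0.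
Proof.
have aB := act_bilin; have iL := @lin_id k H.
have [W [f [g [fL gL fK gK]]]] := fin_dim_coord fin_dim_V.
pose n := \dim {:H}; pose b (i : 'I_n) : H := (vbasis {:H})`_i.
pose l (i : 'I_n) (h : H) : k^o := coord (vbasis {:H}) i h.
have lL i : linear (l i) by move=> a x y; rewrite /l linearP.
have lE h : h = \sum_i (l i h : k) *: b i by exact: coord_vbasis (memvf h).
have lb i j : l i (b j) = (i == j)%:R.
  by rewrite /l /b coord_free ?(basis_free (vbasisP _)) // eq_sym.
pose comp (X : lmodType k) i (z : tens X H) : X := tscaler (tmap id (l i) z).
have compL X i : linear (@comp X i).
  by apply: (lin_comp (@tscaler_lin _ _)); exact: tmap_lin.
have comp_pure (X : lmodType k) i (x : X) h : comp X i (x \ox h) = (l i h : k) *: x.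
  by rewrite /comp tmap_pure ?tscaler_pure.
have comp_nat (X Y : lmodType k) i (u : X -> Y) z : linear u ->
    comp Y i (tmap u id z) = u (comp X i z).
  move=> uL; move: z; apply: tens_ext => [||x h].
  - by apply: (lin_comp (compL Y i)); exact: tmap_lin.
  - by apply: (lin_comp uL); exact: (compL X i).
  by rewrite tmap_pure // !comp_pure (linZ uL).
have compE y : y = \sum_j comp H j y \ox b j.
  have pB := @tpure_bilin k H H; move: y; apply: tens_ext => [||x h] //.
    move=> a u v; rewrite scaler_sumr -big_split; apply: eq_bigr => j _ /=.
    by rewrite compL (bilin_l pB).
  rewrite {1}[h]lE (lin_sum (bilin_r pB x)); apply: eq_bigr => j _.
  by rewrite comp_pure (linZ (bilin_r pB _)) (linZ (bilin_l pB _)).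
pose th j i : W := f (comp V i (psib (1 \ox b j))).
pose actW q (w : W) : W := f (act q (g w)).
have aWB : bilin actW.
  apply: (bilin_post (p := f)) => //.
  exact: (bilin_comp aB (@lin_id k H) gL).
have n0 : (0 < n)%N.
  rewrite lt0n dimv_eq0; apply: contraTN isT => /eqP H0.
  by have := memvf (1 : H); rewrite H0 memv0 oner_eq0.
have aW1 w : actW 1 w = w by rewrite /actW act1v gK.
have aWM q q' w : actW (q * q') w = actW q (actW q' w) by rewrite /actW fK actMv.
have [x|v0 v0E] := power_generated_cyclic aWB aW1 aWM (th := th) n0.
  (* z is the tuple x read in V (x) H; writing psi z as the sum of the q_j (x) b_j gives the
     coefficients q_j. *)
  pose z : tens V H := \sum_i g (x i) \ox b i.
  exists (fun j => comp H j (psif z)) => i.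
  have <- : f (comp V i z) = x i.
    rewrite /z (lin_sum (compL V i)) (bigD1 i) //= comp_pure lb eqxx scale1r.
    rewrite big1 ?addr0 ?gK // => j /negPf ji.
    by rewrite comp_pure lb eq_sym ji scale0r.
  rewrite -[z in LHS]psifK [psif z in LHS]compE (lin_sum psib_lin).
  rewrite (lin_sum (compL V i)) (lin_sum fL); apply: eq_bigr => j _.
  rewrite /actW /th fK; congr f; rewrite -comp_nat; last exact: lhom_lin.
  rewrite -psi_actb; congr (comp V i (psib _)).
  by rewrite tmap_pure ?mulr1 //; exact: bilin_r.
exists (g v0) => v; have [q vq] := v0E (f v); exists q.
exact: (can_inj fK).
Qed.

(** The map q (x) h |-> psi(q.v0 (x) h) is a surjective endomorphism of the finite-dimensional space
    H (x) H, hence injective. *)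
Lemma act_free v0 : (forall v, exists q, v = act q v0) ->
  injective (fun q => act q v0).
Proof.
move=> v0E; have aL := bilin_l act_bilin v0; have iL := @lin_id k H.
have tL := tmap_lin aL iL.
have fL : linear (fun y => psif (tmap (fun q => act q v0) id y)).
  exact: (lin_comp psif_lin tL).
have tS : forall z : tens V H, exists y : tens H H, z = tmap (fun q => act q v0) id y.
  apply: tens_ind => [v h|s t [y ->] [y' ->]]; last first.
    by exists (y + y'); rewrite (linD tL).
  by have [q ->] := v0E v; exists (q \ox h); rewrite tmap_pure.
have fI := fin_dim_surj_inj
  (@fin_dim_tens k H Q (lregular H) (lregular H) (fin_dim_vect H) (fin_dim_vect H)) fL.
have {}fI : injective (fun y => psif (tmap (fun q => act q v0) id y)).
  by apply: fI => y; have [x yx] := tS (psib y); exists x; rewrite -yx psibK.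
move=> q q' qq; rewrite -[q]cofree_pr1 -[q']cofree_pr1; congr cofree_pr.
by apply: fI; rewrite !tmap_pure // qq.
Qed.

Lemma quasi_hopf_of_isom : is_quasi_hopf Q.
Proof.
have [v0 v0E] := act_cyclic; have v0I := act_free v0E; have aB := act_bilin.
have aL := bilin_l aB v0; have iL := @lin_id k H.
have /choice[S SE] h := v0E (lact h v0).
have [beta betaE] := v0E (vpi (1 \ox 1)).
pose alpha := vtau (v0 \ox 1).
have pH := @tpure_bilin k H H; have pV := @tpure_bilin k V H.
have S_lin : linear S.
  move=> a x y; apply: v0I; rewrite -SE (bilin_l lB) !SE.
  by rewrite -(bilin_l aB v0).
(* The two actions on V commute, which reverses the factors. *)
have S_anti g h : S (g * h) = S h * S g.
  by apply: v0I; rewrite -SE lactM (SE h) -lhom_act (SE g) actMv.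
have vpiE p h : vpi (p \ox h) = act (p * beta * S h) v0.
  have -> : p \ox h = tmap ( *%R p) id (lact h ((1 : H) \ox (1 : H) : PH)) :> tens H H.
    by rewrite eps_regular_lact mulr1 tmap_pure ?mulr1 //; exact: bilin_r.
  by rewrite vpi_mul vpi_lact betaE -lhom_act SE -!actMv ?mulrA.
have vtauE q h : vtau (act q v0 \ox h) = q * alpha * h.
  have -> : act q v0 \ox h = tmap (act q) id (ract h (v0 \ox 1 : VH)).
    by rewrite R_ract mul1r tmap_pure //; exact: lhom_lin.
  by rewrite vtau_act vtau_ract mulrA.
have bB : bilin (fun h1 h2 => h1 * beta * S h2).
  by apply: (bilin_comp mB (p := fun h => h * beta)) => //; exact: bilin_l.
have cB : bilin (fun h1 h2 => S h1 * alpha * h2).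
  apply: (bilin_comp mB (p := fun h => S h * alpha)) => //.
  by apply: (lin_comp (bilin_l mB alpha)).
exists S, alpha, beta; split=> //.
- by apply: v0I; rewrite -SE lact1 act1v.
(* Apply vtau to h (v0 (x) 1): the left action on P goes through eps. *)
- move=> h; have vtL := vtau_lin.
  have <- : vtau (lact h (v0 \ox 1 : VH)) = eps Q h *: alpha by rewrite vtau_lact.
  rewrite /= /ltens_act; have lmB := tmap2_bilin lB mB.
  move: (Delta Q h); apply: tens_ext => [||h1 h2]; first exact: tlift_lin.
    by apply: (lin_comp vtL); exact: (bilin_l lmB).
  rewrite tlift_pure // tmap2_pure // SE -[X in _ \ox X]/(h2 * 1) mulr1.
  by rewrite vtauE.
(* Apply vpi to (1 (x) 1) h: the right action on V goes through eps. *)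
- move=> h; apply: v0I; have vpL := vpi_lin.
  rewrite (linZ aL) -betaE -vpi_ract.
  have -> : ract h ((1 : H) \ox (1 : H) : PH) = Delta Q h.
    have rB := bilin_flip mB.
    rewrite -[RHS]tmul2_1l; apply: esym; exact: (tmap2_flip mB mB).
  move: (Delta Q h); apply: tens_ext => [||h1 h2].
  - by apply: (lin_comp aL); exact: tlift_lin.
  - exact: vpL.
  by rewrite tlift_pure // vpiE.
(* This is psi psi^-1 = id at 1 (x) 1, whose coaction is phi. *)
- have vpL := vpi_lin; have vtL := vtau_lin.
  have := congr1 vtau (psib_rho (1 \ox 1)).
  rewrite rho_eps_regular /vtau psibK cofree_pr1 => ->.
  rewrite -[LHS]/(tlift3 (fun x y z => x * beta * S y * alpha * z) (phi Q)) -/(vtau _).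
  move: (phi Q); apply: tens3_ext => [||x y z].
  - apply: tlift3_lin => [y z a u u'|x].
      by rewrite !(mulrDl, mulrDr) -!(scalerAl, scalerAr).
    apply: bilinI => [z|y] a u u'; last by rewrite mulrDr -scalerAr.
    by rewrite S_lin !(mulrDl, mulrDr) -!(scalerAl, scalerAr).
  - apply: (lin_comp vtL); apply: (lin_comp (tmap_lin vpL iL)).
    exact: tassocV_lin.
  rewrite tassocV_pure tmap_pure // vpiE vtauE tlift3_pure //.
  + move=> ? ? a u u'; by rewrite !(mulrDl, mulrDr) -!(scalerAl, scalerAr).
  + move=> x'; apply: bilinI => [z'|y'] a u u'; last by rewrite mulrDr -scalerAr.
    by rewrite S_lin !(mulrDl, mulrDr) -!(scalerAl, scalerAr).
(* This is psi^-1 psi = id at v0 (x) 1, whose coaction is phi^-1 (v0 (x) 1 (x) 1). *)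
- have vpL := vpi_lin; have vtL := vtau_lin.
  have m2B := @tmul2_bilin k H.
  apply: v0I; rewrite act1v.
  have := congr1 vpi (psif_rho (v0 \ox 1)).
  rewrite /vpi psifK cofree_pr1 -/(vpi _) rho_R => E; rewrite [RHS]E.
  rewrite -[tlift _ _]/(tlift3 (fun x y z => S x * alpha * y * beta * S z) (phiV Q)).
  have F1 y z : linear (fun x => S x * alpha * y * beta * S z).
    by move=> a u u'; rewrite S_lin !(mulrDl, mulrDr) -!(scalerAl, scalerAr).
  have F2 x : bilin (fun y z => S x * alpha * y * beta * S z).
    apply: bilinI => [z|y] a u u'.
      by rewrite !(mulrDl, mulrDr) -!(scalerAl, scalerAr).
    by rewrite S_lin mulrDr -scalerAr.
  move: (phiV Q); apply: tens3_ext => [||x y z].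
  - by apply: (lin_comp aL); exact: tlift3_lin.
  - apply: (lin_comp vpL); apply: (lin_comp (tmap_lin vtL iL)).
    apply: (lin_comp (@tassocV_lin _ _ _ _)).
    exact: (bilin_l (tmap2_bilin lB m2B)).
  rewrite tlift3_pure // tmap2_pure // /tmul2 tmap2_pure // tassocV_pure.
  by rewrite !mulr1 tmap_pure // SE vtauE vpiE.
Qed.

End Quasiantipode.

(** Take V = G(P (x) H): G carries the left multiplications of P to V, and naturality of psi is the
    compatibility [psi_acth]. *)
Lemma equivalence_quasi_hopf (k : fieldType) (H : falgType k) (Q : quasibialgebra H) :
  is_equivalence (R_functor Q) -> is_quasi_hopf Q.
Proof.
move=> [G [_ [psi]]].
pose M := cofree (regular_coalgebra Q) (eps_regular Q).
pose m q : Hom (c := hopf_module_cat Q) M M :=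
  cofree_map (regular_coalgebra Q) (eps_regular_mul Q q).
apply: (@quasi_hopf_of_isom k H Q (G M) (psi M) (fun q => fmap G (m q))) => q z.
exact: (congr1 (fun f : comodule_hom (R_functor Q (G M)) M =>
  (comod_hom f : bimodule_hom (btens Q (triv Q (G M)) (regular H))
     (btens Q (eps_regular Q) (regular H))) z) (nnat psi (m q))).
Qed.

Theorem theorem3p1 (k : fieldType) (H : falgType k) (Q : quasibialgebra H) :
  (is_quasi_hopf Q <-> rigid (fin_lmodule_moncat Q)) /\
  (rigid (fin_lmodule_moncat Q) <-> is_equivalence (R_functor Q)).
Proof.
have qr : is_quasi_hopf Q -> rigid (fin_lmodule_moncat Q).
  by move=> [S [alpha [beta SP]]]; exact: (quasi_hopf_rigid SP).
have re := @rigid_equivalence k H Q; have eq := @equivalence_quasi_hopf k H Q.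
split; split; auto.
Qed.
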